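(* Let $f,\phi,h,\mathcal{D}_{\mathrm{s}},U,\mathcal{D},\omega,V,\beta,\varphi,W$ be as in the context, with all standing assumptions there. Let $\Omega\subseteq\mathbb{R}^n$ be a compact set with $\mathcal{D}_{\mathrm{s}}\subseteq\Omega$. Let $\omega(x)=\theta(x)\frac{\|x\|^2}{(1-h(x))^k}$ with $k\ge1$ and $\theta\in C_b^1(\Omega;\mathbb{R}_+)$, let $$\tilde f(x)=f(x)\cdot\frac{(1-h(x))^k}{\theta(x)},$$ and let $\psi(t;x_0)$ be the solution of $\dot x=\tilde f(x)$ with $x(0)=x_0$. Then: (1) $\tilde V(x)=\int_0^\infty\|\psi(t;x)\|^2\,dt$ is the unique viscosity solution of $$-\nabla\tilde V(x)\cdot\tilde f(x)-\|x\|^2=0\ \text{ on }\mathcal{D},\qquad \tilde V(0)=0,$$ and $\tilde V(x)=V(x)$ for all $x\in\mathcal{D}$. (2) The function $\tilde W$ defined by $\tilde W(x)=\beta(\tilde V(x))$ for $x\in\mathcal{D}$ and $\tilde W(x)=1$ elsewhere is the unique viscosity solution on $\Omega$ of the Dirichlet problem $$\begin{cases}-\nabla\tilde W(x)\cdot\tilde f(x)-(1-\tilde W(x))\,\varphi(\beta(\tilde V(x)))\,\|x\|^2=0,\\ \tilde W(0)=0;\quad\tilde W(x)=1,\ x\in\partial\Omega.\end{cases}$$ Furthermore, $\tilde W(x)=W(x)$ for all $x\in\mathcal{D}_{\mathrm{s}}$.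
   Context: System. $\dot x=f(x)$ on $\mathbb{R}^n$ with $f:\mathbb{R}^n\to\mathbb{R}^n$ locally Lipschitz. $\phi(t;x)$ is the unique solution with $\phi(0;x)=x$, assumed to exist for all $t\in[0,\infty)$. The origin is a locally asymptotically stable equilibrium point, with domain of attraction $\mathcal{D}_0=\{x\in\mathbb{R}^n:\lim_{t\to\infty}\|\phi(t;x)\|=0\}$ ($\|\cdot\|$ is the Euclidean norm). Safe set. $U\subseteq\mathbb{R}^n$ is the unsafe set and $\mathcal{D}_{\mathrm{s}}=\mathbb{R}^n\setminus U$. Assume $\mathcal{D}_{\mathrm{s}}=\{x\in\mathbb{R}^n:h(x)<1\}$ for some $h\in C^1(\mathbb{R}^n)$ with $\nabla h(x)\ne0$ on $\{x:h(x)=1\}$; $\mathcal{D}_{\mathrm{s}}$ is open and bounded; and $0\in\mathcal{D}_{\mathrm{s}}$. The system satisfies a stability-with-safety specification $(\mathcal{X}_0,U)$ for a set $\mathcal{X}_0\subseteq\mathbb{R}^n$ of initial conditions: $\mathcal{X}_0\subseteq\mathcal{D}_0$ and $\phi(t;x)\notin U$ for all $x\in\mathcal{X}_0$, $t\ge0$. Exit time and safe domain of attraction. $\tau(x)=\inf\{t\ge0:\phi(t;x)\in U\}$, with $\inf\emptyset=+\infty$. $\mathcal{D}=\{x\in\mathbb{R}^n:\lim_{t\to\infty}\|\phi(t;x)\|=0\text{ and }\phi(t;x)\notin U\ \forall t\ge0\}=\mathcal{D}_0\cap\{x:\tau(x)=+\infty\}$. Proper indicator. For an open set $D\ni0$,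 a continuous $\omega:D\to[0,\infty)$ is a proper indicator for the origin on $D$ if (i) $\omega(x)=0$ iff $x=0$; (ii) $\omega(x_m)\to\infty$ for any sequence $\{x_m\}\subset D$ with either $x_m\to p\in\partial D$ or $\|x_m\|\to\infty$. The function $V$. Given a proper indicator $\omega$ for the origin on $\mathcal{D}_{\mathrm{s}}$, define $$V(x)=\begin{cases}\int_0^{\tau(x)}\omega(\phi(t;x))\,dt+q(\phi(\tau(x);x)),&\tau(x)<\infty,\\ \int_0^\infty\omega(\phi(t;x))\,dt,&\tau(x)=\infty,\end{cases}$$ where $q(x)=\infty$ for $x\in\partial\mathcal{D}_{\mathrm{s}}\cup(\mathbb{R}^n\setminus\mathcal{D}_{\mathrm{s}})$ and $q=q_0$ on $\mathcal{D}_{\mathrm{s}}$, with $q_0\in C(\mathcal{D}_{\mathrm{s}})$ and $q_0(x)\to+\infty$ as $x\to\partial\mathcal{D}_{\mathrm{s}}$. Conditions on $\omega$. $\mathcal{D}_0\setminus\{0\}\neq\emptyset$, $\omega$ is a proper indicator for the origin on $\mathcal{D}_{\mathrm{s}}$, and: (a) for any $\delta>0$ there exists $c>0$ such that $\omega(x)>c$ for all $x\in\mathcal{D}_{\mathrm{s}}$ with $\|x\|>\delta$; (b) there exist an $r$-neighborhood of $\partial\mathcal{D}_{\mathrm{s}}$ ($r>0$) and a non-increasing function $\psi_0:\mathbb{R}_+\to\mathbb{R}_+$ with $\psi_0(s)\to\infty$ as $s\to0$ and $\int_0^r\psi_0(s)\,ds=\infty$, such that for some constant $C>0$, $\omega(x)\ge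 C\,\psi_0(\|x\|_{\partial\mathcal{D}_{\mathrm{s}}})$ for all $x\in\mathcal{D}_{\mathrm{s}}$ in that neighborhood, where $\|x\|_A=\inf_{y\in A}\|x-y\|$; (c) there exists $\rho>0$ such that $V(x)$ converges (is finite) for all $x$ with $\|x\|<\rho$; (d) for any $\varepsilon>0$ there exists $\delta>0$ such that $\|x\|<\delta$ implies $V(x)<\varepsilon$. $C_b^1(\Omega;\mathbb{R}_+)$ denotes positive, bounded $C^1$ functions on $\Omega$; $k$ is a constant for which $(1-h)^k$ is defined on $\Omega$. The transformation $\beta$. $\beta:[0,\infty)\to\mathbb{R}$ satisfies $\dot\beta=(1-\beta)\varphi(\beta)$, $\beta(0)=0$, where $\varphi(s)>0$ for all $s\ge0$, and there is a nonempty interval $I$ on which $s\mapsto(1-s)\varphi(s)$ is monotonically decreasing. Then $\beta$ is strictly increasing with $\beta(s)\to1$ as $s\to\infty$; in the PDE for $\tilde W$, $\beta(\tilde V(x))$ is read as $1$ for $x\notin\mathcal{D}$. The function $W$ is $W(x)=\beta(V(x))$ for $x\in\mathcal{D}$ and $W(x)=1$ otherwise. Viscosity solutions are continuous functions, understood in the standard sense for the equations with the signs as written.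
   Formalization: The formal theorem also assumes φ is continuous on [0,∞). Without it the claim fails: with φ(s)=1/2−s for s<1/2 and φ(s)=1 for s≥1/2, β tends to 1/2 rather than 1, so W̃ is discontinuous at the boundary of D. *)

(* Defs.v *)
From HB Require Import structures.
From mathcomp Require Import all_boot all_order all_algebra.
From mathcomp Require Import all_classical all_reals all_analysis.

Set Implicit Arguments.
Unset Strict Implicit.
Unset Printing Implicit Defensive.

Import Order.TTheory GRing.Theory Num.Theory.
Import numFieldNormedType.Exports.

Local Open Scope classical_set_scope.
Local Open Scope ring_scope.

Section EuclideanSpace.
Context {R : realType} {n : nat}.
Implicit Types (x u v : 'rV[R]_n) (A : set 'rV[R]_n) (g : 'rV[R]_n -> R).

Definition dotv u v : R := \sum_(i < n) u 0 i * v 0 i.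

(* The library norm on ['rV[R]_n] is the sup norm; it induces the same topology,
   the same bounded sets and the same Lipschitz maps as [enorm]. *)
Definition enorm x : R := Num.sqrt (dotv x x).

Definition dist_to x A : R := inf [set enorm (x - y) | y in A].

Definition frontier A : set 'rV[R]_n := closure A `\` interior A.

Definition grad g x : 'rV[R]_n := \row_(i < n) 'D_(delta_mx 0 i) g x.

(* [A] is meant to be open. *)
Definition C1_on A g : Prop :=
  forall x, A x -> differentiable g x /\ {for x, continuous (grad g)}.

Definition loc_lipschitz (f : 'rV[R]_n -> 'rV[R]_n) : Prop :=
  forall x, exists2 A, nbhs x A & [lipschitz f y | y in A].

End EuclideanSpace.

(* Forward solution of [y' = F y] on [0, +oo[, for a vector field [F] with
   domain [A]. When [F] is continuous on [A], the one-sided derivative at time 0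
   is [F (y 0)] by continuity. *)
Definition is_solution {R : realType} {V : normedModType R}
    (F : V -> V) (A : set V) (x0 : V) (y : R -> V) : Prop :=
  [/\ y 0 = x0,
      {within `[0, +oo[, continuous y},
      forall t : R, 0 <= t -> A (y t) &
      forall t : R, 0 < t -> is_derive t 1 y (F (y t))].

Section RealPower.
Context {R : realType}.
Implicit Types a k : R.

Definition odd_denominator k : Prop :=
  exists p q : nat, odd q /\ k * q%:R = p%:R.

Definition odd_over_odd k : Prop :=
  exists p q : nat, [/\ odd p, odd q & k * q%:R = p%:R].

(* Real power of exponent [k >= 0]: for a negative base it is defined when [k] is
   rational with odd denominator (in particular when [k] is an integer). *)
Definition rpow_defined a k : Prop := 0 <= a \/ odd_denominator k.

Definition rpow a k : R :=
  if 0 <= a then a `^ k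
  else if `[< odd_over_odd k >] then - ((- a) `^ k) else (- a) `^ k.

End RealPower.

Section System.
Context {R : realType} {n : nat}.
Local Notation E := 'rV[R]_n.
Implicit Types (f : E -> E) (phi : R -> E -> E) (U : set E) (w : E -> R).

Definition is_flow f phi : Prop :=
  forall x, is_solution f setT x (phi ^~ x).

Definition loc_asymp_stable f phi : Prop :=
  [/\ f 0 = 0,
      forall e : R, 0 < e -> exists2 d : R, 0 < d &
        forall x, enorm x < d -> forall t, 0 <= t -> enorm (phi t x) < e &
      exists2 d : R, 0 < d &
        forall x, enorm x < d -> enorm (phi t x) @[t --> +oo] --> (0 : R)].

Definition attraction_domain phi : set E :=
  [set x | enorm (phi t x) @[t --> +oo] --> (0 : R)].

Definition safe_attraction_domain phi U : set E :=
  [set x | attraction_domain phi x /\ forall t, 0 <= t -> ~ U (phi t x)].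

Definition exit_time phi U x : \bar R :=
  ereal_inf [set t%:E | t in [set t : R | 0 <= t /\ U (phi t x)]].

(* [w] is only constrained on [A]. *)
Definition proper_indicator (A : set E) w : Prop :=
  [/\ {within A, continuous w},
      forall x, A x -> 0 <= w x,
      forall x, A x -> (w x = 0 <-> x = 0) &
      forall x_ : nat -> E, (forall m, A (x_ m)) ->
        (exists2 p, frontier A p & x_ m @[m --> \oo] --> p) \/
        enorm (x_ m) @[m --> \oo] --> +oo ->
        w (x_ m) @[m --> \oo] --> +oo].

Definition exit_cost U (q0 : E -> R) (x : E) : \bar R :=
  if x \in U then +oo%E else (q0 x)%:E.

Definition exit_cost_ok U (q0 : E -> R) : Prop :=
  {within ~` U, continuous q0} /\
  forall p, frontier (~` U) p -> q0 x @[x --> within (~` U) (nbhs p)] --> +oo.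

Definition value phi U w (q0 : E -> R) (x : E) : \bar R :=
  let tau := exit_time phi U x in
  if (tau < +oo)%E then
    ((\int[lebesgue_measure]_(t in `[0%R, fine tau[) (w (phi t x))%:E)
       + exit_cost U q0 (phi (fine tau) x))%E
  else (\int[lebesgue_measure]_(t in `[0%R, +oo[) (w (phi t x))%:E)%E.

Definition coercive_away_from_origin U w : Prop :=
  forall d : R, 0 < d -> exists2 c : R, 0 < c &
    forall x, (~` U) x -> d < enorm x -> c < w x.

(* [psi0] lives on ]0, +oo[: it has to blow up at 0. *)
Definition boundary_blowup U w : Prop :=
  exists (r C : R) (psi0 : R -> R),
    [/\ 0 < r, 0 < C,
        (forall s, 0 < s -> 0 <= psi0 s) /\
        (forall s t, 0 < s -> s <= t -> psi0 t <= psi0 s),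
        psi0 s @[s --> 0^'+] --> +oo /\
        (\int[lebesgue_measure]_(s in `]0%R, r[) (psi0 s)%:E = +oo)%E &
        forall x, (~` U) x -> dist_to x (frontier (~` U)) < r ->
          C * psi0 (dist_to x (frontier (~` U))) <= w x].

Definition running_cost_conditions phi U w (q0 : E -> R) : Prop :=
  [/\ proper_indicator (~` U) w,
      coercive_away_from_origin U w,
      boundary_blowup U w,
      (exists2 rho : R, 0 < rho &
        forall x, enorm x < rho -> value phi U w q0 x \is a fin_num) &
      forall e : R, 0 < e -> exists2 d : R, 0 < d &
        forall x, enorm x < d -> (value phi U w q0 x < e%:E)%E].

Definition safe_set_conditions U (h : E -> R) : Prop :=
  [/\ ~` U = [set x | h x < 1],
      C1_on setT h,
      (forall x, h x = 1 -> grad h x != 0),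
      open (~` U) /\ bounded_set (~` U) &
      (~` U) 0].

Definition C1b_pos (Omega : set E) (theta : E -> R) : Prop :=
  [/\ forall x, Omega x -> 0 < theta x,
      exists M : R, forall x, Omega x -> theta x <= M &
      exists O, [/\ open O, Omega `<=` O & C1_on O theta]].

Definition omega (h theta : E -> R) (k : R) x : R :=
  theta x * (enorm x ^+ 2 / rpow (1 - h x) k).

Definition ftilde f (h theta : E -> R) (k : R) x : E :=
  (rpow (1 - h x) k / theta x) *: f x.

Definition Vtilde (psi : R -> E -> E) x : \bar R :=
  (\int[lebesgue_measure]_(t in `[0%R, +oo[) (enorm (psi t x) ^+ 2)%:E)%E.

(* [beta] of an extended-real function [Z] finite on [A], read as 1 off [A]. *)
Definition beta_ext (A : set E) (beta : R -> R) (Z : E -> \bar R) x : R :=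
  if x \in A then beta (fine (Z x)) else 1.

End System.

(* Here [vphi] has domain [0, +oo[, so that [beta] takes its values there. *)
Definition transformation {R : realType} (vphi beta : R -> R) : Prop :=
  [/\ {within `[0, +oo[, continuous vphi},
      forall s, 0 <= s -> 0 < vphi s,
      (exists I : interval R,
        [/\ [set` I] !=set0, [set` I] `<=` `[0, +oo[ &
            forall s t, s \in I -> t \in I -> s <= t ->
              (1 - t) * vphi t <= (1 - s) * vphi s]) &
      is_solution (fun b : R => (1 - b) * vphi b) `[0, +oo[ 0 beta].

Section Viscosity.
Context {R : realType} {n : nat}.
Local Notation E := 'rV[R]_n.
Implicit Types (A : set E) (F : E -> R -> E -> R) (u : E -> R).

(* Equation [F x (u x) (grad u x) = 0] on the open set [A]. *)
Definition visc_subsol A F u : Prop :=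
  forall (g : E -> R) x, A x -> C1_on A g ->
    (\forall y \near x, u y - g y <= u x - g x) -> F x (u x) (grad g x) <= 0.

Definition visc_supersol A F u : Prop :=
  forall (g : E -> R) x, A x -> C1_on A g ->
    (\forall y \near x, u x - g x <= u y - g y) -> 0 <= F x (u x) (grad g x).

Definition visc_sol A F u : Prop :=
  [/\ {within A, continuous u}, visc_subsol A F u & visc_supersol A F u].

(* [Omega] is compact: the equation is imposed in its interior. *)
Definition dirichlet_visc_sol (Omega : set E) F u : Prop :=
  [/\ {within Omega, continuous u},
      visc_sol (interior Omega) F u,
      u 0 = 0 &
      forall x, frontier Omega x -> u x = 1].

Definition Vtilde_eq (ft : E -> E) (x : E) (r : R) (p : E) : R :=
  - dotv p (ft x) - enorm x ^+ 2.

(* [b x] stands for [beta (Vtilde x)], read as 1 off the domain of attraction. *)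
Definition Wtilde_eq (ft : E -> E) (vphi : R -> R) (b : E -> R)
    (x : E) (r : R) (p : E) : R :=
  - dotv p (ft x) - (1 - r) * vphi (b x) * enorm x ^+ 2.

End Viscosity.

(* Main.v *)
Require Import Defs.
From HB Require Import structures.
From mathcomp Require Import all_boot all_order all_algebra.
From mathcomp Require Import all_classical all_reals all_analysis.
From mathcomp Require Import measurable_realfun.
From mathcomp Require Import ring lra.

Set Implicit Arguments.
Unset Strict Implicit.
Unset Printing Implicit Defensive.

Import Order.TTheory GRing.Theory Num.Theory.
Import numFieldNormedType.Exports.

Local Open Scope classical_set_scope.
Local Open Scope ring_scope.

(* The field ft is Lipschitz on the compact set Omega, so Gronwall's inequality makes
   psi a unique, continuous semiflow there.  On the safe set, psi is the flow of f run
   with the clock ds = theta / (1 - h)^k dt.  Since k >= 1 and h is C^1, this clock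
   diverges when the flow of f reaches the boundary; hence psi never leaves the safe
   set, its basin of attraction is D, and the change of time turns the running cost
   omega into |psi|^2, so that Vt = V on D.

   Vt is small near 0, which gives its continuity on the open set D, and it blows up at
   the boundary of D because the trajectories of boundary points stay away from 0.
   Vt and Wt are differentiable along trajectories with the derivative prescribed by
   the equations, which makes them viscosity solutions.

   Conversely, doubling variables against a trajectory shows that every viscosity
   solution satisfies the equation along it.  The squared difference of two solutions
   is then nondecreasing along trajectories and tends to 0, hence vanishes on D.  Off D
   the right-hand side of the equation for Wt has a strict sign, and a constant test
   function at an extremum of u - Wt gives u = Wt. *)

(** * Euclidean vectors *)

(** [psi] is specified only at points from which a solution in [Omega] exists for all time. Such a
    solution must therefore be built before anything is known of [psi]: it is [phi] run with the
    inverse clock, and it is defined for every s >= 0 exactly because the clock diverges. The field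
    [ft] is merely Lipschitz, so its flow gives no C^1 coordinates that would straighten the
    equations. Uniqueness uses instead quadratic test functions centred at a moving point of the
    trajectory, and everything is followed forward in time only; the signs of the equations make
    this one direction enough for subsolutions and supersolutions alike. In the second equation the
    coefficient [vphi (beta (Vt x))] is the same for every candidate u. The sources of u and Wt thus
    differ by a nonnegative multiple of u - Wt, which is the sign that keeps the squared difference
    from decreasing. In [Omega] outside the safe set no trajectory is available. There Wt is
    constant along a short segment in the direction of the field, and the segment replaces the
    trajectory. *)

Lemma near_eq_continuous_at (T U : topologicalType) (f g : T -> U) x :
  (\forall y \near x, f y = g y) -> {for x, continuous f} -> {for x, continuous g}.
Proof.
move=> fg; rewrite /prop_for /continuous_at -(nbhs_singleton fg).
by apply: cvg_trans; exact: near_eq_cvg.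
Qed.

Section EuclideanVectors.
Context {R : realType} {n : nat}.
Implicit Types (x y u v a : 'rV[R]_n) (g : 'rV[R]_n -> R).

Lemma dotvC u v : dotv u v = dotv v u.
Proof. by apply: eq_bigr => i _; rewrite mulrC. Qed.

Lemma dotvDl u v x : dotv (u + v) x = dotv u x + dotv v x.
Proof. by rewrite -big_split; apply: eq_bigr => i _; rewrite mxE mulrDl. Qed.

Lemma dotvZl (c : R) u v : dotv (c *: u) v = c * dotv u v.
Proof. by rewrite mulr_sumr; apply: eq_bigr => i _; rewrite mxE mulrA. Qed.

Lemma dotvNl u v : dotv (- u) v = - dotv u v.
Proof. by rewrite -scaleN1r dotvZl mulN1r. Qed.

Lemma dotv0l v : dotv 0 v = 0.
Proof. by rewrite -(scale0r 0) dotvZl mul0r. Qed.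

Lemma dotvDr u v x : dotv x (u + v) = dotv x u + dotv x v.
Proof. by rewrite dotvC dotvDl !(dotvC x). Qed.

Lemma dotvBr u v x : dotv x (u - v) = dotv x u - dotv x v.
Proof. by rewrite dotvDr; congr (_ + _); rewrite dotvC dotvNl dotvC. Qed.

Lemma dotv_ge0 u : 0 <= dotv u u.
Proof. by apply: sumr_ge0 => i _; rewrite -expr2 sqr_ge0. Qed.

Lemma sqr_enorm u : enorm u ^+ 2 = dotv u u.
Proof. by rewrite sqr_sqrtr// dotv_ge0. Qed.

Lemma enorm0 : enorm (0 : 'rV[R]_n) = 0.
Proof. by rewrite /enorm dotv0l sqrtr0. Qed.

Lemma norm_coord_le u i : `|u 0 i| <= `|u|.
Proof.
rewrite [leRHS]/Num.Def.normr/= mx_normrE.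
exact: (le_bigmax _ (fun ij => `|u ij.1 ij.2|) (0, i)).
Qed.

Lemma norm_le_coord u (e : R) : 0 <= e -> (forall i, `|u 0 i| <= e) -> `|u| <= e.
Proof.
move=> e0 ue; rewrite [leLHS]/Num.Def.normr/= mx_normrE.
by apply: bigmax_le => // -[i j] _ /=; rewrite (ord1 i).
Qed.

Lemma norm_le_enorm u : `|u| <= enorm u.
Proof.
apply: norm_le_coord; first exact: sqrtr_ge0.
move=> i; rewrite -ler_sqr ?nnegrE ?sqrtr_ge0//.
rewrite !real_normK ?num_real// sqr_enorm /dotv (bigD1 i)//= -expr2 lerDl.
by apply: sumr_ge0 => j _; rewrite -expr2 sqr_ge0.
Qed.

Lemma sqr_norm_le_dotv u : `|u| ^+ 2 <= dotv u u.
Proof.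
by rewrite -sqr_enorm ler_sqr ?nnegrE ?normr_ge0 ?sqrtr_ge0// norm_le_enorm.
Qed.

(** Penalties and Gronwall estimates are written with the smooth form [dotv], Lipschitz bounds with
    the sup norm. This bound and [sqr_norm_le_dotv] pass between the two, which is where the factors
    [n%:R] of later constants come from. *)
Lemma dotv_le_norm u v : `|dotv u v| <= n%:R * (`|u| * `|v|).
Proof.
apply: le_trans (ler_norm_sum _ _ _) _.
rewrite -[X in X%:R](card_ord n) mulr_natl -sumr_const.
by apply: ler_sum => i _; rewrite normrM ler_pM// norm_coord_le.
Qed.

Lemma enorm_eq0 u : enorm u = 0 -> u = 0.
Proof.
by move=> u0; apply/eqP; rewrite -normr_le0 -[leRHS]u0 norm_le_enorm.
Qed.

Lemma continuous_dotv u v : continuous (fun x => dotv (x - u) (x - v)).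
Proof.
have c (w : 'rV[R]_n) i : continuous (fun x : 'rV[R]_n => (x - w) 0 i).
  have -> : (fun x : 'rV[R]_n => (x - w) 0 i) = (fun x => x 0 i - w 0 i).
    by apply/funext => x; rewrite !mxE.
  by move=> x; apply: continuousB; [exact: coord_continuous|exact: cst_continuous].
apply: (@continuous_big R^o) => [|i _]; first exact: add_continuous.
by move=> x; apply: continuousM; exact: c.
Qed.

Lemma continuous_sqr_enorm : continuous (fun x => enorm x ^+ 2).
Proof.
rewrite (_ : (fun x => _) = fun x => dotv (x - 0) (x - 0)).
  exact: continuous_dotv.
by apply/funext => x; rewrite sqr_enorm subr0.
Qed.

Lemma continuous_enorm : continuous (@enorm R n).
Proof.
rewrite (_ : enorm = Num.sqrt \o (fun x => dotv (x - 0) (x - 0))).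
  by move=> x; apply: continuous_comp;
    [exact: continuous_dotv|exact: sqrt_continuous].
by apply/funext => x; rewrite /= subr0.
Qed.

End EuclideanVectors.

(** * Gradients and derivatives along curves *)

Section EuclideanDerivatives.
Context {R : realType} {n : nat}.
Implicit Types (x u v a : 'rV[R]_n) (g : 'rV[R]_n -> R).

Lemma is_derive_coord {V : normedModType R} (y : V -> 'rV[R]_n) (t v : V) d i :
  is_derive t v y d -> is_derive t v (fun s => y s 0 i) (d 0 i).
Proof.
move=> [dy yd]; have /derivable_mxP/(_ 0 i) dyi := dy.
apply: DeriveDef => //.
by rewrite -yd derive_mx// mxE.
Qed.

Lemma is_derive_dotv {V : normedModType R} (y z : V -> 'rV[R]_n) (t v : V) dy dz :
  is_derive t v y dy -> is_derive t v z dz ->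
  is_derive t v (fun s => dotv (y s) (z s)) (dotv dy (z t) + dotv (y t) dz).
Proof.
move=> y' z'.
have H : is_derive t v (\sum_(i < n) (fun s => y s 0 i * z s 0 i))
   (\sum_(i < n) (dy 0 i * z t 0 i + y t 0 i * dz 0 i)).
  apply: is_derive_sum => i.
  have yi := is_derive_coord i y'; have zi := is_derive_coord i z'.
  apply: (@is_derive_eq _ _ _ _ _ _ _ _ (is_deriveM yi zi)).
  by rewrite /GRing.scale/= addrC; congr (_ + _); rewrite mulrC.
by rewrite fct_sumE in H; rewrite /dotv -big_split.
Qed.

Lemma diff_dotv_grad g x v : differentiable g x -> 'd g x v = dotv (grad g x) v.
Proof.
move=> dg; rewrite {1}(row_sum_delta v) linear_sum; apply: eq_bigr => i _.
by rewrite linearZ/= mxE deriveE// mulrC.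
Qed.

Lemma is_derive_grad g (y : R -> 'rV[R]_n) (t : R) v :
  differentiable g (y t) -> is_derive t 1 y v ->
  is_derive t 1 (fun s => g (y s)) (dotv (grad g (y t)) v).
Proof.
move=> dg [dy yv]; have /derivable1_diffP dy' := dy.
have dgy : differentiable (g \o y) t by exact: differentiable_comp.
apply: DeriveDef; first exact/derivable1_diffP.
rewrite deriveE// diff_comp//=.
have -> : 'd y t 1 = v by rewrite -deriveE.
exact: diff_dotv_grad.
Qed.

Lemma differentiable_dist2 a x : differentiable (fun y => dotv (y - a) (y - a)) x.
Proof.
rewrite /dotv -(fct_sumE _ _ (fun i (y : 'rV[R]_n) => (y - a) 0 i * (y - a) 0 i)).
apply: differentiable_sum => i.
have H : differentiable (fun y : 'rV[R]_n => (y - a) 0 i) x.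
  have -> : (fun y : 'rV[R]_n => (y - a) 0 i) = (fun y => y 0 i - a 0 i).
    by apply/funext => y; rewrite !mxE.
  apply: differentiableB; last exact: differentiable_cst.
  exact: differentiable_coord.
exact: (differentiableM H H).
Qed.

Lemma grad_scale_dist2 (c : R) a x :
  grad (fun y => c * dotv (y - a) (y - a)) x = (2 * c) *: (x - a).
Proof.
apply/rowP => i; rewrite !mxE.
have H : is_derive x (delta_mx 0 i) (fun y => y - a) (delta_mx 0 i : 'rV[R]_n).
  apply: (@is_derive_eq _ _ _ _ _ _ _ _ (is_deriveB (is_derive_id _ _) (is_derive_cst _ _ _))).
  by rewrite subr0.
have H2 := is_deriveZ c (is_derive_dotv H H).
rewrite (@derive_val _ _ _ _ _ _ _ H2) /GRing.scale/= dotvC.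
rewrite [dotv _ (delta_mx 0 i)](_ : _ = (x - a) 0 i); first by rewrite !mxE; ring.
rewrite /dotv (bigD1 i)//= big1 => [|j ji]; first by rewrite !mxE !eqxx mulr1 addr0.
by rewrite !mxE (negbTE ji) andbF mulr0.
Qed.

Lemma C1_scale_dist2 (A : set 'rV[R]_n) (c : R) a :
  C1_on A (fun y => c * dotv (y - a) (y - a)).
Proof.
move=> x _; split.
  by apply: differentiableZ; exact: differentiable_dist2.
rewrite (_ : grad _ = fun y => (2 * c) *: (y - a)); last first.
  by apply/funext => y; exact: grad_scale_dist2.
apply: continuousZ; first exact: cst_continuous.
by apply: continuousB; [exact: cvg_id|exact: cst_continuous].
Qed.

Lemma gradN g x : differentiable g x -> grad (\- g) x = - grad g x.
Proof.
move=> dg; apply/rowP => i; rewrite !mxE deriveN//.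
exact: diff_derivable.
Qed.

Lemma grad_cst (c : R) x : grad (fun=> c) x = 0.
Proof. by apply/rowP => i; rewrite !mxE; exact: derive_cst. Qed.

Lemma C1_cst (A : set 'rV[R]_n) (c : R) : C1_on A (fun=> c).
Proof.
move=> x _; split; first exact: differentiable_cst.
rewrite (_ : grad _ = fun=> 0); first exact: cst_continuous.
by apply/funext => y; exact: grad_cst.
Qed.

Lemma C1N (A : set 'rV[R]_n) g : open A -> C1_on A g -> C1_on A (\- g).
Proof.
move=> oA cg x Ax; have [dg cgx] := cg x Ax; split; first exact: differentiableN.
have H : \forall y \near x, - grad g y = grad (\- g) y.
  near=> y; rewrite gradN//; apply: (cg y _).1.
  by near: y; exact: open_nbhs_nbhs.
exact: near_eq_continuous_at H (continuousN cgx).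
Unshelve. all: by end_near. Qed.

End EuclideanDerivatives.

(** * Real functions of one variable *)

Section RealLine.
Context {R : realType}.
Implicit Types (m d g G : R -> R) (a b t : R).

Lemma is_derive_continuous {V : normedModType R} (y : R -> V) t v :
  is_derive t 1 y v -> {for t, continuous y}.
Proof.
by move=> [/derivable1_diffP dy _]; exact: differentiable_continuous.
Qed.

(** Forward solutions have a derivative only at positive times, hence right continuity at [a] in
    place of a derivative there. *)
Lemma mvt_right m d a b : a < b ->
  (forall t, a < t -> t <= b -> is_derive t 1 m (d t)) ->
  m t @[t --> a^'+] --> m a ->
  exists c, [/\ a < c, c < b & m b - m a = d c * (b - a)].
Proof.
move=> ab dm ma.
have dmo t : t \in `]a, b[%R -> is_derive t 1 m (d t).
  by rewrite in_itv/= => /andP[at_ tb]; apply: dm => //; exact: ltW.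
have mc : {within `[a, b], continuous m}.
  apply/(continuous_within_itvP _ ab); split => //.
  + by move=> t /dmo dt; exact: is_derive_continuous dt.
  + by apply: cvg_at_left_filter; exact: is_derive_continuous (dm _ ab (lexx b)).
have [c] := MVT ab dmo mc.
by rewrite in_itv/= => /andP[ac cb] E; exists c.
Qed.

Lemma ge0_derive_le m d a b : a <= b ->
  (forall t, a < t -> t <= b -> is_derive t 1 m (d t)) ->
  m t @[t --> a^'+] --> m a ->
  (forall t, a < t -> t <= b -> 0 <= d t) -> m a <= m b.
Proof.
rewrite le_eqVlt => /predU1P[->//|ab] dm ma d0.
have [c [ac cb E]] := mvt_right ab dm ma.
by rewrite -subr_ge0 E mulr_ge0 ?subr_ge0 ?(ltW ab)// d0// ltW.
Qed.

Lemma eq0_derive_eq m a b : a <= b ->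
  (forall t, a < t -> t <= b -> is_derive t 1 m 0) ->
  m t @[t --> a^'+] --> m a -> m b = m a.
Proof.
rewrite le_eqVlt => /predU1P[->//|ab] dm ma.
have [c [_ _ /eqP]] := mvt_right ab dm ma.
by rewrite mul0r subr_eq0 => /eqP.
Qed.

Lemma within_ge0_continuous {T : topologicalType} (y : R -> T) a :
  {within `[a, +oo[, continuous y} ->
  (forall t, a < t -> {for t, continuous y}) /\ y t @[t --> a^'+] --> y a.
Proof.
move=> yc; split=> [t at_|].
  have at_oo : `[a, +oo[%classic° t.
    have : nbhs t `]a, +oo[%classic.
      by apply: open_nbhs_nbhs; split; [exact: interval_open|rewrite /= in_itv/= at_].
    by apply: filterS => s /=; rewrite !in_itv/= !andbT => /ltW.
  move/subspace_continuousP : yc => /(_ t); rewrite within_interior//; apply.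
  exact: interior_subset.
move/subspace_continuousP : yc => /(_ a); rewrite /= in_itv/= lexx => /(_ isT).
apply: cvg_trans; apply: cvg_app; apply: within_subset => t /=.
by rewrite in_itv/= andbT => /ltW.
Qed.

Lemma ge0_continuous_within {T : topologicalType} (y : R -> T) a :
  (forall t, a < t -> {for t, continuous y}) -> y t @[t --> a^'+] --> y a ->
  {within `[a, +oo[, continuous y}.
Proof.
move=> yc ya; apply/subspace_continuousP => t /=.
rewrite in_itv/= andbT le_eqVlt => /predU1P[<-{t}|/yc].
  have := cvg_at_right_within ya; apply: cvg_trans; apply: cvg_app.
  by apply: within_subset => z/=; rewrite in_itv/= => /andP[].
exact: cvg_within_filter.
Qed.

(** Integrating from -1 makes 0 an interior point, so that [G] has a two-sided derivative at time 0
    as well. The downward closed set [A] will be the set of times before an exit. *)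
Lemma antiderivative (g : R -> R) (A : set R) : open A -> A 0 ->
  (forall s t, s <= t -> A t -> A s) ->
  (forall t, A t -> {for t, continuous g}) ->
  exists2 G : R -> R, G 0 = 0 & forall t, A t -> -1 < t -> is_derive t 1 G (g t).
Proof.
move=> oA A0 Adown gc.
pose F x := (\int[lebesgue_measure]_(t in [set` `[(-1)%R, x]]) (g t))%R.
exists (fun x => F x - F 0); first by rewrite subrr.
move=> t At t1.
have [u tu Au] : exists2 u, t < u & A u.
  near t^'+ => u; exists u => //.
  near: u; apply: cvg_at_right_filter (oA _ At); exact: cvg_id.
have ig : lebesgue_measure.-integrable `[-1, u] (EFin \o g).
  apply: continuous_compact_integrable; first exact: segment_compact.
  apply: continuous_in_subspaceT => s; rewrite inE/= in_itv/= => /andP[_ su].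
  exact: gc (Adown _ _ su Au).
have [dF EF] := continuous_FTC1_closed tu ig t1 (gc _ At).
have dF' : is_derive t 1 F (g t) by apply: DeriveDef; [exact: dF|rewrite -derive1E].
apply: (@is_derive_eq _ _ _ _ _ _ _ _ (is_deriveB dF' (is_derive_cst _ _ _))).
by rewrite subr0.
Unshelve. all: by end_near. Qed.

(* Integrals over [0, +oo[ are only ever compared through their real upper bounds:
   this replaces changes of variables and translations of the integral. *)
Lemma ge0_integral_leP (g G : R -> R) :
  (forall t, 0 <= t -> 0 <= g t) -> {within `[0, +oo[, continuous g} ->
  G 0 = 0 -> G t @[t --> 0^'+] --> G 0 ->
  (forall t, 0 < t -> is_derive t 1 G (g t)) ->
  forall M : R,
  (\int[lebesgue_measure]_(t in `[0%R, +oo[) (g t)%:E <= M%:E)%E <->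
  forall t, 0 <= t -> G t <= M.
Proof.
move=> g0 cg G0 cG dG M.
have G'g t : 0 < t -> G^`()%classic t = g t.
  by move=> t0; rewrite derive1E; exact: (@derive_val _ _ _ _ _ _ _ (dG t t0)).
have mono s t : 0 <= s -> s <= t -> G s <= G t.
  move=> s0 st; apply: (@ge0_derive_le G g s t st).
  - by move=> r sr _; apply: dG; exact: le_lt_trans sr.
  - move: s0; rewrite le_eqVlt => /predU1P[<-//|s0].
    by apply: cvg_at_right_filter; exact: is_derive_continuous (dG _ s0).
  - by move=> r sr _; apply: g0; exact/ltW/(le_lt_trans s0).
split=> [intM t|GM].
  rewrite le_eqVlt => /predU1P[<-|t0].
    rewrite G0 -lee_fin; apply: le_trans intM; apply: integral_ge0 => s /=.
    by rewrite in_itv/= andbT lee_fin; exact: g0.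
  rewrite -lee_fin; apply: le_trans intM.
  have <- : (\int[lebesgue_measure]_(s in `[0%R, t]) (g s)%:E = (G t)%:E)%E.
    rewrite (@continuous_FTC2 _ g G 0 t t0).
    - by rewrite G0 sube0.
    - by apply: continuous_subspaceW cg; exact: subset_itvl.
    - split => //.
      + by move=> s /andP[/[!bnd_simp] s0 _]; have [] := dG s s0.
      + by apply: cvg_at_left_filter; exact: is_derive_continuous (dG _ t0).
    - by move=> s /andP[/[!bnd_simp] s0 _]; exact: G'g.
  apply: ge0_subset_integral => //=.
  - apply/measurable_EFinP; apply: subspace_continuous_measurable_fun => //.
  - by move=> s; rewrite in_itv/= andbT lee_fin; exact: g0.
  - exact: subset_itvl.
(* Freezing [G] at negative times makes it nondecreasing on the whole line, so that it converges at
   +oo to the supremum of its range. *)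
pose f t := G (Num.max t 0).
have f_nd : nondecreasing_fun f.
  move=> s t st; apply: mono; first by rewrite le_max lexx orbT.
  by rewrite ge_max !le_max lexx st orbT.
have f_ub : forall y, range f y -> y <= M.
  by move=> _ [t _ <-]; apply: GM; rewrite le_max lexx orbT.
have Gl : G t @[t --> +oo] --> sup (range f).
  apply: cvg_trans (nondecreasing_cvgr f_nd _); last by exists M.
  apply: near_eq_cvg; near=> t; rewrite /f; congr G.
  by apply/max_idPl; near: t; exact: nbhs_pinfty_ge.
rewrite (@ge0_continuous_FTC2y _ g G 0 (sup (range f))) => //.
- rewrite G0 sube0 lee_fin; apply: ge_sup => //; first by exists (f 0), 0.
- by move=> t t0; have [] := dG t t0.
- by move=> t /andP[/[!bnd_simp] t0 _]; exact: G'g.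
Unshelve. all: by end_near. Qed.

Lemma cvg_ge_bound {T : Type} (F : set_system T) {FF : ProperFilter F} (u : T -> R) l c :
  u @ F --> l -> (\forall t \near F, c <= u t) -> c <= l.
Proof.
move=> ul cu; have <- := cvg_lim (@Rhausdorff R) ul.
by apply: limr_ge => //; apply/cvg_ex; exists l.
Qed.

(** A nonnegative lower right Dini derivative is all that viscosity solutions provide along a
    trajectory. For a slope e, consider the times up to which [m] stays above the line of slope -e
    issued from [m a]: by continuity their supremum is one of them, and the local bound goes past
    any supremum before [b]. *)
Lemma dini_nondecreasing (m : R -> R) a b : a <= b ->
  {within `[a, b], continuous m} ->
  (forall t (e : R), a <= t -> t < b -> 0 < e -> exists2 d : R, 0 < d &
     forall s, t <= s -> s <= t + d -> s <= b -> m t - e * (s - t) <= m s) ->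
  m a <= m b.
Proof.
move=> ab mc dini.
suff H (e : R) : 0 < e -> m a - e * (b - a) <= m b.
  apply/ler_addgt0Pr => e e0.
  have d0 : 0 < e / (1 + (b - a)) by rewrite divr_gt0// ltr_wpDr ?subr_ge0.
  have := H _ d0; rewrite lerBlDr => /le_trans; apply; rewrite lerD2l.
  rewrite mulrAC ler_pdivrMr ?ltr_wpDr ?subr_ge0// ler_pM2l//.
  by rewrite lerDr.
move=> e0.
pose S' := [set t | a <= t <= b /\ forall s, a <= s <= t -> m a - e * (s - a) <= m s].
have S'a : S' a.
  split; first by rewrite lexx.
  move=> s; rewrite -eq_le => /eqP <-; by rewrite subrr mulr0 subr0.
have hs : has_sup S'.
  by split; [exists a|exists b => t [/andP[]]].
pose c := sup S'.
have ac : a <= c by exact: sup_upper_bound S'a.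
have cb : c <= b by apply: ge_sup => //; [exists a|move=> t [/andP[]]].
have below s : a <= s -> s < c -> m a - e * (s - a) <= m s.
  move=> as_ sc; have [t [tab tS] st] := sup_gt (ex_intro S' a S'a) sc.
  by apply: tS; rewrite as_ ltW.
have Sc : m a - e * (c - a) <= m c.
  have [->|ca] := eqVneq c a; first by rewrite subrr mulr0 subr0.
  have {}ca : a < c by rewrite lt_neqAle eq_sym ca.
  pose k s := m s + e * (s - a).
  have mc' : {within `[a, c], continuous m}.
    by apply: continuous_subspaceW mc; exact: subset_itvl.
  have [_ _ mcc] := (continuous_within_itvP _ ca).1 mc'.
  have kcc : k s @[s --> c^'-] --> k c.
    apply: cvgD => //; apply: cvg_at_left_filter; apply: cvgM; first exact: cvg_cst.
    by apply: cvgB; [exact: cvg_id|exact: cvg_cst].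
  rewrite lerBlDr.
  apply: (cvg_ge_bound kcc); near=> s; rewrite /k -lerBlDr; apply: below.
  - by near: s; exact: nbhs_left_ge.
  - by near: s; exact: nbhs_left_lt.
have [cb'|bc] := ltP c b; last first.
  by have -> : b = c; [apply/le_anti; rewrite bc cb|].
have [d d0 Hd] := dini c e ac cb' e0.
pose t := Num.min (c + d) b.
have ct : c < t by rewrite lt_min cb' ltrDl d0.
have : S' t.
  split; first by rewrite (le_trans ac (ltW ct))/= ge_min lexx orbT.
  move=> s /andP[as_]; rewrite le_min => /andP[sd sb].
  have [sc|cs] := ltP s c; first exact: below.
  apply: le_trans (Hd s cs sd sb).
  rewrite lerBrDr; apply: le_trans Sc; lra.
move/(sup_upper_bound hs); by rewrite leNgt ct.
Unshelve. all: by end_near. Qed.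

End RealLine.

(** * Gronwall's inequality, inversion of a clock, the transformation [beta] *)

Section OneDimensional.
Context {R : realType}.
Implicit Types (m d g G : R -> R) (t s : R).

Lemma gronwall (m d : R -> R) (C : R) :
  (forall t, 0 < t -> is_derive t 1 m (d t)) -> m t @[t --> 0^'+] --> m 0 ->
  (forall t, 0 < t -> d t <= C * m t) ->
  forall t, 0 <= t -> m t <= m 0 * expR (C * t).
Proof.
move=> dm m0 dle t t0.
pose z s := - (m s * expR (- C * s)).
have ec s : is_derive s 1 (fun s : R => expR (- C * s)) (- C * expR (- C * s)).
  have H : is_derive s 1 (fun s : R => - C * s) (- C).
    apply: (@is_derive_eq _ _ _ _ _ _ _ _ (is_deriveZ (- C) (is_derive_id s 1))).
    by rewrite /GRing.scale/= mulr1.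
  apply: (@is_derive_eq _ _ _ _ _ _ _ _ (is_derive1_comp (is_derive_expR _) H)).
  by rewrite mulrC.
have : z 0 <= z t.
  apply: (@ge0_derive_le _ z (fun s => (C * m s - d s) * expR (- C * s))) => //.
  - move=> s s0 _.
    apply: (@is_derive_eq _ _ _ _ _ _ _ _ (is_deriveN (is_deriveM (dm s s0) (ec s)))).
    by rewrite /GRing.scale/=; ring.
  - apply: cvgN; apply: cvgM => //; apply: cvg_at_right_filter.
    exact: is_derive_continuous (ec 0).
  - by move=> s s0 _; rewrite mulr_ge0 ?expR_ge0// subr_ge0 dle.
rewrite /z lerN2 mulr0 expR0 mulr1 => H.
by rewrite -ler_pdivrMr ?expR_gt0// -expRN -mulNr.
Qed.

(** [T] is the inverse of the clock [G]. Since the rate is at least [c], the clock expands distances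
    by [c]: preimages are unique, and T s <= s / c gives continuity at 0, where the inverse function
    theorem is not applied. *)
Lemma time_change (g G : R -> R) (A : set R) (c : R) : open A -> A 0 ->
  (forall s t, s <= t -> A t -> A s) ->
  (forall t, A t -> -1 < t -> is_derive t 1 G (g t)) ->
  0 < c -> (forall t, A t -> c <= g t) -> G 0 = 0 ->
  (forall M : R, exists t, [/\ A t, 0 <= t & M <= G t]) ->
  exists T : R -> R, [/\ T 0 = 0,
    forall s, 0 <= s -> [/\ A (T s), 0 <= T s & G (T s) = s],
    forall t, A t -> 0 <= t -> T (G t) = t,
    {within `[0, +oo[, continuous T} &
    forall s, 0 < s -> is_derive s 1 T (g (T s))^-1].
Proof.
move=> oA A0 Adown dG c0 cg G0 Gub.
have Gc t : A t -> -1 < t -> {for t, continuous G}.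
  by move=> At t1; exact: is_derive_continuous (dG _ At t1).
have Ginc s t : -1 < s -> s <= t -> A t -> c * (t - s) <= G t - G s.
  move=> s1; rewrite le_eqVlt => /predU1P[->|st] At; first by rewrite !subrr mulr0.
  have [r [sr rt ->]] : exists r, [/\ s < r, r < t & G t - G s = g r * (t - s)].
    apply: mvt_right => //.
      by move=> r sr rt; apply: dG; [exact: Adown At|exact: lt_trans sr].
    by apply: cvg_at_right_filter; apply: Gc => //; exact: Adown (ltW st) At.
  by rewrite ler_pM2r ?subr_gt0//; apply: cg; apply: Adown At; exact: ltW.
have Ginj s t : A s -> A t -> -1 < s -> -1 < t -> G s = G t -> s = t.
  move=> As At s1 t1 E; wlog st : s t As At s1 t1 E / s <= t.
    by move=> W; have [/W|/ltW /W/esym] := leP s t; apply.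
  apply/le_anti; rewrite st/= -subr_le0.
  by have := Ginc _ _ s1 st At; rewrite E subrr pmulr_rle0.
pose T s := xget 0 [set t | [/\ A t, -1 < t & G t = s]].
have TG t : A t -> -1 < t -> T (G t) = t.
  move=> At t1; rewrite /T; case: xgetP => [r -> [Ar r1 E]|/(_ t)]; first exact: Ginj.
  by case.
have Gsurj s : 0 <= s -> exists t, [/\ A t, 0 <= t & G t = s].
  move=> s0; have [t1 [At1 t10 st1]] := Gub s.
  have [|| t + E] := @IVT _ G 0 t1 s t10.
  - apply: continuous_in_subspaceT => r; rewrite inE/= in_itv/= => /andP[r0 rt].
    by apply: Gc; [exact: Adown At1|exact: lt_le_trans r0].
  - by rewrite G0 ge_min s0/= le_max st1 orbT.
  - rewrite in_itv/= => /andP[t0 tt1]; exists t; split=> //.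
    exact: Adown At1.
have TP s : 0 <= s -> [/\ A (T s), 0 <= T s & G (T s) = s].
  move=> /Gsurj[t [At t0 <-]]; rewrite TG//; exact: lt_le_trans t0.
have T0 : T 0 = 0 by rewrite -{1}G0 TG// ltrN10.
have dT s : 0 < s -> is_derive s 1 T (g (T s))^-1.
  move=> s0; have [At t0 E] := TP s (ltW s0).
  have t0' : 0 < T s.
    rewrite lt_neqAle t0 andbT; apply/negP => /eqP t00.
    by move: s0; rewrite -E -t00 G0 ltxx.
  have nearP : \forall t \near T s, A t /\ -1 < t.
    near=> t; split; near: t; first exact: open_nbhs_nbhs.
    by apply: lt_nbhsr; exact: lt_trans t0'.
  rewrite -{1}E; apply: is_derive_inverse.
  - by apply: filterS nearP => t [At' t1]; exact: TG.
  - by apply: filterS nearP => t [At' t1]; exact: Gc.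
  - by apply: dG => //; exact: lt_trans t0'.
  - by rewrite gt_eqF// (lt_le_trans c0)// cg.
exists T; split => //.
- by move=> t At t0; rewrite TG//; exact: lt_le_trans t0.
- apply: ge0_continuous_within => [s s0|]; first exact: is_derive_continuous (dT s s0).
  rewrite T0; apply/cvgr0Pnorm_le => e e0; near=> s.
  have s0 : 0 <= s by near: s; exact: nbhs_right_ge.
  have [At t0 E] := TP s s0.
  rewrite ger0_norm//.
  have := Ginc 0 _ (ltrN10 _) t0 At; rewrite G0 !subr0 E => H.
  rewrite -(ler_pM2l c0); apply: le_trans H _.
  by near: s; apply: nbhs_right_le; rewrite mulr_gt0.
Unshelve. all: by end_near. Qed.

Lemma continuous_max0 : continuous (fun t : R => Num.max t 0).
Proof.
by move=> t; apply: (@continuous_max R R (fun t => t) (fun=> 0));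
  [exact: cvg_id|exact: cst_continuous].
Qed.

(** Data on [0, +oo[ are extended by a constant to the left, so that two-sided continuity and
    integration from -1 apply to them. *)
Lemma continuous_extend_right {T : topologicalType} (y : R -> T) :
  {within `[0, +oo[, continuous y} -> continuous (fun t => y (Num.max t 0)).
Proof.
move=> /subspace_continuousP yc t.
have t0 s : `[0%R, +oo[%classic (Num.max s 0).
  by rewrite /= in_itv/= andbT le_max lexx orbT.
have H : Num.max s 0 @[s --> t] --> within `[0, +oo[%classic (nbhs (Num.max t 0)).
  move=> P HP; have HP' : nbhs t ((fun s : R => Num.max s 0) @^-1`
      [set s | `[0, +oo[%classic s -> P s]) := continuous_max0 HP.
  by apply: filterS HP' => s /= /(_ (t0 s)).
exact: cvg_comp H (yc _ (t0 t)).
Qed.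

(** One has beta = 1 - exp (- K), where K is the integral of [vphi] along [beta]; hence beta < 1.
    Then [vphi] is evaluated only in [0, 1], where it has a positive minimum, so K grows at least
    linearly and beta tends to 1. *)
Lemma transformation_bounds (vphi beta : R -> R) : transformation vphi beta ->
  [/\ forall s, 0 <= s -> 0 <= beta s, forall s, 0 <= s -> beta s < 1 &
      forall e, e < 1 -> exists M : R, forall s, M <= s -> 0 <= s -> e <= beta s].
Proof.
move=> [vc v0 _ [b0 bc bge bd]].
have {}bge s : 0 <= s -> 0 <= beta s by move=> /bge /=; rewrite in_itv/= andbT.
pose ck t := vphi (Num.max (beta (Num.max t 0)) 0).
have ckc : continuous ck.
  have b_c := continuous_extend_right bc; have v_c := continuous_extend_right vc.
  by move=> t; apply: (continuous_comp (b_c t) (v_c _)).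
have [K K0 dK] := @antiderivative R ck setT openT I (fun _ _ _ _ => I) (fun t _ => ckc t).
have ckE t : 0 <= t -> ck t = vphi (beta t).
  by move=> t0; rewrite /ck (max_idPl t0) (max_idPl (bge _ t0)).
have [bc' bcr] := within_ge0_continuous bc.
have E t : 0 <= t -> (1 - beta t) * expR (K t) = 1.
  move=> t0.
  have de s : -1 < s -> is_derive s 1 (fun s => expR (K s)) (ck s * expR (K s)).
    move=> s1.
    apply: (@is_derive_eq _ _ _ _ _ _ _ _ (is_derive1_comp (is_derive_expR _) (dK s I s1))).
    by rewrite mulrC.
  transitivity ((1 - beta 0) * expR (K 0)); last by rewrite b0 K0 subr0 expR0 mulr1.
  apply: (@eq0_derive_eq _ (fun t => (1 - beta t) * expR (K t)) 0 t t0).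
  - move=> s s0 _.
    have d1 : is_derive s 1 (fun s => 1 - beta s) (- ((1 - beta s) * vphi (beta s))).
      apply: (@is_derive_eq _ _ _ _ _ _ _ _ (is_deriveB (is_derive_cst _ _ _) (bd s s0))).
      by rewrite sub0r.
    have s1 : -1 < s by exact: lt_trans s0.
    apply: (@is_derive_eq _ _ _ _ _ _ _ _ (is_deriveM d1 (de s s1))).
    by rewrite /GRing.scale/= ckE ?(ltW s0)//; ring.
  - apply: cvgM; first by apply: cvgB => //; exact: cvg_cst.
    apply: cvg_at_right_filter; exact: is_derive_continuous (de 0 (ltrN10 _)).
have blt s : 0 <= s -> beta s < 1.
  move=> s0; rewrite -subr_gt0 -(pmulr_lgt0 _ (expR_gt0 (K s))) E//.
split=> // e e1.
have vc1 : {within `[0, 1], continuous vphi}.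
  by apply: continuous_subspaceW vc; exact: subset_itvl.
have [p + pmin] := EVT_min ler01 vc1.
rewrite in_itv/= => /andP[p0 p1]; pose c := vphi p.
have c0 : 0 < c by exact: v0.
have Kc t : 0 <= t -> c * t <= K t.
  move=> t0; rewrite -subr_ge0.
  have -> : 0 = K 0 - c * 0 by rewrite K0 mulr0 subr0.
  have dz s : -1 < s -> is_derive s 1 (fun s => K s - c * s) (ck s - c).
    move=> s1; apply: is_deriveB; first exact: dK.
    apply: (@is_derive_eq _ _ _ _ _ _ _ _ (is_deriveZ c (is_derive_id s 1))).
    by rewrite /GRing.scale/= mulr1.
  apply: (@ge0_derive_le _ (fun s => K s - c * s) (fun s => ck s - c)) => //.
  - by move=> s s0 _; apply: dz; exact: lt_trans s0.
  - by apply: cvg_at_right_filter; exact: is_derive_continuous (dz 0 (ltrN10 _)).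
  - move=> s s0 _; rewrite subr_ge0 ckE ?(ltW s0)//; apply: pmin.
    by rewrite in_itv/= bge ?(ltW s0)//= ltW// blt ?(ltW s0).
(* Beyond this threshold exp K >= 1 + K >= c s >= 1 / (1 - e), which is beta >= e. *)
exists ((1 - e)^-1 / c) => s Ms s0.
have e1' : 0 < 1 - e by rewrite subr_gt0.
have : (1 - e)^-1 <= expR (K s).
  have H1 : (1 - e)^-1 <= c * s by rewrite mulrC -ler_pdivrMr.
  have H2 := Kc s s0; have H3 := expR_ge1Dx (K s).
  by apply: le_trans H1 (le_trans H2 (le_trans _ H3)); rewrite lerDr.
move=> H; rewrite -lerN2 -(lerD2l 1).
have -> : 1 - beta s = (expR (K s))^-1.
  have ne0 := lt0r_neq0 (expR_gt0 (K s)).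
  by apply: (mulIf ne0); rewrite E// mulVf.
by rewrite -[leRHS]invrK lef_pV2 ?posrE ?invr_gt0 ?expR_gt0.
Unshelve. all: by end_near. Qed.
End OneDimensional.

(** * Viscosity solutions along characteristics *)

Lemma near_distP {R : realType} {V : normedModType R} (x : V) (P : V -> Prop) :
  (\forall y \near x, P y) <->
  exists2 r : R, 0 < r & forall y, `|y - x| < r -> P y.
Proof.
split=> [/nbhs_normP[r r0 H]|[r r0 H]].
  by exists r => // y yx; apply: H => /=; rewrite distrC.
by apply/nbhs_normP; exists r => // y /=; rewrite distrC; exact: H.
Qed.

Lemma continuous_near_dist {R : realType} {T : topologicalType}
    {V : normedModType R} (f : T -> V) x (e : R) :
  {for x, continuous f} -> 0 < e -> \forall y \near x, `|f y - f x| < e.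
Proof. by move=> fc e0; exact: (cvgr_distC_lt _ _ fc). Qed.

Lemma near_dist_continuous {R : realType} {T : topologicalType}
    {V : normedModType R} (f : T -> V) x :
  (forall e : R, 0 < e -> \forall y \near x, `|f y - f x| <= e) ->
  {for x, continuous f}.
Proof.
move=> H; apply/cvgrPdist_le => e e0.
by apply: filterS (H e e0) => y; rewrite distrC.
Qed.

(** Only later times are compared, because in the doubling argument the maximum may sit at the left
    end of the time interval. *)
Lemma derive_le0_right_max {R : realType} (m : R -> R) (t D : R) :
  is_derive t 1 m D -> (\forall s \near t^'+, m s <= m t) -> D <= 0.
Proof.
move=> /is_derive1_caratheodory[h [mE hc <-]] mt.
rewrite leNgt; apply/negP => h0.
have hpos : \forall s \near t^'+, 0 < h s by exact: cvg_at_right_filter (cvgr_gt _ hc _ h0).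
have : \forall s \near t^'+, False.
  near=> s.
  have : 0 < h s * (s - t).
    by rewrite mulr_gt0//; [near: s|rewrite subr_gt0; near: s; exact: nbhs_right_gt].
  by rewrite -mE subr_gt0 ltNge; apply/negP; rewrite negbK; near: s.
by move/filter_ex => [].
Unshelve. all: by end_near. Qed.

(** Both equations take this form once the value of the solution is frozen into the source [l]; each
    solution is then treated with its own source. *)
Definition transport {R : realType} {n : nat} (F : 'rV[R]_n -> 'rV[R]_n)
    (l : 'rV[R]_n -> R) (x : 'rV[R]_n) (_ : R) (p : 'rV[R]_n) : R :=
  - dotv p (F x) - l x.

Section Transport.
Context {R : realType} {n : nat}.
Local Notation E := 'rV[R]_n.
Implicit Types (A : set E) (F : E -> E) (u l : E -> R) (gamma : R -> E).

Lemma compact_closed_ball (p : E) (r : R) : compact [set x : E | `|x - p| <= r].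
Proof.
apply: bounded_closed_compact.
  exists (`|p| + r); split; first exact: num_real.
  move=> M rM x /= xp; apply: le_trans (ltW rM).
  by rewrite -[x](subrK p) addrC (le_trans (ler_normD _ _))// lerD2l.
have := @closed_closed_ball_ R E p r; congr closed.
by apply/seteqP; split => x /=; rewrite /closed_ball_ /= distrC.
Qed.

(* Doubling of variables against the characteristic: the maximum over
   [t0, t1] x ball of u(x) + c (t - t0) - kappa e^(-C (t - t0)) |x - gamma t|^2
   can only be attained at time t1; the exponential absorbs the Lipschitz error
   made when F (gamma t) replaces F x. *)
Lemma visc_subsol_growth A A' F (L : R) u l gamma (t0 c : R) : open A -> A `<=` A' ->
  (forall x y, A x -> A y -> `|F x - F y| <= L * `|x - y|) ->
  (forall x, A x -> {for x, continuous u}) ->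
  0 < t0 -> A (gamma t0) -> {for gamma t0, continuous l} ->
  (forall t : R, 0 < t -> is_derive t 1 gamma (F (gamma t))) ->
  visc_subsol A' (transport F l) u -> l (gamma t0) < c ->
  exists2 d : R, 0 < d & forall t, t0 <= t -> t <= t0 + d ->
    u (gamma t0) <= u (gamma t) + c * (t - t0).
Proof.
move=> oA AA' FL uc t00 Ap lc dg sub lpc; set p := gamma t0.
have [r r0 Hr] : exists2 r : R, 0 < r & forall y, `|y - p| < r -> A y /\ l y < c.
  apply/near_distP; near=> y; split; near: y; first exact: open_nbhs_nbhs.
  exact: (cvgr_lt _ lc).
pose r2 := r / 2; have r20 : 0 < r2 by rewrite divr_gt0.
have r2r : r2 < r by rewrite /r2; lra.
have gc (t : R) : 0 < t -> {for t, continuous gamma}.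
  by move=> t0'; exact: is_derive_continuous (dg t t0').
have [d d0 Hd] : exists2 d : R, 0 < d & forall t, `|t - t0| < d -> `|gamma t - p| < r2 / 2.
  apply/(near_distP (V := R^o)).
  have r40 : 0 < r2 / 2 by rewrite divr_gt0.
  exact: continuous_near_dist (gc _ t00) r40.
exists (d / 2) => [|t1 t01 t1d]; first by rewrite divr_gt0.
have gr t : t0 <= t -> t <= t1 -> `|gamma t - p| < r2 / 2.
  by move=> t0t tt1; apply: Hd; rewrite ger0_norm ?subr_ge0//; lra.
pose B := [set x : E | `|x - p| <= r2].
have BA x : B x -> A x /\ l x < c by move=> /= xp; apply: Hr; exact: le_lt_trans r2r.
have Bp : B p by rewrite /B /= subrr normr0 ltW.
have [b _ ub] : exists2 b, b \in B & forall x, x \in B -> u x <= u b.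
  apply: EVT_max_rV; [by exists p|exact: compact_closed_ball|].
  by apply: continuous_in_subspaceT => x /set_mem/BA[Ax _]; exact: uc.
(* The time derivative of the squared distance involves [F (gamma t)], the equation at x involves
   [F x]. Replacing one by the other costs at most [C] times the squared distance. *)
pose C : R := 2 * n%:R * `|L|.
pose a t := expR (- C * (t - t0)).
have da (t : R) : is_derive t 1 a (- C * a t).
  have H : is_derive t 1 (fun t : R => - C * (t - t0)) (- C).
    apply: (@is_derive_eq _ _ _ _ _ _ _ _ (is_deriveZ (- C)
      (is_deriveB (is_derive_id t 1) (is_derive_cst t0 _ _)))).
    by rewrite /GRing.scale/= subr0 mulr1.
  apply: (@is_derive_eq _ _ _ _ _ _ _ _ (is_derive1_comp (is_derive_expR _) H)).
  by rewrite mulrC.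
have a_ge (t : R) : t <= t1 -> a t1 <= a t.
  move=> tt1; rewrite ler_expR !mulNr lerN2 ler_wpM2l ?lerD2r//.
  by rewrite !mulr_ge0// ler0n.
(* the gap between the maximum and its lower bound [u p] *)
pose b' := u b - u p + `|c| * (t1 - t0).
(* Points arbitrarily close to [gamma t1] are enough, since [u] is continuous there. *)
have key (eta : R) : 0 < eta -> exists2 x, `|x - gamma t1| < eta & u p <= u x + c * (t1 - t0).
  move=> eta0; pose e := Num.min eta (r2 / 2).
  have e0 : 0 < e by rewrite lt_min eta0 divr_gt0.
  (* With this value a point at distance [e] or more from [gamma t] pays a penalty of at least |b'|
     + 1, more than the gap b', so it cannot be a maximum point. *)
  pose kappa := (`|b'| + 1) / (a t1 * e ^+ 2).
  have k0 : 0 < kappa.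
    by rewrite divr_gt0 ?mulr_gt0 ?expR_gt0 ?exprn_gt0// ltr_wpDl.
  pose q t x := dotv (x - gamma t) (x - gamma t).
  pose M (tx : R * E) := u tx.2 + c * (tx.1 - t0) - kappa * (a tx.1 * q tx.1 tx.2).
  have q0 t x : 0 <= q t x by exact: dotv_ge0.
  have [] : exists2 tx, tx \in `[t0, t1]%classic `*` B &
      forall ty, ty \in `[t0, t1]%classic `*` B -> M ty <= M tx.
    apply: compact_EVT_max.
    - by exists (t0, p); split => //=; rewrite in_itv/= lexx.
    - by apply: compact_setX; [exact: segment_compact|exact: compact_closed_ball].
    - apply: continuous_in_subspaceT => -[t x] /set_mem[/=].
      rewrite in_itv/= => /andP[t0t tt1] /BA[Ax _].
      have c1 : {for (t, x), continuous (fun tx : R * E => tx.1)} by exact: cvg_fst.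
      have c2 : {for (t, x), continuous (fun tx : R * E => tx.2)} by exact: cvg_snd.
      have cg : {for (t, x), continuous (fun tx : R * E => gamma tx.1)}.
        by apply: continuous_comp => //=; apply: gc; exact: lt_le_trans t0t.
      have cu : {for (t, x), continuous (fun tx : R * E => u tx.2)}.
        by apply: continuous_comp => //=; exact: uc.
      have ca : {for (t, x), continuous (fun tx : R * E => a tx.1)}.
        by apply: continuous_comp => //=; exact: is_derive_continuous (da t).
      have cq : {for (t, x), continuous (fun tx : R * E => q tx.1 tx.2)}.
        have -> : (fun tx : R * E => q tx.1 tx.2) =
            (fun z => dotv (z - 0) (z - 0)) \o (fun tx : R * E => tx.2 - gamma tx.1).
          by apply/funext => tx /=; rewrite subr0.
        by apply: continuous_comp; [exact: continuousB|exact: continuous_dotv].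
      have cc (z : R) : {for (t, x), continuous (fun _ : R * E => z)}.
        exact: cst_continuous.
      exact: (continuousB (continuousD cu (continuousM (cc c) (continuousB c1 (cc t0))))
        (continuousM (cc kappa) (continuousM ca cq))).
  move=> [t x] /set_mem[/=]; rewrite in_itv/= => /andP[t0t tt1] Bx Mmax.
  have {}Mmax s y : t0 <= s -> s <= t1 -> B y -> M (s, y) <= M (t, x).
    by move=> s0 s1 By; apply: Mmax; apply/mem_set; split => //=; rewrite in_itv/= s0.
  have Mp : u p <= M (t, x).
    apply: le_trans (Mmax t0 p (lexx _) t01 Bp).
    by rewrite /M /q /= /p !subrr mulr0 dotv0l !mulr0 addr0 subr0.
  have xg : `|x - gamma t| < e.
    have : kappa * (a t * q t x) <= b'.
      rewrite /M /= in Mp; have ux : u x <= u b by apply: ub; exact: mem_set.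
      have : c * (t - t0) <= `|c| * (t1 - t0).
        apply: le_trans (ler_norm _) _; rewrite normrM ler_wpM2l//.
        by rewrite ger0_norm ?subr_ge0// lerD2r.
      rewrite /b'; lra.
    move=> H; have {}H : kappa * (a t1 * `|x - gamma t| ^+ 2) <= b'.
      apply: le_trans H; rewrite ler_wpM2l// ?(ltW k0)//.
      by apply: ler_pM; rewrite ?expR_ge0 ?sqr_ge0 ?a_ge// sqr_norm_le_dotv.
    have {}H : kappa * a t1 * `|x - gamma t| ^+ 2 < kappa * a t1 * e ^+ 2.
      rewrite -mulrA (le_lt_trans H)// -mulrA /kappa divfK; last first.
        by rewrite lt0r_neq0// mulr_gt0 ?expR_gt0// exprn_gt0.
      by rewrite (le_lt_trans (ler_norm _))// ltrDl.
    have ka1 : 0 < kappa * a t1 by apply: mulr_gt0 => //; exact: expR_gt0.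
    rewrite (ltr_pM2l ka1) in H.
    by rewrite -ltr_sqr ?nnegrE// ltW.
  have [t1t|tlt1] := leP t1 t.
    have Et : t = t1 by apply/le_anti; rewrite tt1 t1t.
    exists x; first by rewrite -Et (lt_le_trans xg)// ge_min lexx.
    apply: le_trans Mp _; rewrite /M/= Et lerBlDr lerDl.
    by apply: mulr_ge0; [exact: ltW|apply: mulr_ge0; [exact: expR_ge0|exact: q0]].
  (* Before [t1], maximality in space makes the penalty a test function touching [u] at x, and
     maximality over later times bounds the time derivative of [M]. The two inequalities together
     contradict l x < c. *)
  exfalso.
  have tgt0 : 0 < t by exact: lt_le_trans t0t.
  have xin : `|x - p| < r2.
    rewrite -(subrKA (gamma t)) (le_lt_trans (ler_normD _ _))//.
    have := gr t t0t tt1; have : e <= r2 / 2 by rewrite ge_min lexx orbT.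
    lra.
  have [Ax lx] := BA x Bx.
  have Ag : A (gamma t) by apply: (BA _ _).1; rewrite /B /=; have := gr t t0t tt1; lra.
  pose g y := kappa * a t * dotv (y - gamma t) (y - gamma t).
  have : transport F l x (u x) (grad g x) <= 0.
    apply: sub; [exact: AA'|exact: C1_scale_dist2|].
    apply/near_distP; exists (r2 - `|x - p|); first by rewrite subr_gt0.
    move=> y yx; have By : B y.
      rewrite /B /= -(subrKA x) (le_trans (ler_normD _ _))//.
      by move: yx; rewrite ltrBrDr => /ltW.
    have := Mmax t y t0t tt1 By; rewrite /M /g /q /=; lra.
  rewrite /transport /g grad_scale_dist2 => Hx.
  have dq : is_derive t 1 (fun s => q s x) (- 2 * dotv (x - gamma t) (F (gamma t))).
    have H : is_derive t 1 (fun s => x - gamma s) (- F (gamma t)).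
      have dgt := dg t tgt0.
      apply: (@is_derive_eq _ _ _ _ _ _ _ _ (is_deriveB (is_derive_cst x _ _) dgt)).
      by rewrite sub0r.
    apply: (@is_derive_eq _ _ _ _ _ _ _ _ (is_derive_dotv H H)).
    rewrite [dotv (x - _) (- _)]dotvC !dotvNl [dotv (F _) _]dotvC; ring.
  have dM : is_derive t 1 (fun s => M (s, x))
      (c - kappa * (- C * a t * q t x + a t * (- 2 * dotv (x - gamma t) (F (gamma t))))).
    rewrite /M /=; apply: is_deriveB.
      have H : is_derive t 1 (fun s => c * (s - t0)) c.
        apply: (@is_derive_eq _ _ _ _ _ _ _ _ (is_deriveZ c
          (is_deriveB (is_derive_id t 1) (is_derive_cst t0 _ _)))).
        by rewrite /GRing.scale/= subr0 mulr1.
      apply: (@is_derive_eq _ _ _ _ _ _ _ _ (is_deriveD (is_derive_cst (u x) _ _) H)).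
      by rewrite add0r.
    apply: (@is_derive_eq _ _ _ _ _ _ _ _ (is_deriveZ kappa (is_deriveM (da t) dq))).
    by rewrite /GRing.scale/=; ring.
  have : c - kappa * (- C * a t * q t x + a t * (- 2 * dotv (x - gamma t) (F (gamma t)))) <= 0.
    apply: derive_le0_right_max dM _; near=> s; apply: Mmax => //.
      by apply: le_trans t0t _; near: s; exact: nbhs_right_ge.
    by near: s; exact: nbhs_right_le.
  have Hd' : dotv (x - gamma t) (F x) - dotv (x - gamma t) (F (gamma t)) <= n%:R * `|L| * q t x.
    rewrite -dotvBr; apply: le_trans (ler_norm _) _; apply: le_trans (dotv_le_norm _ _) _.
    rewrite -mulrA ler_wpM2l ?ler0n//.
    apply: le_trans (ler_wpM2l (normr_ge0 _) (FL x _ Ax Ag)) _.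
    rewrite mulrCA; apply: (@le_trans _ _ (`|L| * (`|x - gamma t| ^+ 2))).
      by rewrite -expr2 ler_wpM2r ?sqr_ge0// ler_norm.
    by rewrite ler_wpM2l// sqr_norm_le_dotv.
  rewrite dotvZl in Hx; move: Hx Hd'.
  set X := dotv _ (F x); set Y := dotv _ (F (gamma t)) => Hx Hd'.
  have ka0 : 0 < kappa * a t by apply: mulr_gt0 => //; exact: expR_gt0.
  have : kappa * a t * (X - Y) <= kappa * a t * (n%:R * `|L| * q t x) by rewrite ler_pM2l.
  rewrite /C; move: lx Hx; set Z := kappa * a t.
  move=> lx Hx H1.
  have -> : kappa * (- (2 * n%:R * `|L|) * a t * q t x + a t * (- 2 * Y)) =
    - 2 * (Z * (n%:R * `|L| * q t x)) - 2 * (Z * Y) by rewrite /Z; ring.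
  move: H1; rewrite mulrBr => H1.
  move: Hx; have -> : 2 * Z * X = 2 * (Z * X) by ring.
  lra.
rewrite leNgt; apply/negP => H.
have Ag1 : A (gamma t1).
  by apply: (BA _ _).1; rewrite /B /=; have := gr t1 t01 (lexx _); lra.
have [eta eta0 Heta] : exists2 eta : R, 0 < eta & forall x, `|x - gamma t1| < eta ->
    u x < u p - c * (t1 - t0).
  by apply/near_distP; apply: (cvgr_lt _ (uc _ Ag1)); rewrite ltrBrDr.
have [x /Heta] := key eta eta0.
by rewrite ltrBrDr ltNge => /negP.
Unshelve. all: by end_near. Qed.

End Transport.

Lemma nbhs_right_itv {R : realType} (a : R) (P : R -> Prop) :
  (\forall t \near a^'+, P t) ->
  exists2 b, a < b & forall t, a < t -> t <= b -> P t.
Proof.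
move=> [e /= e0 H]; exists (a + e / 2); first by rewrite ltrDl divr_gt0.
move=> t at_ tb; apply: H => //=.
by rewrite ltr0_norm ?subr_lt0// opprB; lra.
Qed.

(** * Comparison of two solutions, and solutions obtained from characteristics *)

Section Characteristics.
Context {R : realType} {n : nat}.
Local Notation E := 'rV[R]_n.
Implicit Types (A : set E) (F : E -> E) (u l g : E -> R) (gamma v : R -> E).

Lemma cvg_dotv (T : Type) (G : set_system T) {FG : Filter G} (y z : T -> E) a b :
  y @ G --> a -> z @ G --> b -> dotv (y t) (z t) @[t --> G] --> dotv a b.
Proof.
move=> ya zb.
have H i : y t 0 i * z t 0 i @[t --> G] --> a 0 i * b 0 i.
  apply: cvgM.
    exact: (cvg_comp _ _ ya (@coord_continuous R 1 n 0 i a)).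
  exact: (cvg_comp _ _ zb (@coord_continuous R 1 n 0 i b)).
apply: (@cvg_big R^o _ _ _ _ (@add_continuous R^o)) => i _; exact: H.
Qed.

Lemma visc_supersol_opp A F l u : open A ->
  visc_supersol A (transport F l) u ->
  visc_subsol A (transport F (\- l)) (\- u).
Proof.
move=> oA sup g x Ax cg gx.
have := sup _ x Ax (C1N oA cg); rewrite /transport gradN; last exact: (cg x Ax).1.
rewrite dotvNl /= => H; have {H} : 0 <= - - dotv (grad g x) (F x) - l x.
  by apply: H; apply: filterS gx => y /=; lra.
lra.
Qed.

(** Along [gamma] each solution decreases at the rate of its source, so the sign condition on the
    product says that (u1 - u2)^2 has a nonnegative derivative. Two sets are kept because test
    functions must be C^1 on the whole set where the equation holds: a solution on [A'] does not
    restrict at once to one on [A]. *)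
Lemma visc_comparison A A' F (L : R) u1 u2 l1 l2 gamma z :
  open A -> open A' -> A `<=` A' ->
  (forall x y, A x -> A y -> `|F x - F y| <= L * `|x - y|) ->
  (forall x, A x -> {for x, continuous u1} /\ {for x, continuous u2}) ->
  (forall x, A x -> {for x, continuous l1} /\ {for x, continuous l2}) ->
  visc_subsol A' (transport F l1) u1 -> visc_supersol A' (transport F l1) u1 ->
  visc_subsol A' (transport F l2) u2 -> visc_supersol A' (transport F l2) u2 ->
  (forall x, A x -> 0 <= (u1 x - u2 x) * (l2 x - l1 x)) ->
  (forall t, 0 <= t -> A (gamma t)) ->
  (forall t : R, 0 < t -> is_derive t 1 gamma (F (gamma t))) ->
  gamma t @[t --> 0^'+] --> gamma 0 ->
  gamma t @[t --> +oo] --> z -> A z -> u1 z = u2 z ->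
  u1 (gamma 0) = u2 (gamma 0).
Proof.
move=> oA oA' AA' FL uc lc sub1 sup1 sub2 sup2 mono gA dg g0 gz Az uz.
pose w t := u1 (gamma t) - u2 (gamma t); pose m t := w t ^+ 2.
have wc t : 0 < t -> {for t, continuous w}.
  move=> t0; have gt := is_derive_continuous (dg t t0).
  have [c1 c2] := uc _ (gA _ (ltW t0)).
  exact: (continuousB (continuous_comp gt c1) (continuous_comp gt c2)).
have growth u l : (forall x, A x -> {for x, continuous u}) ->
    (forall x, A x -> {for x, continuous l}) ->
    visc_subsol A' (transport F l) u -> visc_supersol A' (transport F l) u ->
    forall t (e : R), 0 < t -> 0 < e -> exists2 d : R, 0 < d & forall s,
      t <= s -> s <= t + d ->
      `|u (gamma s) - u (gamma t) + l (gamma t) * (s - t)| <= e * (s - t).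
  move=> cu cl sub sup t e t0 e0; have At := gA _ (ltW t0).
  have [|d1 d10 H1] := visc_subsol_growth (c := l (gamma t) + e)
      oA AA' FL cu t0 At (cl _ At) dg sub.
    by rewrite ltrDl.
  have [|d2 d20 H2] := @visc_subsol_growth _ _ A A' F L (\- u) (\- l) gamma t
      (- l (gamma t) + e) oA AA' FL (fun x Ax => continuousN (cu x Ax)) t0 At
      (continuousN (cl _ At)) dg (visc_supersol_opp oA' sup).
    by rewrite /= ltrDl.
  exists (Num.min d1 d2); first by rewrite lt_min d10.
  move=> s ts sd; have sd1 : s <= t + d1.
    by apply: le_trans sd _; rewrite lerD2l ge_min lexx.
  have sd2 : s <= t + d2 by apply: le_trans sd _; rewrite lerD2l ge_min lexx orbT.
  have := H1 s ts sd1; have := H2 s ts sd2; rewrite /= ler_norml; lra.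
have mono_m a b : 0 < a -> a <= b -> m a <= m b.
  move=> a0 ab; apply: dini_nondecreasing => //.
    apply: continuous_in_subspaceT => t; rewrite inE/= in_itv/= => /andP[at_ _].
    have wt := wc t (lt_le_trans a0 at_); exact: (continuousM wt wt).
  move=> t e at_ _ e0; have t0 := lt_le_trans a0 at_.
  have At := gA _ (ltW t0).
  (* Two growth errors e' (s - t) enter the cross term of the square, which is then off by at most 4
     e' |w t| (s - t) <= e (s - t). *)
  have e'0 : 0 < e / (4 * (`|w t| + 1)) by rewrite divr_gt0// mulr_gt0// ltr_wpDl.
  have [d1 d10 H1] := growth u1 l1 (fun x Ax => (uc x Ax).1) (fun x Ax => (lc x Ax).1)
     sub1 sup1 t _ t0 e'0.
  have [d2 d20 H2] := growth u2 l2 (fun x Ax => (uc x Ax).2) (fun x Ax => (lc x Ax).2)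
     sub2 sup2 t _ t0 e'0.
  exists (Num.min d1 d2); first by rewrite lt_min d10.
  move=> s ts sd _; have sd1 : s <= t + d1.
    by apply: le_trans sd _; rewrite lerD2l ge_min lexx.
  have sd2 : s <= t + d2 by apply: le_trans sd _; rewrite lerD2l ge_min lexx orbT.
  have {}H1 := H1 s ts sd1; have {}H2 := H2 s ts sd2.
  set e' := e / _ in e'0 H1 H2.
  pose k := l2 (gamma t) - l1 (gamma t).
  have wk : 0 <= w t * k by exact: mono.
  pose z1 := w s - w t - k * (s - t).
  have z1e : `|z1| <= 2 * e' * (s - t).
    have -> : z1 = (u1 (gamma s) - u1 (gamma t) + l1 (gamma t) * (s - t)) -
       (u2 (gamma s) - u2 (gamma t) + l2 (gamma t) * (s - t)) by rewrite /z1 /w /k; ring.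
    by apply: le_trans (ler_normB _ _) _; lra.
  have H3 : - (`|w t| * (2 * e' * (s - t))) <= w t * z1.
    have : `|w t * z1| <= `|w t| * (2 * e' * (s - t)) by rewrite normrM ler_wpM2l.
    by rewrite ler_norml => /andP[].
  have H4 : `|w t| * (4 * e' * (s - t)) <= e * (s - t).
    rewrite mulrA ler_wpM2r ?subr_ge0// /e'.
    rewrite [leLHS](_ : _ = e * (`|w t| * 4 / (4 * (`|w t| + 1)))); last by ring.
    rewrite ger_pMr// ler_pdivrMr ?mulr_gt0 ?ltr_wpDl//.
    by rewrite mul1r mulrC ler_wpM2l// lerDl.
  have sqw : 0 <= (w s - w t) ^+ 2 by exact: sqr_ge0.
  have H5 : 0 <= w t * k * (s - t) by rewrite mulr_ge0 ?subr_ge0.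
  have -> : m s = m t + 2 * (w t * k * (s - t)) + 2 * (w t * z1) + (w s - w t) ^+ 2.
    by rewrite /m /z1; ring.
  have E1 : `|w t| * (4 * e' * (s - t)) = 2 * (`|w t| * (2 * e' * (s - t))) by ring.
  lra.
have m_oo : m t @[t --> +oo] --> (0 : R).
  have [c1 c2] := uc z Az.
  have -> : 0 = (u1 z - u2 z) * (u1 z - u2 z) :> R by rewrite uz subrr mulr0.
  have wz : w t @[t --> +oo] --> u1 z - u2 z.
    by apply: cvgB; [exact: (cvg_comp _ _ gz c1)|exact: (cvg_comp _ _ gz c2)].
  exact: (cvgM wz wz).
have w0 t : 0 < t -> w t = 0.
  move=> t0; apply/eqP; rewrite -sqrf_eq0 eq_le sqr_ge0 andbT.
  by apply: (cvg_ge_bound m_oo); near=> s; apply: mono_m => //; near: s; exact: nbhs_pinfty_ge.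
have [c1 c2] := uc _ (gA 0 (lexx _)).
have wr : w t @[t --> 0^'+] --> w 0.
  by apply: cvgB; [exact: (cvg_comp _ _ g0 c1)|exact: (cvg_comp _ _ g0 c2)].
apply/eqP; rewrite -subr_eq0; apply/eqP.
apply: (cvg_unique _ wr) => //.
apply: cvg_near_cst; near=> t; apply: w0; near: t; exact: nbhs_right_gt.
Unshelve. all: by end_near. Qed.

(* [gamma] need not be an integral curve of [F]: only its velocity at [x] matters,
   so straight segments are allowed where no solution is available. *)
Definition has_characteristic F l u (x : E) : Prop :=
  exists gamma v (d : R -> R),
  [/\ gamma 0 = x, gamma t @[t --> 0^'+] --> x /\ v t @[t --> 0^'+] --> F x,
      (\forall t \near (0:R)^'+, is_derive (t : R) 1 gamma (v t)),
      (\forall t \near (0:R)^'+, is_derive (t : R) 1 (fun s => u (gamma s)) (- d t)) &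
      u (gamma t) @[t --> 0^'+] --> u x /\ d t @[t --> 0^'+] --> l x].

Lemma has_characteristicN F l u x : has_characteristic F l u x ->
  has_characteristic F (\- l) (\- u) x.
Proof.
move=> [gamma [v [d [g0 gv dg du [ux dx]]]]].
exists gamma, v, (\- d); split => //; last by split; exact: cvgN.
apply: filterS du => t dt; rewrite /= opprK.
by have := is_deriveN dt; rewrite opprK.
Qed.

(** At a local maximum of [u - g], its forward derivative along the curve, - l x - <grad g x, F x>,
    cannot be positive; this is already the subsolution inequality. Since derivatives are known only
    at positive times, the sign is read off the mean value theorem on a short interval. Negating
    [u], [g] and [l] gives the supersolution inequality with the same forward curve. *)
Lemma characteristic_test A F l u g x : open A -> A x -> C1_on A g ->
  has_characteristic F l u x ->
  (\forall y \near x, u y - g y <= u x - g x) ->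
  - dotv (grad g x) (F x) - l x <= 0.
Proof.
move=> oA Ax cg [gamma [v [d [g0 [gx vx] dg du [ux dx]]]]] loc.
rewrite leNgt; apply/negP => K0.
pose m t := g (gamma t) - u (gamma t).
pose D t := dotv (grad g (gamma t)) (v t) + d t.
have Dl : D t @[t --> 0^'+] --> dotv (grad g x) (F x) + l x.
  apply: cvgD => //; apply: cvg_dotv => //.
  exact: (cvg_comp _ _ gx (cg x Ax).2).
have Dneg : dotv (grad g x) (F x) + l x < 0 by lra.
have Al : \forall t \near 0^'+, A (gamma t).
  exact: (gx _ (open_nbhs_nbhs (conj oA Ax))).
have locl : \forall t \near 0^'+, u (gamma t) - g (gamma t) <= u x - g x.
  exact: (gx _ loc).
have Dn : \forall t \near 0^'+, D t < 0 by exact: (cvgr_lt _ Dl).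
have [b b0 Hb] : exists2 b : R, 0 < b & forall t : R, 0 < t -> t <= b ->
    [/\ is_derive t 1 m (D t), D t < 0 & m 0 <= m t].
  apply: nbhs_right_itv; near=> t; split.
  - have d1 : is_derive t 1 (fun s => g (gamma s)) (dotv (grad g (gamma t)) (v t)).
      apply: is_derive_grad; last by near: t.
      by apply: (cg _ _).1; near: t.
    have d2 : is_derive t 1 (fun s => u (gamma s)) (- d t) by near: t.
    apply: (@is_derive_eq _ _ _ _ _ _ _ _ (is_deriveB d1 d2)).
    by rewrite opprK.
  - by near: t; exact: Dn.
  - rewrite /m g0.
    have : u (gamma t) - g (gamma t) <= u x - g x by near: t.
    lra.
have [c [c0 cb]] : exists c, [/\ 0 < c, c < b & m b - m 0 = D c * (b - 0)].
  apply: mvt_right => //; first by move=> t t0 tb; have [] := Hb t t0 tb.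
  rewrite /m g0; apply: cvgB => //.
  exact: (cvg_comp _ _ gx (differentiable_continuous (cg x Ax).1)).
have [_ Dc _] := Hb c c0 (ltW cb); have [_ _ mb] := Hb b b0 (lexx _).
rewrite subr0 => Em; have : D c * b < 0 by rewrite nmulr_rlt0.
lra.
Unshelve. all: by end_near. Qed.

Lemma visc_of_characteristics A F l u : open A ->
  (forall x, A x -> has_characteristic F l u x) ->
  visc_subsol A (transport F l) u /\ visc_supersol A (transport F l) u.
Proof.
move=> oA H; split => g x Ax cg gx.
  exact: characteristic_test oA Ax cg (H x Ax) gx.
have := characteristic_test oA Ax (C1N oA cg) (has_characteristicN (H x Ax)).
rewrite gradN; last exact: (cg x Ax).1.
rewrite dotvNl /transport /= => H1.
have {}H1 : - - dotv (grad g x) (F x) - - l x <= 0.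
  by apply: H1; apply: filterS gx => y; lra.
lra.
Qed.

End Characteristics.

(** * Local Lipschitz bounds *)

Section PowerLipschitz.
Context {R : realType}.
Implicit Types a b k B : R.

Lemma powR_lipschitz a b k B : 0 <= a -> a <= b -> b <= B -> 1 <= k ->
  `|b `^ k - a `^ k| <= k * B `^ (k - 1) * (b - a).
Proof.
move=> a0 ab bB k1; have k0 : 0 < k by exact: lt_le_trans k1.
have mon : a `^ k <= b `^ k.
  by apply: ge0_ler_powR; rewrite ?nnegrE ?(ltW k0)// (le_trans a0).
rewrite ger0_norm ?subr_ge0//.
move: ab; rewrite le_eqVlt => /predU1P[->|ab]; first by rewrite !subrr mulr0.
have dp (t : R) : 0 < t -> is_derive t 1 (fun x => x `^ k) (k * t `^ (k - 1)).
  by move=> t0; exact: is_derive1_powR.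
have [c [ac cb ->]] : exists c, [/\ a < c, c < b &
    b `^ k - a `^ k = k * c `^ (k - 1) * (b - a)].
  apply: (@mvt_right _ (fun x => x `^ k) (fun t => k * t `^ (k - 1))) => //.
    by move=> t at_ _; apply: dp; exact: le_lt_trans at_.
  move: a0; rewrite le_eqVlt => /predU1P[<-|a0].
    by rewrite powR0 ?gt_eqF//; exact: powR_cvg0.
  by apply: cvg_at_right_filter; exact: is_derive_continuous (dp _ a0).
rewrite ler_wpM2r ?subr_ge0 ?(ltW ab)// ler_wpM2l ?(ltW k0)//.
have c0 : 0 <= c by rewrite (le_trans a0)// ltW.
apply: ge0_ler_powR; rewrite ?nnegrE ?subr_ge0//.
  by rewrite (le_trans c0)// (le_trans (ltW cb)).
by rewrite (le_trans (ltW cb)).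
Qed.

(** The base 1 - h may be negative in [Omega]. Two bases of opposite signs are compared through 0,
    where both branches vanish and |a - b| = |a| + |b|; the sign of the negative branch depends on
    [k] alone. *)
Lemma rpow_lipschitz a b k B : `|a| <= B -> `|b| <= B -> 1 <= k ->
  `|rpow a k - rpow b k| <= k * B `^ (k - 1) * `|a - b|.
Proof.
move=> aB bB k1; have k0 : 0 < k by exact: lt_le_trans k1.
have pl x y : 0 <= x -> 0 <= y -> x <= B -> y <= B ->
    `|x `^ k - y `^ k| <= k * B `^ (k - 1) * `|x - y|.
  move=> x0 y0 xB yB; have [yx|/ltW xy] := leP y x.
    by rewrite (ger0_norm (x := x - y)) ?subr_ge0// powR_lipschitz.
  rewrite distrC (distrC x) (ger0_norm (x := y - x)) ?subr_ge0//.
  exact: powR_lipschitz.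
have pl0 x : 0 <= x -> x <= B -> `|x `^ k| <= k * B `^ (k - 1) * x.
  move=> x0 xB; have := pl x 0 x0 (lexx _) xB (le_trans x0 xB).
  by rewrite powR0 ?gt_eqF// !subr0 (ger0_norm x0).
have [s s1 sE] : exists2 s : R, `|s| = 1 & forall y, y < 0 -> rpow y k = s * (- y) `^ k.
  rewrite /rpow; case: asboolP => _.
    by exists (-1); [rewrite normrN1|move=> y y0; rewrite leNgt y0/= mulN1r].
  by exists 1; [rewrite normr1|move=> y y0; rewrite leNgt y0/= mul1r].
have mixed x y : 0 <= x -> y < 0 -> `|x| <= B -> `|y| <= B ->
    `|rpow x k - rpow y k| <= k * B `^ (k - 1) * `|x - y|.
  move=> x0 y0; rewrite (ger0_norm x0) (ltr0_norm y0) => xB yB.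
  rewrite {1}/rpow x0 sE//; apply: le_trans (ler_normB _ _) _.
  rewrite normrM s1 mul1r (_ : `|x - y| = x + - y); last by rewrite ger0_norm//; lra.
  by rewrite mulrDr lerD// pl0// oppr_ge0 ltW.
have [a0|a0] := leP 0 a; have [b0|b0] := leP 0 b.
- by rewrite /rpow a0 b0; apply: pl => //; [move: aB|move: bB]; rewrite ger0_norm.
- exact: mixed.
- by rewrite distrC (distrC a); exact: mixed.
- rewrite !sE// -mulrBr normrM s1 mul1r (distrC a) (_ : b - a = - a - - b); last by ring.
  by rewrite pl ?oppr_ge0 ?(ltW a0) ?(ltW b0)// -ltr0_norm.
Qed.

End PowerLipschitz.

Lemma is_derive_line {R : realType} {V : normedModType R} (a v : V) (t : R) :
  is_derive t 1 (fun s : R => a + s *: v) v.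
Proof.
have did : differentiable (fun s : R => s) t by apply/derivable1_diffP; exact: derivable_id.
have H : is_derive t 1 (fun s : R => s *: v) v.
  apply: DeriveDef.
    by apply/derivable1_diffP; exact: differentiableZl.
  rewrite deriveE; last exact: differentiableZl.
  by rewrite diffZl// diff_val scale1r.
apply: (@is_derive_eq _ _ _ _ _ _ _ _ (is_deriveD (is_derive_cst a _ _) H)).
by rewrite add0r.
Qed.

Section LocalLipschitz.
Context {R : realType} {n : nat}.
Local Notation E := 'rV[R]_n.
Implicit Types (Omega O : set E) (p : E).

(** Only points of [Omega] are compared, as [theta] is bounded away from 0 only there. *)
Definition lip_near {V : normedModType R} Omega p (f : E -> V) : Prop :=
  exists L r : R, [/\ 0 <= L, 0 < r & forall x y, Omega x -> Omega y ->
    `|x - p| < r -> `|y - p| < r -> `|f x - f y| <= L * `|x - y|].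

Lemma lip_near_bounded {V : normedModType R} Omega p (f : E -> V) : Omega p ->
  lip_near Omega p f -> exists B r : R, [/\ 0 <= B, 0 < r &
    forall x, Omega x -> `|x - p| < r -> `|f x| <= B].
Proof.
move=> Op [L [r [L0 r0 H]]]; exists (L * r + `|f p|), r; split => //.
  by rewrite addr_ge0// mulr_ge0// ltW.
move=> x Ox xp; rewrite -[f x](subrK (f p)) (le_trans (ler_normD _ _))// lerD2r.
apply: le_trans (H x p Ox Op xp _) _; first by rewrite subrr normr0.
by rewrite ler_wpM2l// ltW.
Qed.

Lemma lip_nearZ {V : normedModType R} Omega p (s : E -> R) (f : E -> V) : Omega p ->
  lip_near Omega p (s : E -> R^o) -> lip_near Omega p f ->
  lip_near Omega p (fun x => s x *: f x).
Proof.
move=> Op ls lf.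
have [Bs [rs [Bs0 rs0 Hs]]] := lip_near_bounded Op ls.
have [Bf [rf [Bf0 rf0 Hf]]] := lip_near_bounded Op lf.
have [Ls [rs' [Ls0 rs'0 Hs']]] := ls.
have [Lf [rf' [Lf0 rf'0 Hf']]] := lf.
exists (Bs * Lf + Ls * Bf), (Num.min (Num.min rs rf) (Num.min rs' rf')); split.
- by rewrite addr_ge0// mulr_ge0.
- by rewrite !lt_min rs0 rf0 rs'0.
- move=> x y Ox Oy; rewrite !lt_min => /andP[/andP[x1 x2] /andP[x3 x4]].
  move=> /andP[/andP[y1 y2] /andP[y3 y4]].
  have -> : s x *: f x - s y *: f y = s x *: (f x - f y) + (s x - s y) *: f y.
    by rewrite scalerBr scalerBl addrA subrK.
  apply: le_trans (ler_normD _ _) _; rewrite !normrZ mulrDl lerD//.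
    by rewrite -mulrA ler_pM// ?Hs// Hf'.
  by rewrite mulrAC ler_pM// ?Hf// Hs'.
Qed.

Lemma lip_nearV Omega p (s : E -> R) (c : R) : 0 < c ->
  (forall x, Omega x -> c <= s x) ->
  lip_near Omega p (s : E -> R^o) -> lip_near Omega p ((fun x => (s x)^-1) : E -> R^o).
Proof.
move=> c0 cs [L [r [L0 r0 H]]]; exists (c^-1 * c^-1 * L), r; split => //.
  by rewrite !mulr_ge0// invr_ge0 ltW.
move=> x y Ox Oy xp yp.
have sx0 : 0 < s x by exact: lt_le_trans (cs _ Ox).
have sy0 : 0 < s y by exact: lt_le_trans (cs _ Oy).
have -> : (s x)^-1 - (s y)^-1 = (s x)^-1 * (s y)^-1 * (s y - s x).
  by field; rewrite !gt_eqF.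
have H1 : `|s y - s x| <= L * `|x - y| by rewrite distrC; exact: H.
rewrite normrM -[leRHS]mulrA; apply: ler_pM => //.
rewrite normrM !ger0_norm ?invr_ge0 ?(ltW sx0) ?(ltW sy0)//.
by apply: ler_pM; rewrite ?invr_ge0 ?(ltW sx0) ?(ltW sy0)// lef_pV2 ?posrE// cs.
Qed.

(** [Omega] need not be convex: a segment between two of its points may leave it, but stays in a
    ball around [p] on which [g] is C^1 with bounded gradient. *)
Lemma C1_lip_near Omega O p (g : E -> R) : open O -> O p -> C1_on O g ->
  lip_near Omega p (g : E -> R^o).
Proof.
move=> oO Op cg; pose B := `|grad g p| + 1.
have [r r0 Hr] : exists2 r : R, 0 < r & forall x, `|x - p| < r ->
    O x /\ `|grad g x| <= B.
  apply/near_distP; near=> x; split; near: x; first exact: open_nbhs_nbhs.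
  apply: filterS (continuous_near_dist (cg p Op).2 ltr01) => x xp.
  by rewrite -[grad g x](subrK (grad g p)) (le_trans (ler_normD _ _))// addrC lerD2l ltW.
exists (n%:R * B), r; split => //; first by rewrite mulr_ge0 ?ler0n// addr_ge0.
move=> x y _ _ xp yp.
pose gam (t : R) := y + t *: (x - y).
have gamr t : 0 <= t -> t <= 1 -> `|gam t - p| < r.
  move=> t0 t1; have -> : gam t - p = (1 - t) *: (y - p) + t *: (x - p).
    by apply/rowP => i; rewrite !mxE; ring.
  apply: le_lt_trans (ler_normD _ _) _; rewrite !normrZ (ger0_norm t0) ger0_norm ?subr_ge0//.
  have [->|tn0] := eqVneq t 0; first by rewrite subr0 mul1r mul0r addr0.
  have {}t0 : 0 < t by rewrite lt_neqAle eq_sym tn0.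
  have : t * `|x - p| < t * r by rewrite ltr_pM2l.
  have : (1 - t) * `|y - p| <= (1 - t) * r by rewrite ler_wpM2l ?subr_ge0// ltW.
  lra.
have dgam (t : R) : is_derive t 1 gam (x - y) by exact: is_derive_line.
have dg (t : R) : 0 <= t -> t <= 1 ->
    is_derive t 1 (fun s => g (gam s)) (dotv (grad g (gam t)) (x - y)).
  by move=> t0 t1; apply: is_derive_grad => //; exact: (cg _ (Hr _ (gamr t t0 t1)).1).1.
have [c [c0 c1]] : exists c, [/\ 0 < c, c < 1 &
    g (gam 1) - g (gam 0) = dotv (grad g (gam c)) (x - y) * (1 - 0)].
  apply: (@mvt_right _ (fun s => g (gam s)) (fun t => dotv (grad g (gam t)) (x - y))) => //.
    by move=> t t0 t1; apply: dg => //; exact: ltW.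
  by apply: cvg_at_right_filter; exact: is_derive_continuous (dg 0 (lexx _) ler01).
rewrite /gam scale1r scale0r addr0 (addrC y) subrK subr0 mulr1 => ->.
apply: le_trans (dotv_le_norm _ _) _; rewrite -mulrA ler_wpM2l ?ler0n//.
by rewrite ler_wpM2r//; apply: (Hr _ (gamr c (ltW c0) (ltW c1))).2.
Unshelve. all: by end_near. Qed.

(** Local constants say nothing of points far apart. For these the boundedness of [F] is used:
    values differ by at most 2 B, and a distance of at least r / 2 turns this into the constant 2 B
    / (r / 2). *)
Lemma lip_near_compact {V : normedModType R} Omega (F : E -> V) : compact Omega ->
  (forall p, Omega p -> lip_near Omega p F) ->
  (exists B, forall x, Omega x -> `|F x| <= B) /\
  exists L, forall x y, Omega x -> Omega y -> `|F x - F y| <= L * `|x - y|.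
Proof.
move=> /compact_near_coveringP cO lF.
have [B HB] : exists B, forall x, Omega x -> `|F x| <= B.
  have := cO R (pinfty_nbhs R) (fun B x => Omega x -> `|F x| <= B) _.
  case=> [p Op|M [_ H]]; last first.
    by exists (M + 1) => x Ox; apply: (H (M + 1)) => //; rewrite ltrDl.
  have [B [r [B0 r0 H]]] := lip_near_bounded Op (lF p Op).
  have Hr : \forall x \near p, Omega x -> `|F x| <= B.
    by apply/near_distP; exists r => // x xp Ox; exact: H.
  have HM : \forall M \near +oo, B <= M by apply: nbhs_pinfty_ge; rewrite num_real.
  exists ([set x | Omega x -> `|F x| <= B], [set M | B <= M]) => //.
  by move=> [x M] [/= Hx BM] Ox; exact: le_trans (Hx Ox) BM.
split; first by exists B.
have := cO R (pinfty_nbhs R)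
  (fun L x => Omega x -> forall y, Omega y -> `|F x - F y| <= L * `|x - y|) _.
case=> [p Op|M [_ H]]; last first.
  by exists (M + 1) => x y Ox Oy; apply: (H (M + 1)) => //; rewrite ltrDl.
have [L [r [L0 r0 H]]] := lF p Op.
have r20 : 0 < r / 2 by rewrite divr_gt0.
have Hr : \forall x \near p, `|x - p| < r / 2 by apply/near_distP; exists (r / 2).
have HM : \forall M \near +oo, L <= M /\ 2 * B / (r / 2) <= M.
  by near=> M; split; near: M; apply: nbhs_pinfty_ge; rewrite num_real.
exists ([set x | `|x - p| < r / 2], [set M | L <= M /\ 2 * B / (r / 2) <= M]) => //.
move=> [x M] [/= xp [ML MB]] Ox y Oy.
have [yp|yp] := ltP `|y - p| r.
  apply: le_trans (H x y Ox Oy _ yp) _; first by lra.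
  by rewrite ler_wpM2r.
have xy : r / 2 <= `|x - y|.
  have : `|y - p| <= `|y - x| + `|x - p|.
    by rewrite -[y - p](subrKA x) (le_trans (ler_normD _ _)).
  rewrite (distrC y x); lra.
apply: (@le_trans _ _ (2 * B)).
  by apply: le_trans (ler_normB _ _) _; have := HB x Ox; have := HB y Oy; lra.
rewrite ler_pdivrMr// in MB; apply: le_trans MB _.
have B0 : 0 <= B by exact: le_trans (HB x Ox).
by rewrite ler_wpM2l// (le_trans _ ML).
Unshelve. all: by end_near. Qed.

End LocalLipschitz.

(** * Solutions and the value function of a semiflow *)

Section Solutions.
Context {R : realType} {n : nat}.
Local Notation E := 'rV[R]_n.
Context (F : E -> E) (Omega : set E) (L : R).
Hypothesis FL : forall x y, Omega x -> Omega y -> `|F x - F y| <= L * `|x - y|.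
Implicit Types (y z : R -> E).

Lemma solution_cvg0 x y : is_solution F Omega x y -> y t @[t --> 0^'+] --> x.
Proof. by move=> [<- /within_ge0_continuous[_ yc] _ _]. Qed.

Lemma solution_gronwall x x' y z :
  is_solution F Omega x y -> is_solution F Omega x' z ->
  forall t, 0 <= t -> dotv (y t - z t) (y t - z t) <=
    dotv (x - x') (x - x') * expR (2 * n%:R * `|L| * t).
Proof.
move=> sy sz t t0.
have y0 : y 0 = x by case: sy. have z0 : z 0 = x' by case: sz.
have [_ _ yO dy] := sy; have [_ _ zO dz] := sz.
have Em : dotv (x - x') (x - x') = dotv (y 0 - z 0) (y 0 - z 0) by rewrite y0 z0.
rewrite Em; apply: (@gronwall _ (fun t => dotv (y t - z t) (y t - z t))
   (fun t => 2 * dotv (y t - z t) (F (y t) - F (z t)))) => //.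
- move=> s s0; have H := is_deriveB (dy s s0) (dz s s0).
  apply: (@is_derive_eq _ _ _ _ _ _ _ _ (is_derive_dotv H H)).
  by rewrite /= dotvC; ring.
- rewrite y0 z0; apply: cvg_dotv.
    by apply: cvgB; [exact: solution_cvg0 sy|exact: solution_cvg0 sz].
  by apply: cvgB; [exact: solution_cvg0 sy|exact: solution_cvg0 sz].
- move=> s s0; rewrite -!mulrA ler_wpM2l//.
  apply: le_trans (ler_norm _) _; apply: le_trans (dotv_le_norm _ _) _.
  rewrite ler_wpM2l ?ler0n//.
  have := ler_wpM2l (normr_ge0 (y s - z s)) (FL (yO s (ltW s0)) (zO s (ltW s0))).
  move=> /le_trans; apply; rewrite mulrCA.
  apply: (@le_trans _ _ (`|L| * (`|y s - z s| ^+ 2))).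
    by rewrite -expr2 ler_wpM2r ?sqr_ge0// ler_norm.
  by rewrite ler_wpM2l// sqr_norm_le_dotv.
Qed.

Lemma solution_unique x y z : is_solution F Omega x y -> is_solution F Omega x z ->
  forall t, 0 <= t -> y t = z t.
Proof.
move=> sy sz t t0; have := solution_gronwall sy sz t0.
rewrite subrr dotv0l mul0r => H; apply/eqP; rewrite -subr_eq0; apply/eqP.
apply: enorm_eq0; apply/eqP; rewrite -sqrf_eq0 sqr_enorm.
by rewrite eq_le H dotv_ge0.
Qed.

Lemma solution_near (T e : R) : 0 <= T -> 0 < e ->
  exists2 d : R, 0 < d & forall x x' y z,
    is_solution F Omega x y -> is_solution F Omega x' z -> `|x - x'| < d ->
    forall t, 0 <= t -> t <= T -> `|y t - z t| < e.
Proof.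
move=> T0 e0; pose C := 2 * n%:R * `|L|.
have C0 : 0 <= C by rewrite !mulr_ge0// ler0n.
(* Taking [n.+1] keeps K >= 1 even in dimension 0, and K >= 1 gives K * (e / K)^2 <= e^2. *)
pose K := n.+1%:R * expR (C * T).
have K1 : 1 <= K.
  rewrite -[leLHS]mulr1 ler_pM//; first by rewrite ler1n.
  by rewrite -expR0 ler_expR mulr_ge0.
have K0 : 0 < K by exact: lt_le_trans K1.
exists (e / K); first by rewrite divr_gt0.
move=> x x' y z sy sz xx t t0 tT.
have H := solution_gronwall sy sz t0.
rewrite -ltr_sqr ?nnegrE ?(ltW e0)//; apply: le_lt_trans (sqr_norm_le_dotv _) _.
apply: le_lt_trans H _.
have H1 : dotv (x - x') (x - x') * expR (C * t) <= K * `|x - x'| ^+ 2.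
  rewrite /K [leRHS]mulrAC ler_pM ?dotv_ge0 ?expR_ge0//; last first.
    by rewrite ler_expR ler_wpM2l.
  apply: le_trans (ler_norm _) _; apply: le_trans (dotv_le_norm _ _) _.
  by rewrite -expr2 ler_wpM2r ?sqr_ge0// ler_nat.
apply: le_lt_trans H1 _; apply: (@lt_le_trans _ _ (K * (e / K) ^+ 2)).
  by rewrite ltr_pM2l// ltr_sqr ?nnegrE// ltW// divr_gt0.
have -> : K * (e / K) ^+ 2 = e ^+ 2 / K by field; rewrite gt_eqF.
by rewrite ler_pdivrMr// ler_peMr// sqr_ge0.
Qed.

Lemma solution_shift x y (s : R) : 0 <= s -> is_solution F Omega x y ->
  is_solution F Omega (y s) (fun t => y (s + t)).
Proof.
move=> s0 [y0 yc yO dy].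
have dsh (t : R) : is_derive t 1 (fun t => s + t) 1.
  apply: (@is_derive_eq _ _ _ _ _ _ _ _ (is_deriveD (is_derive_cst s _ _) (is_derive_id t 1))).
  by rewrite add0r.
have dys (t : R) : 0 < t -> is_derive t 1 (fun t => y (s + t)) (F (y (s + t))).
  move=> t0; have := dy (s + t) (ltr_wpDl s0 t0).
  rewrite -[in is_derive (s + t) _ _ _](addrC t s).
  move=> [dy1 dy2].
  have -> : (fun t => y (s + t)) = y \o shift s by apply/funext => r /=; rewrite addrC.
  have E : (fun h : R => h^-1 *: ((y \o shift (t + s)) (h *: 1) - y (t + s))) =
     (fun h : R => h^-1 *: (((y \o shift s) \o shift t) (h *: 1) - (y \o shift s) t)).
    by apply/funext => h /=; rewrite addrA.
  apply: DeriveDef.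
    by rewrite /derivable -E.
  by rewrite (addrC s t) -dy2 /derive -E.
split; first by rewrite addr0.
- apply: ge0_continuous_within => [t t0|]; first exact: is_derive_continuous (dys t t0).
  have ext : {for 0, continuous (fun t => y (Num.max (s + t) 0))}.
    apply: (@continuous_comp _ _ _ (fun t => s + t) (fun r => y (Num.max r 0)));
      last exact: continuous_extend_right.
    by apply: continuousD; [exact: cst_continuous|exact: cvg_id].
  have := cvg_at_right_filter ext; rewrite addr0 (max_idPl s0).
  apply: cvg_trans; apply: near_eq_cvg; near=> t.
  by rewrite (max_idPl _)// addr_ge0//; near: t; exact: nbhs_right_ge.
- by move=> t t0; apply: yO; rewrite addr_ge0.
- by move=> t t0; exact: dys.
Unshelve. all: by end_near. Qed.

End Solutions.

(** * Basin of attraction and value function of a semiflow *)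

Section Semiflow.
Context {R : realType} {n : nat}.
Local Notation E := 'rV[R]_n.
Context (F : E -> E) (Omega S : set E) (L B : R) (psi : R -> E -> E).
Hypothesis FL : forall x y, Omega x -> Omega y -> `|F x - F y| <= L * `|x - y|.
Hypothesis Omega_bounded : forall x, Omega x -> `|x| <= B.
Hypothesis S_open : open S.
Hypothesis S_Omega : S `<=` Omega.
Hypothesis psi_solution : forall x, S x -> is_solution F Omega x (psi ^~ x).
Hypothesis psi_S : forall x t, S x -> 0 <= t -> S (psi t x).

(** As [S] is invariant under [psi], safety reduces to the starting point; for the rescaled field
    this will be the safe domain of attraction. *)
Definition basin : set E := [set x | S x /\ psi t x @[t --> +oo] --> (0 : E)].

Hypothesis basin_near0 : \forall x \near (0 : E), basin x.

Lemma psi_add x s t : S x -> 0 <= s -> 0 <= t -> psi (s + t) x = psi t (psi s x).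
Proof.
move=> Sx s0 t0.
exact: (solution_unique FL (solution_shift s0 (psi_solution Sx)) (psi_solution (psi_S Sx s0)) t0).
Qed.

Lemma basin_psi x s : S x -> 0 <= s -> basin (psi s x) <-> basin x.
Proof.
move=> Sx s0; split=> -[S' lim]; split => //.
- have lim' : psi (t - s) (psi s x) @[t --> +oo] --> (0 : E).
    by apply: (cvg_comp _ _ _ lim); exact: cvg_addrr.
  apply: cvg_trans lim'; apply: near_eq_cvg; near=> t.
  by rewrite -psi_add// ?subr_ge0 ?(addrC s) ?subrK//; near: t; exact: nbhs_pinfty_ge.
- exact: psi_S.
- have lim' : psi (s + t) x @[t --> +oo] --> (0 : E).
    by apply: (cvg_comp _ _ _ lim); exact: cvg_addrl.
  apply: cvg_trans lim'; apply: near_eq_cvg; near=> t.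
  by rewrite -psi_add//; near: t; exact: nbhs_pinfty_ge.
Unshelve. all: by end_near. Qed.

Lemma basin_open : open basin.
Proof.
have [d d0 Hd] := (near_distP _ _).1 basin_near0.
rewrite openE => x [Sx lim]; apply/(near_distP x basin).
have d20 : 0 < d / 2 by rewrite divr_gt0.
have [T T0 HT] : exists2 T, 0 <= T & `|psi T x| < d / 2.
  near (pinfty_nbhs R) => T; exists T; first by near: T; exact: nbhs_pinfty_ge.
  by near: T; apply: (cvgr0_norm_lt _ lim).
have [e e0 He] := solution_near FL T0 d20.
have [r r0 Hr] := (near_distP _ _).1 (open_nbhs_nbhs (conj S_open Sx)).
exists (Num.min e r); first by rewrite lt_min e0.
move=> y; rewrite lt_min => /andP[ye yr]; have Sy := Hr y yr.
apply/(basin_psi Sy T0)/Hd; rewrite subr0.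
have := He y x _ _ (psi_solution Sy) (psi_solution Sx) ye T T0 (lexx _).
rewrite -[psi T y in X in _ -> X](subrK (psi T x)) => H.
by apply: le_lt_trans (ler_normD _ _) _; lra.
Unshelve. all: by end_near. Qed.

Lemma psi_origin : F 0 = 0 -> S 0 -> forall t, 0 <= t -> psi t 0 = 0.
Proof.
move=> F0 S0 t t0; have sol0 : is_solution F Omega 0 (fun=> 0).
  split => //.
  - by apply: continuous_subspaceT; exact: cst_continuous.
  - by move=> *; exact: S_Omega.
  - by move=> *; rewrite F0; exact: is_derive_cst.
exact: (solution_unique FL (psi_solution S0) sol0).
Qed.

Lemma away_from_basin : exists2 d : R, 0 < d &
  forall x, S x -> ~ basin x -> forall t, 0 <= t -> d <= `|psi t x|.
Proof.
have [d d0 Hd] := (near_distP _ _).1 basin_near0.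
exists d => // x Sx nb t t0; rewrite leNgt; apply/negP => H.
by apply: nb; apply/(basin_psi Sx t0)/Hd; rewrite subr0.
Qed.

(** [G x t] is the cost accumulated up to time t, given by its derivative. [Vtilde] is handled only
    through upper bounds of this cost, by [Vtilde_leP]. *)
Definition is_cost (G : E -> R -> R) : Prop := forall x, S x ->
  [/\ G x 0 = 0, G x t @[t --> 0^'+] --> (0 : R) &
      forall t : R, 0 < t -> is_derive t 1 (G x) (enorm (psi t x) ^+ 2)].

Lemma psi_continuous x : S x -> {within `[0, +oo[, continuous (psi ^~ x)}.
Proof. by move=> /psi_solution[]. Qed.

Lemma cost_exists : exists G, is_cost G.
Proof.
suff : forall x, exists Gx : R -> R, S x -> [/\ Gx 0 = 0, Gx t @[t --> 0^'+] --> (0 : R) &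
    forall t : R, 0 < t -> is_derive t 1 Gx (enorm (psi t x) ^+ 2)].
  by move=> /choice[G HG]; exists G.
move=> x; have [Sx|nSx] := pselect (S x); last by exists (fun=> 0).
have qc : continuous (fun t : R => enorm (psi (Num.max t 0) x) ^+ 2).
  move=> t; apply: (@continuous_comp _ _ _ (fun t : R => psi (Num.max t 0) x)
    (fun z => enorm z ^+ 2)).
    exact: (continuous_extend_right (psi_continuous Sx)).
  exact: continuous_sqr_enorm.
have [G G0 dG] := @antiderivative R _ setT openT I (fun _ _ _ _ => I) (fun t _ => qc t).
exists G => _; split => //.
  have := cvg_at_right_filter (is_derive_continuous (dG 0 I (ltrN10 _))).
  by rewrite G0.
by move=> t t0; have := dG t I (lt_trans (ltrN10 _) t0); rewrite (max_idPl (ltW t0)).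
Qed.

Context (G : E -> R -> R) (Gcost : is_cost G).

Lemma Vtilde_leP x (M : R) : S x ->
  (Vtilde psi x <= M%:E)%E <-> forall t, 0 <= t -> G x t <= M.
Proof.
move=> Sx; have [G0 Gr dG] := Gcost Sx.
apply: ge0_integral_leP => //; last by rewrite G0.
  by move=> t _; exact: sqr_ge0.
have [pc p0] := within_ge0_continuous (psi_continuous Sx).
apply: ge0_continuous_within => [t t0|].
  apply: (@continuous_comp _ _ _ (psi ^~ x) (fun z => enorm z ^+ 2)); first exact: pc.
  exact: continuous_sqr_enorm.
exact: (cvg_comp _ _ p0 (@continuous_sqr_enorm R n _)).
Qed.

Lemma cost_mono x (s t : R) : S x -> 0 <= s -> s <= t -> G x s <= G x t.
Proof.
move=> Sx s0 st; have [G0 Gr dG] := Gcost Sx.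
apply: (@ge0_derive_le _ (G x) (fun t => enorm (psi t x) ^+ 2)) => //.
- by move=> r sr _; apply: dG; exact: le_lt_trans sr.
- move: s0; rewrite le_eqVlt => /predU1P[<-|s0]; first by rewrite G0.
  by apply: cvg_at_right_filter; exact: is_derive_continuous (dG _ s0).
- by move=> r _ _; exact: sqr_ge0.
Qed.

Lemma cost_add x (s t : R) : S x -> 0 <= s -> 0 <= t ->
  G x (s + t) = G x s + G (psi s x) t.
Proof.
move=> Sx s0 t0; have [G0 Gr dG] := Gcost Sx.
have Sy := psi_S Sx s0; have [H0 Hr dH] := Gcost Sy.
pose m t := G x (s + t) - G (psi s x) t.
have dm (r : R) : 0 < r -> is_derive r 1 m 0.
  move=> r0; have dsh : is_derive r 1 (fun t : R => s + t) 1.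
    apply: (@is_derive_eq _ _ _ _ _ _ _ _ (is_deriveD (is_derive_cst s _ _) (is_derive_id r 1))).
    by rewrite add0r.
  have d1 := is_derive1_comp (dG _ (ltr_wpDl s0 r0)) dsh.
  apply: (@is_derive_eq _ _ _ _ _ _ _ _ (is_deriveB d1 (dH r r0))).
  by rewrite psi_add// ?(ltW r0)// mulr1 subrr.
have : m t = m 0.
  apply: eq0_derive_eq => //; first by move=> r r0 _; exact: dm.
  apply: cvgB; last by rewrite H0.
  rewrite addr0.
  have Gs : G x r @[r --> s^'+] --> G x s.
    move: s0; rewrite le_eqVlt => /predU1P[<-|s0']; first by rewrite G0.
    by apply: cvg_at_right_filter; exact: is_derive_continuous (dG _ s0').
  apply: (cvg_comp (fun r : R => s + r) (G x) _ Gs).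
  move=> P [e /= e0 HP]; exists e => //= r /= re r0; apply: HP => /=.
    by move: re; rewrite sub0r normrN opprD addrA subrr sub0r normrN.
  by rewrite ltrDl.
by rewrite /m addr0 H0 subr0 => /eqP; rewrite subr_eq => /eqP.
Qed.

Hypothesis Vtilde_small : forall e : R, 0 < e -> exists2 d : R, 0 < d &
  forall x : E, `|x| < d -> (Vtilde psi x < e%:E)%E.

Lemma basin_reaches x (e : R) : basin x -> 0 < e ->
  exists2 T, 0 <= T & `|psi T x| < e.
Proof.
move=> [Sx lim] e0; near (pinfty_nbhs R) => T; exists T.
  by near: T; exact: nbhs_pinfty_ge.
by near: T; apply: (cvgr0_norm_lt _ lim).
Unshelve. all: by end_near. Qed.

Lemma Vtilde_ge0 x : (0 <= Vtilde psi x)%E.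
Proof. by apply: integral_ge0 => t _; rewrite lee_fin sqr_ge0. Qed.

(** The cost is finite up to the time of entry into a ball around 0 on which [Vtilde] is below 1. *)
Lemma Vtilde_fin_num x : basin x -> Vtilde psi x \is a fin_num.
Proof.
move=> Dx; have [Sx _] := Dx.
have [d d0 Hd] := Vtilde_small ltr01.
have [T T0 HT] := basin_reaches Dx d0.
have ST := psi_S Sx T0.
have HG := (Vtilde_leP 1 ST).1 (ltW (Hd _ HT)).
rewrite ge0_fin_numE ?Vtilde_ge0//.
apply: (@le_lt_trans _ _ (G x T + 1)%:E); last exact: ltry.
apply/(Vtilde_leP _ Sx) => t t0; have [tT|Tt] := leP t T.
  by apply: le_trans (cost_mono Sx t0 tT) _; rewrite lerDl.
rewrite -[t](subrK T) addrC cost_add ?subr_ge0 ?(ltW Tt)// lerD2l.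
by apply: HG; rewrite subr_ge0 ltW.
Qed.

Local Notation v := (fine \o Vtilde psi).

Lemma fine_Vtilde_leP x (M : R) : basin x ->
  v x <= M <-> forall t, 0 <= t -> G x t <= M.
Proof.
move=> Dx; rewrite -(Vtilde_leP _ Dx.1) -[X in (X <= _)%E](fineK (Vtilde_fin_num Dx)).
by rewrite lee_fin.
Qed.

Lemma fine_Vtilde_ge0 x : 0 <= v x.
Proof. by rewrite /= fine_ge0// Vtilde_ge0. Qed.

Lemma fine_Vtilde_psi x s : basin x -> 0 <= s -> v (psi s x) = v x - G x s.
Proof.
move=> Dx s0; have [Sx _] := Dx; have Ds := (basin_psi Sx s0).2 Dx.
have Vx := (fine_Vtilde_leP _ Dx).1 (lexx _).
have Vs := (fine_Vtilde_leP _ Ds).1 (lexx _).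
apply/le_anti/andP; split.
  apply/(fine_Vtilde_leP _ Ds) => t t0; rewrite lerBrDl -cost_add//.
  by apply: Vx; rewrite addr_ge0.
rewrite lerBlDl; apply/(fine_Vtilde_leP _ Dx) => t t0; have [ts|st] := leP t s.
  by apply: le_trans (cost_mono Sx t0 ts) _; rewrite lerDl fine_Vtilde_ge0.
rewrite -[t](subrK s) addrC cost_add ?subr_ge0 ?(ltW st)// lerD2l.
by apply: Vs; rewrite subr_ge0 ltW.
Qed.

Lemma fine_Vtilde_small (e : R) : 0 < e ->
  exists2 d : R, 0 < d & forall x : E, basin x -> `|x| < d -> v x < e.
Proof.
move=> e0; have [d d0 H] := Vtilde_small e0; exists d => // x Dx xd.
by rewrite -lte_fin fineK ?Vtilde_fin_num// H.
Qed.

Lemma cost_near (T e : R) : 0 <= T -> 0 < e -> exists2 d : R, 0 < d &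
  forall x y, S x -> S y -> `|x - y| < d -> `|G x T - G y T| <= e.
Proof.
(* |psi t x|^2 - |psi t y|^2 is the product of the difference and the sum of the two points, hence
   at most n (|B| + |B|) times their distance; this is integrated up to T, and the 1 keeps [K]
   positive. *)
move=> T0 e0; pose K := n%:R * (`|B| + `|B|) * T + 1.
have K0 : 0 < K by rewrite ltr_wpDl// !mulr_ge0 ?ler0n// addr_ge0.
have eK : 0 < e / K by rewrite divr_gt0.
have [d d0 Hd] := solution_near FL T0 eK; exists d => // x y Sx Sy xy.
suff H : forall x y, S x -> S y -> `|x - y| < d -> G x T - G y T <= e.
  by rewrite ler_norml lerNl opprB !H// distrC.
move=> {x y Sx Sy xy} x y Sx Sy xy.
have [Gx0 Gxr dGx] := Gcost Sx; have [Gy0 Gyr dGy] := Gcost Sy.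
pose m t := e / K * (n%:R * (`|B| + `|B|)) * t - (G x t - G y t).
have : m 0 <= m T.
  apply: (@ge0_derive_le _ m (fun t => e / K * (n%:R * (`|B| + `|B|)) -
     (enorm (psi t x) ^+ 2 - enorm (psi t y) ^+ 2))).
  - exact: T0.
  - move=> t t0 _; apply: is_deriveB; last exact: is_deriveB (dGx t t0) (dGy t t0).
    apply: (@is_derive_eq _ _ _ _ _ _ _ _ (is_deriveZ _ (is_derive_id t 1))).
    by rewrite /GRing.scale/= mulr1.
  - apply: cvgB; last by rewrite Gx0 Gy0; exact: cvgB.
    apply: cvg_at_right_filter; apply: cvgM; [exact: cvg_cst|exact: cvg_id].
  - move=> t t0 tT; rewrite subr_ge0 !sqr_enorm.
    have -> : dotv (psi t x) (psi t x) - dotv (psi t y) (psi t y) =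
        dotv (psi t x - psi t y) (psi t x + psi t y).
      rewrite dotvDr dotvDl dotvDl !dotvNl (dotvC (psi t y) (psi t x)); ring.
    apply: le_trans (ler_norm _) _; apply: le_trans (dotv_le_norm _ _) _.
    rewrite [leRHS]mulrCA ler_wpM2l ?ler0n//; apply: ler_pM => //.
      apply: ltW; exact: (Hd x y _ _ (psi_solution Sx) (psi_solution Sy) xy t (ltW t0) tT).
    apply: le_trans (ler_normD _ _) _.
    have bB z : S z -> `|psi t z| <= `|B|.
      move=> Sz; apply: le_trans (ler_norm B); apply: Omega_bounded.
      by apply: S_Omega; apply: psi_S => //; exact: ltW.
    by rewrite lerD// bB.
rewrite /m mulr0 Gx0 Gy0 subr0 subr0 subr_ge0 => /le_trans; apply.
have -> : e / K * (n%:R * (`|B| + `|B|)) * T = e * (n%:R * (`|B| + `|B|) * T / K).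
  by ring.
by rewrite ler_piMr ?(ltW e0)// ler_pdivrMr// mul1r /K lerDl.
Qed.

(** At a time [T] when the trajectory of x is close to 0, its remaining cost and those of its
    neighbours are below e / 3, while the cost up to [T] depends continuously on the starting
    point. *)
Lemma fine_Vtilde_continuous x : basin x -> {for x, continuous v}.
Proof.
move=> Dx; have [Sx _] := Dx.
apply: (@near_dist_continuous R _ R^o) => e e0; have e3 : 0 < e / 3 by rewrite divr_gt0.
have [d d0 Hd] := fine_Vtilde_small e3.
have [T T0 HT] := basin_reaches Dx d0.
have [b b0 Hb] : exists2 b : R, 0 < b & forall y, `|y - psi T x| < b -> `|y| < d.
  exists (d - `|psi T x|); first by rewrite subr_gt0.
  move=> y H; rewrite -[y](subrK (psi T x)).
  by apply: le_lt_trans (ler_normD _ _) _; rewrite -ltrBrDr.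
have [r1 r10 H1] := solution_near FL T0 b0.
have [r2 r20 H2] := cost_near T0 e3.
have [r3 r30 H3] := (near_distP _ _).1 (open_nbhs_nbhs (conj basin_open Dx)).
apply/near_distP; exists (Num.min r1 (Num.min r2 r3)).
  by rewrite !lt_min r10 r20.
move=> y; rewrite !lt_min => /and3P[y1 y2 y3]; have Dy := H3 y y3; have [Sy _] := Dy.
have Dx' := (basin_psi Sx T0).2 Dx; have Dy' := (basin_psi Sy T0).2 Dy.
have vx := Hd _ Dx' HT.
have vy : v (psi T y) < e / 3.
  apply: Hd => //; apply: Hb.
  exact: (H1 y x _ _ (psi_solution Sy) (psi_solution Sx) y1 T T0 (lexx _)).
have := H2 y x Sy Sx y2; rewrite ler_norml => /andP[].
move: vx vy; rewrite (fine_Vtilde_psi Dx T0) (fine_Vtilde_psi Dy T0).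
have := fine_Vtilde_ge0 (psi T x); have := fine_Vtilde_ge0 (psi T y).
rewrite (fine_Vtilde_psi Dx T0) (fine_Vtilde_psi Dy T0).
rewrite ler_norml; lra.
Qed.

(** [p] may lie outside [S], so the reference solution [gam] is not taken from [psi]. Trajectories
    starting near [p] stay at distance at least d / 2 from 0 up to time [T], which costs at least T
    (d / 2)^2 = |M|. *)
Lemma fine_Vtilde_blowup p (gam : R -> E) (d : R) : 0 < d ->
  is_solution F Omega p gam -> (forall t, 0 <= t -> d <= `|gam t|) ->
  forall M : R, \forall x \near p, basin x -> M <= v x.
Proof.
move=> d0 sg gd M; have d20 : 0 < d / 2 by rewrite divr_gt0.
pose T := `|M| / (d / 2) ^+ 2.
have T0 : 0 <= T by rewrite divr_ge0// sqr_ge0.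
have [r r0 Hr] := solution_near FL T0 d20.
apply/near_distP; exists r => // x xp Dx; have [Sx _] := Dx.
apply: le_trans ((fine_Vtilde_leP _ Dx).1 (lexx _) T T0).
have [G0 Gr dG] := Gcost Sx.
pose m t := G x t - (d / 2) ^+ 2 * t.
have : m 0 <= m T.
  apply: (@ge0_derive_le _ m (fun t => enorm (psi t x) ^+ 2 - (d / 2) ^+ 2)).
  - exact: T0.
  - move=> t t0 _; apply: is_deriveB; first exact: dG.
    apply: (@is_derive_eq _ _ _ _ _ _ _ _ (is_deriveZ _ (is_derive_id t 1))).
    by rewrite /GRing.scale/= mulr1.
  - rewrite /m G0; apply: cvgB => //.
    apply: cvg_at_right_filter; apply: cvgM; [exact: cvg_cst|exact: cvg_id].
  - move=> t t0 tT; rewrite subr_ge0 sqr_enorm.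
    apply: le_trans (sqr_norm_le_dotv _); rewrite ler_sqr ?nnegrE ?(ltW d20)//.
    have := Hr x p _ _ (psi_solution Sx) sg xp t (ltW t0) tT.
    have := gd t (ltW t0).
    have : `|gam t| <= `|psi t x - gam t| + `|psi t x|.
      by rewrite -{1}[gam t](subrK (psi t x)) (le_trans (ler_normD _ _))// distrC.
    lra.
rewrite /m G0 mulr0 subr0 subr_ge0; apply: le_trans.
rewrite /T mulrC divfK ?gt_eqF// ?exprn_gt0//; exact: ler_norm.
Qed.

End Semiflow.

(** * The time change *)

Lemma is_derive_reparam {R : realType} {V : normedModType R} (y : R -> V)
    (T : R -> R) (s c : R) v :
  is_derive (T s) 1 y v -> is_derive s 1 T c ->
  is_derive s 1 (fun s => y (T s)) (c *: v).
Proof.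
move=> [dy yv] [dT Tc]; have /derivable1_diffP dy' := dy.
have /derivable1_diffP dT' := dT.
have dyT : differentiable (y \o T) s by exact: differentiable_comp.
apply: DeriveDef; first exact/derivable1_diffP.
rewrite deriveE// diff_comp//=.
have -> : 'd T s 1 = c by rewrite -Tc deriveE.
have -> : c = c *: (1 : R) :> R by rewrite /GRing.scale/= mulr1.
by rewrite linearZ/= -deriveE// yv /GRing.scale/= mulr1.
Qed.

Lemma lip_near_continuous {R : realType} {n : nat} {V : normedModType R}
    (f : 'rV[R]_n -> V) p : lip_near setT p f -> {for p, continuous f}.
Proof.
move=> [L [r [L0 r0 H]]]; apply: near_dist_continuous => e e0.
have eL : 0 < e / (L + 1) by rewrite divr_gt0// ltr_wpDl.
apply/near_distP; exists (Num.min r (e / (L + 1))); first by rewrite lt_min r0.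
move=> y; rewrite lt_min => /andP[yr ye].
apply: le_trans (H y p I I yr _) _; first by rewrite subrr normr0.
rewrite ltr_pdivlMr in ye; last by rewrite ltr_wpDl.
apply: le_trans (ltW ye); rewrite mulrC ler_wpM2l// lerDl//.
Qed.

Lemma loc_lipschitz_lip_near {R : realType} {n : nat} (f : 'rV[R]_n -> 'rV[R]_n) p :
  loc_lipschitz f -> lip_near setT p f.
Proof.
move=> /(_ p)[A Ap [M [_ HM]]].
have [r r0 Hr] := (near_distP _ _).1 Ap.
exists (`|M| + 1), r; split => //.
move=> x y _ _ xp yp; apply: (HM (`|M| + 1) _ (x, y)).
  by rewrite (le_lt_trans (ler_norm M))// ltrDl.
by split; exact: Hr.
Qed.

Lemma eq_ge0_le_fin {R : realType} (a b : \bar R) : (0 <= a)%E -> (0 <= b)%E ->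
  (forall M : R, (a <= M%:E)%E <-> (b <= M%:E)%E) -> a = b.
Proof.
have key (c d : \bar R) : (0 <= d)%E ->
    (forall M : R, (d <= M%:E)%E -> (c <= M%:E)%E) -> (c <= d)%E.
  by case: d => [r|//|//] _ H; [exact: H|rewrite leey].
by move=> a0 b0 H; apply/le_anti/andP; split; apply: key => // M HM; apply/H.
Qed.

Lemma compact_pos_lower_bound {R : realType} {n : nat} (A : set 'rV[R]_n) (g : 'rV[R]_n -> R) :
  compact A -> (forall x, A x -> {for x, continuous g}) -> (forall x, A x -> 0 < g x) ->
  exists2 c : R, 0 < c & forall x, A x -> c <= g x.
Proof.
move=> cA gc g0; have [[a Aa]|nA] := pselect (A !=set0); last first.
  by exists 1 => // x Ax; exfalso; apply: nA; exists x.
have [c /set_mem cA' H] : exists2 c, c \in A & forall t, t \in A -> g c <= g t.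
  apply: EVT_min_rV => //; first by exists a.
  by apply: continuous_in_subspaceT => x /set_mem; exact: gc.
by exists (g c); [exact: g0|move=> x Ax; apply: H; exact: mem_set].
Qed.

Lemma compact_abs_upper_bound {R : realType} {n : nat} (A : set 'rV[R]_n) (g : 'rV[R]_n -> R) :
  compact A -> (forall x, A x -> {for x, continuous g}) ->
  exists2 M : R, 0 < M & forall x, A x -> `|g x| <= M.
Proof.
move=> cA gc; have [[a Aa]|nA] := pselect (A !=set0); last first.
  by exists 1 => // x Ax; exfalso; apply: nA; exists x.
have [c /set_mem cA' H] : exists2 c, c \in A & forall t, t \in A -> `|g t| <= `|g c|.
  apply: (@EVT_max_rV _ _ (fun x => `|g x|)) => //; first by exists a.
  apply: continuous_in_subspaceT => x /set_mem Ax.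
  by apply: (@continuous_comp _ _ _ g (fun z : R => `|z|)); [exact: gc|exact: norm_continuous].
exists (`|g c| + 1); first by rewrite ltr_wpDl.
by move=> x Ax; rewrite (le_trans (H x (mem_set Ax)))// lerDl.
Qed.

(** * The rescaled field on the safe set and its clock *)

Section SafeSystem.
Context {R : realType} {n : nat}.
Local Notation E := 'rV[R]_n.
Context (f : E -> E) (phi : R -> E -> E) (Omega : set E) (h theta : E -> R) (k : R).
Local Notation S := [set x : E | h x < 1].
Local Notation ft := (ftilde f h theta k).
Hypothesis f_lip : loc_lipschitz f.
Hypothesis phi_flow : is_flow f phi.
Hypothesis h_C1 : C1_on setT h.
Hypothesis Omega_compact : compact Omega.
Hypothesis S_Omega : S `<=` Omega.
Hypothesis k_ge1 : 1 <= k.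
Hypothesis theta_ok : C1b_pos Omega theta.

Lemma h_continuous : continuous h.
Proof. by move=> x; exact: differentiable_continuous (h_C1 I).1. Qed.

Lemma one_minus_h_continuous : continuous (fun x => 1 - h x).
Proof.
by move=> x; apply: continuousB; [exact: cst_continuous|exact: h_continuous].
Qed.

Lemma theta_continuous x : Omega x -> {for x, continuous theta}.
Proof.
by move=> Ox; have [_ _ [Q [_ OQ cQ]]] := theta_ok;
  exact: differentiable_continuous (cQ x (OQ x Ox)).1.
Qed.

Lemma f_continuous : continuous f.
Proof. by move=> x; apply: lip_near_continuous; exact: loc_lipschitz_lip_near. Qed.

Lemma ftilde_lipschitz : exists L, forall x y, Omega x -> Omega y ->
  `|ft x - ft y| <= L * `|x - y|.
Proof.
suff /(lip_near_compact Omega_compact)[] : forall p, Omega p -> lip_near Omega p ft by [].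
move=> p Op; have [th0 _ [Q [opQ OQ cQ]]] := theta_ok.
have [c c0 cth] := compact_pos_lower_bound Omega_compact theta_continuous th0.
have lth := lip_nearV c0 cth (C1_lip_near Omega opQ (OQ p Op) cQ).
have [Lf [rf [Lf0 rf0 Hf]]] := loc_lipschitz_lip_near p f_lip.
have lf : lip_near Omega p f by exists Lf, rf; split => // x y _ _; exact: Hf.
have [M M0 HM] := compact_abs_upper_bound Omega_compact
  (fun x _ => @one_minus_h_continuous x).
have [Lh [rh [Lh0 rh0 Hh]]] := C1_lip_near Omega openT (I : [set: E] p) h_C1.
have lr : lip_near Omega p ((fun x => rpow (1 - h x) k) : E -> R^o).
  exists (k * M `^ (k - 1) * Lh), rh; split => //.
    by rewrite !mulr_ge0 ?powR_ge0// (le_trans ler01).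
  move=> x y Ox Oy xp yp; apply: le_trans (rpow_lipschitz (HM x Ox) (HM y Oy) k_ge1) _.
  rewrite -[leRHS]mulrA ler_wpM2l ?mulr_ge0 ?powR_ge0 ?(le_trans ler01)//.
  rewrite (_ : 1 - h x - (1 - h y) = - (h x - h y)); last by ring.
  by rewrite normrN; exact: Hh.
exact: (lip_nearZ Op (lip_nearZ (V := R^o) Op lr lth) lf).
Qed.

Lemma S_open : open S.
Proof.
apply: (@open_comp _ _ h [set r | r < 1]); last exact: open_lt.
by move=> x _; exact: h_continuous.
Qed.

Section TimeChange.
Context (x : E) (Sx : S x).
(** Freezing the flow before time 0 makes it continuous on the whole line, and all negative times
    safe. *)
Definition forward_flow (t : R) := phi (Num.max t 0) x.
Local Notation gam := forward_flow.

Definition safe_times : set R := [set t | forall s, s <= t -> S (gam s)].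
Local Notation A := safe_times.

(* In the time [s] with [ds/dt = clock_rate t], the flow of [f] solves [y' = ft y]. *)
Definition clock_rate (t : R) := theta (gam t) / rpow (1 - h (gam t)) k.
Local Notation g := clock_rate.

Let phi_x : is_solution f setT x (phi ^~ x) := phi_flow x.

Lemma forward_flow_continuous : continuous gam.
Proof. by have [_ c _ _] := phi_x; exact: (continuous_extend_right c). Qed.

Let gam0 t : t <= 0 -> gam t = x.
Proof. by move=> t0; rewrite /gam (max_idPr t0); case: phi_x. Qed.

Let gamE t : 0 <= t -> gam t = phi t x.
Proof. by move=> t0; rewrite /gam (max_idPl t0). Qed.

Lemma safe_times0 : A 0.
Proof. by move=> s s0; rewrite gam0. Qed.

Lemma safe_times_down s t : s <= t -> A t -> A s.
Proof. by move=> st At r rs; apply: At; exact: le_trans st. Qed.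

Let A_S t : A t -> S (gam t).
Proof. by apply. Qed.

Lemma safe_times_open : open A.
Proof.
rewrite openE => t At; apply/(@near_distP _ R^o t A).
have near_S : \forall r \near t, h (gam r) < 1.
  exact: (cvgr_lt _ (continuous_comp (@forward_flow_continuous t) (@h_continuous _)) _ (A_S At)).
have [e e0 H] := (@near_distP _ R^o t (fun r => h (gam r) < 1)).1 near_S.
exists e => // s se r rs.
have [rt|tr] := leP r t; first exact: At.
apply: H; rewrite ger0_norm ?subr_ge0 ?(ltW tr)//.
by move: se; rewrite ltr_norml => /andP[_]; apply: le_lt_trans; rewrite lerD2r.
Qed.

Let rpow_S z : S z -> rpow (1 - h z) k = (1 - h z) `^ k /\ 0 < (1 - h z) `^ k.
Proof.
move=> /= Sz; have h0 : 0 < 1 - h z by rewrite subr_gt0.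
by rewrite /rpow (ltW h0) powR_gt0.
Qed.

Lemma clock_rate_continuous t : A t -> {for t, continuous g}.
Proof.
move=> At; have St := A_S At.
have h0 : 0 < 1 - h (gam t) by rewrite subr_gt0.
pose g' s := theta (gam s) / (1 - h (gam s)) `^ k.
have : {for t, continuous g'}.
  have c1 : {for t, continuous (fun s => theta (gam s))}.
    exact: (continuous_comp (@forward_flow_continuous t) (theta_continuous (S_Omega St))).
  have c2 : {for t, continuous (fun s => 1 - h (gam s))}.
    exact: (continuous_comp (@forward_flow_continuous t) (@one_minus_h_continuous _)).
  have c3 : {for t, continuous (fun s => (1 - h (gam s)) `^ k)}.
    exact: (continuous_comp c2 (is_derive_continuous (is_derive1_powR k h0))).
  apply: continuousM => //; apply: (continuousV _ c3).
  by rewrite gt_eqF// powR_gt0.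
apply: near_eq_continuous_at.
have := safe_times_open; rewrite openE => /(_ t At); rewrite /interior => H.
by apply: filterS H => s As; rewrite /g /g' (rpow_S (A_S As)).1.
Qed.

Lemma clock_rate_lower : exists2 c : R, 0 < c & forall t, A t -> c <= g t.
Proof.
have [th0 _ _] := theta_ok.
have [c c0 cth] := compact_pos_lower_bound Omega_compact theta_continuous th0.
have [M M0 HM] := compact_abs_upper_bound Omega_compact
  (fun x _ => @one_minus_h_continuous x).
exists (c / M `^ k); first by rewrite divr_gt0// powR_gt0.
move=> t At; have St := A_S At; have [E1 E2] := rpow_S St; have Ot := S_Omega St.
rewrite /g E1; apply: ler_pM; rewrite ?(ltW c0) ?invr_ge0 ?powR_ge0//.
  exact: cth.
rewrite lef_pV2 ?posrE// ?powR_gt0//.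
have k0 : 0 <= k by exact: le_trans ler01 k_ge1.
have h0 : 0 <= 1 - h (gam t) by rewrite subr_ge0 ltW.
apply: ge0_ler_powR; rewrite ?nnegrE ?(ltW M0)//.
exact: le_trans (ler_norm _) (HM _ Ot).
Qed.

Context (G : R -> R) (G0 : G 0 = 0).
Hypothesis dG : forall t : R, A t -> -1 < t -> is_derive t 1 G (g t).

Let dG' t : A t -> 0 <= t -> is_derive t 1 G (g t).
Proof. by move=> At t0; apply: dG => //; exact: lt_le_trans t0. Qed.

Lemma clock_mono s t : 0 <= s -> s <= t -> A t -> G s <= G t.
Proof.
move=> s0 st At; have [c c0 cg] := clock_rate_lower.
apply: (@ge0_derive_le _ G g s t st).
- move=> r sr rt; apply: dG'; first exact: safe_times_down At.
  by rewrite (le_trans s0)// ltW.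
- apply: cvg_at_right_filter; apply: is_derive_continuous (dG' (safe_times_down st At) s0).
- by move=> r sr rt; apply: le_trans (ltW c0) _; apply: cg; exact: safe_times_down At.
Qed.

(** Let eta = 1 - h along the flow of [f]. Its derivative is bounded, and since k >= 1 the product
    of eta and the clock rate g, which is theta / eta^(k - 1), is bounded below. Hence eta' >= - C g
    eta, and eta exp (C G) does not decrease. A bounded clock would then keep eta away from 0 and
    make all times safe, but over an infinite time the lower bound on the rate makes the clock
    unbounded. *)
Lemma clock_unbounded (M : R) : exists t, [/\ A t, 0 <= t & M <= G t].
Proof.
apply: contrapT => nM.
have {nM} GM t : A t -> 0 <= t -> G t < M.
  by move=> At t0; rewrite ltNge; apply/negP => MG; apply: nM; exists t.
have [th0 _ _] := theta_ok.
have [c c0 cth] := compact_pos_lower_bound Omega_compact theta_continuous th0.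
have [B B0 HB] := compact_abs_upper_bound Omega_compact
  (fun x _ => @one_minus_h_continuous x).
have cont z : {for z, continuous (fun z => dotv (grad h z) (f z))}.
  have gc : {for z, continuous (grad h)} by exact: (h_C1 (I : setT z)).2.
  exact: (cvg_dotv gc (@f_continuous z)).
have [L0 L00 HL0] := compact_abs_upper_bound Omega_compact (fun z _ => cont z).
pose eta t := 1 - h (gam t).
(* Chosen so that C g eta >= L0, from theta >= c and eta <= B. *)
pose C := L0 * B `^ (k - 1) / c.
have C0 : 0 <= C by rewrite divr_ge0 ?(ltW c0)// mulr_ge0 ?powR_ge0// ltW.
have deta (t : R) : 0 < t -> is_derive t 1 eta (- dotv (grad h (gam t)) (f (gam t))).
  move=> t0; rewrite gamE ?(ltW t0)//.
  have [_ _ _ dphi] := phi_x.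
  have d1 : is_derive t 1 (fun s => h (phi s x)) (dotv (grad h (phi t x)) (f (phi t x))).
    exact: is_derive_grad (h_C1 (I : setT (phi t x))).1 (dphi t t0).
  have d2 : is_derive t 1 (fun s => 1 - h (phi s x)) (- dotv (grad h (phi t x)) (f (phi t x))).
    apply: (@is_derive_eq _ _ _ _ _ _ _ _ (is_deriveB (is_derive_cst (1 : R) t 1) d1)).
    by rewrite sub0r.
  apply: near_eq_is_derive d2; near=> s; rewrite /eta gamE//.
  by apply: ltW; near: s; exact: lt_nbhsr.
have eta_lower t : A t -> 0 <= t -> eta 0 * expR (- (C * M)) <= eta t.
  move=> At t0.
  have et0 : 0 <= eta t by rewrite subr_ge0 ltW//; exact: A_S.
  have H : eta 0 <= eta t * expR (C * G t).
    have -> : eta 0 = eta 0 * expR (C * G 0) by rewrite G0 mulr0 expR0 mulr1.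
    apply: (@ge0_derive_le _ (fun t => eta t * expR (C * G t))
       (fun t => (- dotv (grad h (gam t)) (f (gam t)) + C * g t * eta t) * expR (C * G t))) => //.
    - move=> s s0 st; have dGs := dG' (safe_times_down st At) (ltW s0).
      have dE : is_derive s 1 (fun s => expR (C * G s)) (C * g s * expR (C * G s)).
        have H := is_deriveZ C dGs.
        apply: (@is_derive_eq _ _ _ _ _ _ _ _ (is_derive1_comp (is_derive_expR _) H)).
        by rewrite mulrC.
      apply: (@is_derive_eq _ _ _ _ _ _ _ _ (is_deriveM (deta s s0) dE)).
      by rewrite /GRing.scale/=; ring.
    - apply: cvgM.
        apply: cvg_at_right_filter.
        exact: (continuous_comp (@forward_flow_continuous 0) (@one_minus_h_continuous _)).
      apply: cvg_at_right_filter.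
      have cG := is_derive_continuous (dG' safe_times0 (lexx 0)).
      apply: (@continuous_comp _ _ _ (fun t => C * G t) expR); last exact: continuous_expR.
      exact: (continuousM (@cst_continuous _ _ C 0) cG).
    - move=> s s0 st; have As := safe_times_down st At; have Ss := A_S As.
      rewrite mulr_ge0 ?expR_ge0//.
      have es0 : 0 < eta s by rewrite subr_gt0.
      have : `|dotv (grad h (gam s)) (f (gam s))| <= L0 by apply: HL0; exact: S_Omega.
      have : L0 <= C * g s * eta s.
        have [E1 E2] := rpow_S Ss.
        rewrite /C /g E1 -/(eta s).
        have -> : eta s `^ k = eta s * eta s `^ (k - 1).
          by rewrite mulr_powRB1 ?(ltW es0)// (lt_le_trans ltr01).
        have p0 : 0 < eta s `^ (k - 1) by exact: powR_gt0.
        have -> : L0 * B `^ (k - 1) / c * (theta (gam s) / (eta s * eta s `^ (k - 1))) * eta s =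
          L0 * ((B `^ (k - 1) / eta s `^ (k - 1)) * (theta (gam s) / c)).
          by field; rewrite !gt_eqF.
        rewrite ler_peMr ?(ltW L00)//.
        rewrite -[leLHS]mulr1 ler_pM// ler_pdivlMr// mul1r.
          apply: ge0_ler_powR; rewrite ?nnegrE ?(ltW es0) ?(ltW B0) ?subr_ge0//.
          by apply: le_trans (ler_norm _) (HB _ _); exact: S_Omega.
        by apply: cth; exact: S_Omega.
      rewrite ler_norml; lra.
  have H2 : expR (C * G t) <= expR (C * M).
    by rewrite ler_expR ler_wpM2l// ltW// GM.
  rewrite expRN -ler_pdivlMr ?invr_gt0 ?expR_gt0// invrK.
  by apply: le_trans H _; rewrite ler_wpM2l.
have e0 : 0 < eta 0 * expR (- (C * M)).
  by rewrite mulr_gt0 ?expR_gt0// subr_gt0; exact: A_S safe_times0.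
(* At a finite supremum of the safe times eta would still be positive by continuity, so the supremum
   would be safe, which openness of the safe times forbids. *)
have Aall t : A t.
  apply: contrapT => nAt.
  have ub s : A s -> s <= t.
    by move=> As; rewrite leNgt; apply/negP => ts; apply: nAt; exact: safe_times_down (ltW ts) As.
  have hs : has_sup A by split; [exists 0; exact: safe_times0|exists t].
  pose tau := sup A.
  have below s : s < tau -> A s.
    move=> st; have [r Ar sr] := sup_gt (ex_intro safe_times 0 safe_times0) st.
    exact: safe_times_down (ltW sr) Ar.
  have notin s : A s -> s < tau.
    move=> As; have [r r0 Hr] := (@near_distP _ R^o s A).1
      (open_nbhs_nbhs (conj safe_times_open As)).
    have : A (s + r / 2).
      by apply: Hr; rewrite addrC addKr ger0_norm; lra.
    move=> /(sup_upper_bound hs); rewrite -/tau; lra.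
  have tau0 : 0 < tau by apply: notin; exact: safe_times0.
  suff /notin : A tau by rewrite ltxx.
  move=> s; rewrite le_eqVlt => /predU1P[->|/below/A_S//].
  have lim : eta s @[s --> tau^'-] --> eta tau.
    apply: cvg_at_left_filter.
    exact: (continuous_comp (@forward_flow_continuous tau) (@one_minus_h_continuous _)).
  have : eta 0 * expR (- (C * M)) <= eta tau.
    apply: (cvg_ge_bound lim); near=> r; apply: eta_lower.
      by apply: below; near: r; exact: nbhs_left_lt.
    by near: r; exact: nbhs_left_ge.
  by move=> /(lt_le_trans e0); rewrite subr_gt0.
have [c' c'0 cg] := clock_rate_lower.
pose t := `|M| / c'.
have t0 : 0 <= t by rewrite divr_ge0// ltW.
have := GM t (Aall t) t0; rewrite ltNge => /negP; apply.
have : G 0 - c' * 0 <= G t - c' * t.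
  apply: (@ge0_derive_le _ (fun t => G t - c' * t) (fun t => g t - c')) => //.
  - move=> s s0 _; apply: is_deriveB; first exact: dG' (ltW s0).
    apply: (@is_derive_eq _ _ _ _ _ _ _ _ (is_deriveZ c' (is_derive_id s 1))).
    by rewrite /GRing.scale/= mulr1.
  - apply: cvg_at_right_filter; apply: cvgB.
      exact: is_derive_continuous (dG' safe_times0 (lexx 0)).
    by apply: cvgM; [exact: cvg_cst|exact: cvg_id].
  - by move=> s s0 _; rewrite subr_ge0 cg.
rewrite G0 mulr0 subr0 subr_ge0; apply: le_trans.
by rewrite /t mulrC divfK ?gt_eqF// ler_norm.
Unshelve. all: by end_near. Qed.

Lemma clock_solution : exists T : R -> R,
  [/\ is_solution ft Omega x (fun s => phi (T s) x),
      forall s, 0 <= s -> [/\ A (T s), 0 <= T s & G (T s) = s] &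
      forall t, A t -> 0 <= t -> T (G t) = t].
Proof.
have [c c0 cg] := clock_rate_lower.
have [T [T0 TA TG Tc dT]] := time_change safe_times_open safe_times0 safe_times_down
  dG c0 cg G0 clock_unbounded.
exists T; split => //.
have phiT s : 0 <= s -> phi (T s) x = gam (T s).
  by move=> /TA[_ T0' _]; rewrite gamE.
have [p0 _ _ dphi] := phi_x.
have dy (s : R) : 0 < s -> is_derive s 1 (fun s => phi (T s) x) (ft (phi (T s) x)).
  move=> s0; have [As Ts0 GTs] := TA s (ltW s0).
  have Tpos : 0 < T s.
    rewrite lt_neqAle Ts0 andbT; apply/negP => /eqP E.
    by move: s0; rewrite -GTs -E G0 ltxx.
  have H := is_derive_reparam (dphi _ Tpos) (dT s s0).
  by move: H; rewrite /ftilde /g invf_div gamE ?(ltW Tpos).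
split.
- by rewrite T0.
- apply: ge0_continuous_within => [s s0|]; first exact: is_derive_continuous (dy s s0).
  have [_ Tr] := within_ge0_continuous Tc.
  have gT : gam (T s) @[s --> 0^'+] --> gam (T 0).
    exact: (cvg_comp _ _ Tr (@forward_flow_continuous _)).
  rewrite phiT//; apply: cvg_trans gT; apply: near_eq_cvg.
  by near=> s; rewrite phiT//; near: s; exact: nbhs_right_ge.
- by move=> s s0; rewrite phiT//; apply/S_Omega/A_S; have [] := TA s s0.
- exact: dy.
Unshelve. all: by end_near. Qed.

(** The clock diverges at a finite exit time tau, so the limit 0 of the rescaled solution would be
    the exit point [gam tau]; but 0 is safe. *)
Lemma safe_forever (y : R -> E) : S 0 -> (forall t, A t -> 0 <= t -> y (G t) = gam t) ->
  y s @[s --> +oo] --> (0 : E) -> forall t, A t.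
Proof.
move=> S0 yG lim t; apply: contrapT => nAt.
have ub s : A s -> s <= t.
  by move=> As; rewrite leNgt; apply/negP => ts; apply: nAt; exact: safe_times_down (ltW ts) As.
have hs : has_sup A by split; [exists 0; exact: safe_times0|exists t].
pose tau := sup A.
have below s : s < tau -> A s.
  move=> st; have [r Ar sr] := sup_gt (ex_intro safe_times 0 safe_times0) st.
  exact: safe_times_down (ltW sr) Ar.
have above s : A s -> s < tau.
  move=> As; have [r r0 Hr] := (@near_distP _ R^o s A).1
      (open_nbhs_nbhs (conj safe_times_open As)).
  have : A (s + r / 2).
    by apply: Hr; rewrite addrC addKr ger0_norm; lra.
  move=> /(sup_upper_bound hs); rewrite -/tau; lra.
suff /above : A tau by rewrite ltxx.
move=> r; rewrite le_eqVlt => /predU1P[->{r}|/below/A_S//].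
have Goo : G s @[s --> tau^'-] --> +oo.
  apply/cvgryPge => M; have [t1 [At1 t10 Mt1]] := clock_unbounded M.
  near=> s; apply: le_trans Mt1 _; apply: clock_mono => //.
    by near: s; apply: nbhs_left_ge; exact: above.
  by apply: below; near: s; exact: nbhs_left_lt.
have lim1 : y (G s) @[s --> tau^'-] --> (0 : E) by exact: (cvg_comp _ _ Goo lim).
have tau0 : 0 < tau by apply: above; exact: safe_times0.
have lim2 : y (G s) @[s --> tau^'-] --> gam tau.
  apply: cvg_trans (cvg_at_left_filter (@forward_flow_continuous tau)).
  apply: near_eq_cvg; near=> s; rewrite yG//.
    by apply: below; near: s; exact: nbhs_left_lt.
  by near: s; exact: nbhs_left_ge.
have -> : gam tau = 0 by exact: (cvg_unique _ lim2 lim1).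
exact: S0.
Unshelve. all: by end_near. Qed.

End TimeChange.
Context (psi : R -> E -> E) (U : set E).
Hypothesis psi_sol : forall x, (exists y, is_solution ft Omega x y) ->
  is_solution ft Omega x (psi ^~ x).
Hypothesis safe_set : ~` U = S.
Hypothesis S_origin : S 0.

(** The inverse clock is hidden here: later arguments need only that [G] reaches every s >= 0 and
    that [psi] at clock time [G t] is the flow of [f] at t. *)
Lemma safe_clock x : S x -> exists G : R -> R,
  [/\ G 0 = 0,
      forall t : R, safe_times x t -> -1 < t -> is_derive t 1 G (clock_rate x t),
      is_solution ft Omega x (psi ^~ x) /\ (forall s, 0 <= s -> S (psi s x)),
      forall s, 0 <= s -> exists t, [/\ safe_times x t, 0 <= t & G t = s] &
      forall t, safe_times x t -> 0 <= t -> psi (G t) x = forward_flow x t].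
Proof.
move=> Sx; have [L FL] := ftilde_lipschitz.
have [G G0 dG] : exists2 G : R -> R, G 0 = 0 &
    forall t : R, safe_times x t -> -1 < t -> is_derive t 1 G (clock_rate x t).
  apply: antiderivative.
  - exact: safe_times_open.
  - exact: safe_times0.
  - exact: safe_times_down.
  - exact: clock_rate_continuous.
have [T [solT TA TG]] := clock_solution Sx G0 dG.
have psix := psi_sol (ex_intro _ _ solT).
have psiT s : 0 <= s -> psi s x = phi (T s) x.
  by move=> s0; exact: (solution_unique FL psix solT).
exists G; split => //.
- split=> // s s0; rewrite psiT//; have [As Ts0 _] := TA s s0.
  by have := As _ (lexx (T s)); rewrite /forward_flow (max_idPl Ts0).
- by move=> s s0; exists (T s); exact: TA.
- move=> t At t0; rewrite psiT ?TG// /forward_flow ?(max_idPl t0)//.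
  by rewrite -G0; apply: clock_mono.
Qed.

Lemma psi_solution_safe x : S x -> is_solution ft Omega x (psi ^~ x).
Proof. by move=> /safe_clock[G [_ _ [? _]]]. Qed.

Lemma psi_safe x t : S x -> 0 <= t -> S (psi t x).
Proof. by move=> /safe_clock[G [_ _ [_ H] _ _]]; exact: H. Qed.

Lemma safe_attraction_domainP x : safe_attraction_domain phi U x <-> basin S psi x.
Proof.
have Sdom z : ~ U z <-> S z by rewrite -safe_set.
have phi0 : phi 0 x = x by case: (phi_flow x).
split=> [[lim nU]|[Sx lim]].
  have Sx : S x by rewrite -phi0; apply/Sdom/nU.
  have [G [G0 dG _ Gs psiG]] := safe_clock Sx.
  have Aall t : safe_times x t.
    by move=> s _; apply/Sdom/nU; rewrite le_max lexx orbT.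
  split => //; apply/cvgr0Pnorm_lt => e e0.
  have /cvgr0Pnorm_lt/(_ e e0)[t0 [_ Ht0]] := lim.
  pose t1 := Num.max (t0 + 1) 0.
  exists (Num.max (G t1) 0); split; first exact: num_real.
  move=> s; rewrite gt_max => /andP[Gs1 s0].
  have [t [At t0' Et]] := Gs s (ltW s0).
  rewrite -Et psiG// /forward_flow (max_idPl t0').
  have t1t : t1 < t.
    rewrite ltNge; apply/negP => tt1; have := clock_mono dG t0' tt1 (Aall _).
    by rewrite Et leNgt Gs1.
  apply: le_lt_trans (norm_le_enorm _) _; apply: le_lt_trans (ler_norm _) _.
  apply: Ht0; apply: lt_trans t1t; apply: (@lt_le_trans _ _ (t0 + 1)); first by rewrite ltrDl.
  by rewrite le_max lexx.
have [G [G0 dG _ Gs psiG]] := safe_clock Sx.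
have Aall := safe_forever Sx G0 dG S_origin psiG lim.
split=> [|t t0]; last first.
  apply/Sdom; have := Aall t _ (lexx t).
  by rewrite /forward_flow (max_idPl t0).
have Goo : G t @[t --> +oo] --> +oo.
  apply/cvgryPge => M; have [t1 [_ t10 Mt1]] := clock_unbounded Sx G0 dG M.
  near=> t; apply: le_trans Mt1 _; apply: (clock_mono dG) => //.
have lim1 : psi (G t) x @[t --> +oo] --> (0 : E) by exact: (cvg_comp _ _ Goo lim).
have : enorm (psi (G t) x) @[t --> +oo] --> enorm (0 : E).
  exact: (cvg_comp _ _ lim1 (@continuous_enorm R n 0)).
rewrite enorm0; apply: cvg_trans; apply: near_eq_cvg; near=> t.
have t0 : 0 <= t by near: t; exact: nbhs_pinfty_ge.
by rewrite psiG// /forward_flow (max_idPl t0).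
Unshelve. all: by end_near. Qed.

(** [omega] is the squared norm times the clock rate, so if [K x] is an antiderivative of |psi|^2,
    then [K x] composed with [G] is one of [omega] along [phi]. As [G] maps [0, +oo[ onto itself,
    the two have the same upper bounds. *)
Lemma value_eq_Vtilde (q0 : E -> R) x : safe_attraction_domain phi U x ->
  value phi U (omega h theta k) q0 x = Vtilde psi x.
Proof.
move=> Dx; have [Sx psilim] := (safe_attraction_domainP x).1 Dx.
have [_ nU] := Dx.
have -> : value phi U (omega h theta k) q0 x =
    (\int[lebesgue_measure]_(t in `[0%R, +oo[) (omega h theta k (phi t x))%:E)%E.
  rewrite /value /exit_time (_ : [set _ | _ in _] = set0) ?ereal_inf0 ?ltxx//.
  by apply/seteqP; split => // y [t [t0 /(nU t t0)]].
have [G [G0 dG _ Gs psiG]] := safe_clock Sx.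
have Sdom z : ~ U z <-> S z by rewrite -safe_set.
have Aall t : safe_times x t.
  by move=> s _; apply/Sdom/nU; rewrite le_max lexx orbT.
have [th0 _ _] := theta_ok.
have [L FL] := ftilde_lipschitz.
have [K HK] := cost_exists psi_solution_safe.
have [K0 Kr dK] := HK x Sx.
pose q t := enorm (forward_flow x t) ^+ 2 * clock_rate x t.
have qE t : 0 <= t -> omega h theta k (phi t x) = q t.
  move=> t0; rewrite /q /omega /clock_rate /forward_flow (max_idPl t0).
  by rewrite mulrCA mulrA.
have qc : continuous q.
  move=> t; have c1 : {for t, continuous (fun t => enorm (forward_flow x t) ^+ 2)}.
    apply: (@continuous_comp _ _ _ (forward_flow x) (fun z => enorm z ^+ 2)).
      exact: forward_flow_continuous.
    exact: continuous_sqr_enorm.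
  exact: (continuousM c1 (clock_rate_continuous (Aall t))).
have q0' t : 0 <= t -> 0 <= q t.
  move=> t0; have [c c0 cg] := clock_rate_lower x.
  by rewrite mulr_ge0 ?sqr_ge0// (le_trans (ltW c0))// cg.
have -> : (\int[lebesgue_measure]_(t in `[0%R, +oo[) (omega h theta k (phi t x))%:E =
    \int[lebesgue_measure]_(t in `[0%R, +oo[) (q t)%:E)%E.
  apply: eq_integral => t; rewrite inE/= in_itv/= andbT => t0.
  by rewrite qE.
have dG' (t : R) : 0 <= t -> is_derive t 1 G (clock_rate x t).
  by move=> t0; apply: dG => //; exact: lt_le_trans t0.
have Gpos t : 0 < t -> 0 < G t.
  move=> t0; have [c c0 cg] := clock_rate_lower x.
  have [r [r0 rt E]] : exists r, [/\ 0 < r, r < t & G t - G 0 = clock_rate x r * (t - 0)].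
    apply: mvt_right => //; first by move=> r r0 _; exact: dG' (ltW r0).
    by apply: cvg_at_right_filter; exact: is_derive_continuous (dG' 0 (lexx _)).
  rewrite G0 !subr0 in E; rewrite E mulr_gt0// (lt_le_trans c0)//.
  exact: cg (Aall r).
have intq M : (\int[lebesgue_measure]_(t in `[0%R, +oo[) (q t)%:E <= M%:E)%E <->
    forall t, 0 <= t -> K x (G t) <= M.
  move: M; apply: ge0_integral_leP => //.
  - exact: continuous_subspaceT.
  - by rewrite G0.
  - rewrite G0 K0; apply/cvgrPdist_lt => e e0.
    have /cvgrPdist_lt/(_ e e0)[d /= d0 Hd] := Kr.
    have Gr : G t @[t --> 0^'+] --> (0 : R).
      rewrite -[X in _ --> X]G0; apply: cvg_at_right_filter.
      exact: is_derive_continuous (dG' 0 (lexx _)).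
    have /cvgrPdist_lt/(_ d d0) Gd := Gr.
    near=> t; apply: Hd; last by apply: Gpos; near: t; exact: nbhs_right_gt.
    by near: t.
  - move=> t t0; have dKt := dK (G t) (Gpos t t0).
    have H := is_derive1_comp dKt (dG' t (ltW t0)).
    apply: (@is_derive_eq _ _ _ _ _ _ _ _ H).
    by rewrite /q psiG// ltW.
apply: eq_ge0_le_fin => [||M].
- by apply: integral_ge0 => t /=; rewrite in_itv/= andbT lee_fin; exact: q0'.
- exact: Vtilde_ge0.
- rewrite (Vtilde_leP psi_solution_safe HK _ Sx); apply: iff_trans (intq M) _.
  split=> H s s0.
    by have [t [_ t0 <-]] := Gs s s0; exact: H.
  by apply: H; rewrite -G0; apply: (clock_mono dG).
Unshelve. all: by end_near. Qed.

Lemma basin_near_origin : loc_asymp_stable f phi -> \forall x \near (0 : E), basin S psi x.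
Proof.
move=> [_ stab [d2 d20 attr]].
have [e e0 He] := (near_distP _ _).1 (open_nbhs_nbhs (conj S_open S_origin)).
have [d1 d10 Hd1] := stab e e0.
have : \forall x \near (0 : E), enorm x < Num.min d1 d2.
  have m0 : 0 < Num.min d1 d2 by rewrite lt_min d10.
  have := continuous_near_dist (@continuous_enorm R n 0) m0.
  by apply: filterS => x; rewrite enorm0 subr0 ger0_norm// sqrtr_ge0.
apply: filterS => x; rewrite lt_min => /andP[x1 x2].
apply/safe_attraction_domainP; split; first exact: attr.
move=> t t0; suff : S (phi t x) by rewrite -safe_set.
apply: He; rewrite subr0; apply: le_lt_trans (norm_le_enorm _) _.
exact: Hd1.
Qed.

End SafeSystem.

(** * The Dirichlet problem *)

Section DirichletProblem.
Context {R : realType} {n : nat}.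
Local Notation E := 'rV[R]_n.
Context (F : E -> E) (Omega S : set E) (L B : R) (psi : R -> E -> E).
Hypothesis FL : forall x y, Omega x -> Omega y -> `|F x - F y| <= L * `|x - y|.
Hypothesis Omega_bounded : forall x, Omega x -> `|x| <= B.
Hypothesis S_open : open S.
Hypothesis S_Omega : S `<=` Omega.
Hypothesis psi_solution : forall x, S x -> is_solution F Omega x (psi ^~ x).
Hypothesis psi_S : forall x t, S x -> 0 <= t -> S (psi t x).
Local Notation D := (basin S psi).
Local Notation v := (fine \o Vtilde psi).
Hypothesis basin_near0 : \forall x \near (0 : E), D x.
Hypothesis Vtilde_small : forall e : R, 0 < e -> exists2 d : R, 0 < d &
  forall x : E, `|x| < d -> (Vtilde psi x < e%:E)%E.
Hypothesis F_origin : F 0 = 0.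

Let S_origin : S 0.
Proof. by have [] := nbhs_singleton basin_near0. Qed.

Let D_origin : D 0. Proof. exact: nbhs_singleton basin_near0. Qed.

Let D_open : open D.
Proof. exact: (basin_open FL S_open psi_solution psi_S basin_near0). Qed.

Let D_S : D `<=` S. Proof. by move=> x []. Qed.

Let D_Omega : D `<=` Omega. Proof. by move=> x /D_S /S_Omega. Qed.

Let D_psi x t : D x -> 0 <= t -> D (psi t x).
Proof. by move=> Dx t0; apply/(basin_psi FL psi_solution psi_S (D_S Dx) t0). Qed.

Let psi0D x : S x -> psi t x @[t --> 0^'+] --> x.
Proof. by move=> Sx; exact: solution_cvg0 (psi_solution Sx). Qed.

Let v_continuous x : D x -> {for x, continuous v}.
Proof.
have [G Gcost] := cost_exists psi_solution.
exact: (fine_Vtilde_continuous FL Omega_bounded S_open S_Omega psi_solution psi_S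
  basin_near0 Gcost Vtilde_small).
Qed.

Let v_ge0 x : 0 <= v x.
Proof. exact: fine_Vtilde_ge0. Qed.

Lemma Vtilde_origin : Vtilde psi 0 = 0%E.
Proof.
rewrite /Vtilde integral0_eq// => t /=; rewrite in_itv/= andbT => t0.
have -> : psi t 0 = 0 by exact: (psi_origin FL S_Omega psi_solution F_origin S_origin).
by rewrite enorm0 expr0n.
Qed.

Let sqr_enorm_psi x : S x -> enorm (psi t x) ^+ 2 @[t --> 0^'+] --> enorm x ^+ 2.
Proof. by move=> Sx; exact: (cvg_comp _ _ (psi0D Sx) (@continuous_sqr_enorm R n x)). Qed.

Let F_psi x : S x -> F (psi t x) @[t --> 0^'+] --> F x.
Proof.
move=> Sx; have Fc : {for x, continuous F}.
  have [r r0 Hr] := (near_distP _ _).1 (open_nbhs_nbhs (conj S_open Sx)).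
  apply: near_dist_continuous => e e0.
  have eL : 0 < e / (`|L| + 1) by rewrite divr_gt0// ltr_wpDl.
  apply/near_distP; exists (Num.min r (e / (`|L| + 1))); first by rewrite lt_min r0.
  move=> y; rewrite lt_min => /andP[yr ye].
  apply: le_trans (FL (S_Omega (Hr y yr)) (S_Omega Sx)) _.
  rewrite ltr_pdivlMr in ye; last by rewrite ltr_wpDl.
  apply: le_trans (ltW ye); rewrite mulrC ler_wpM2l//.
  by rewrite (le_trans (ler_norm L))// lerDl.
exact: (cvg_comp _ _ (psi0D Sx) Fc).
Qed.

Let dpsi x : S x -> \forall t \near (0 : R)^'+, is_derive (t : R) 1 (psi ^~ x) (F (psi t x)).
Proof.
move=> /psi_solution[_ _ _ dp]; near=> t; apply: dp; near: t; exact: nbhs_right_gt.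
Unshelve. all: by end_near. Qed.

Let dv x (t : R) : D x -> 0 < t ->
  is_derive t 1 (fun s => v (psi s x)) (- (enorm (psi t x) ^+ 2)).
Proof.
move=> Dx t0; have [G Gcost] := cost_exists psi_solution.
have [G0 Gr dG] := Gcost x (D_S Dx).
have H : is_derive t 1 (fun s => v x - G x s) (- (enorm (psi t x) ^+ 2)).
  apply: (@is_derive_eq _ _ _ _ _ _ _ _ (is_deriveB (is_derive_cst (v x) t 1) (dG t t0))).
  by rewrite sub0r.
apply: near_eq_is_derive H; near=> s.
rewrite (fine_Vtilde_psi FL psi_solution psi_S Gcost Vtilde_small Dx)//.
by apply: ltW; near: s; exact: lt_nbhsr.
Unshelve. all: by end_near. Qed.

(** [beta] is known to be differentiable only at positive arguments, so the chain rule for [Wt]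
    along a trajectory needs this. *)
Let v_pos x : D x -> x != 0 -> 0 < v x.
Proof.
move=> Dx x0; have Sx := D_S Dx; have [G Gcost] := cost_exists psi_solution.
have [G0 Gr dG] := Gcost x Sx.
have ex : 0 < enorm x ^+ 2.
  rewrite lt_neqAle sqr_ge0 andbT eq_sym sqrf_eq0.
  by apply: contra x0 => /eqP/enorm_eq0 ->.
have [b b0 Hb] : exists2 b : R, 0 < b & forall t, 0 < t -> t <= b -> 0 < enorm (psi t x) ^+ 2.
  by apply: nbhs_right_itv; exact: (cvgr_gt _ (sqr_enorm_psi Sx)).
have [c [c0 cb Ec]] : exists c, [/\ 0 < c, c < b & G x b - G x 0 = enorm (psi c x) ^+ 2 * (b - 0)].
  apply: (@mvt_right _ (G x) (fun t => enorm (psi t x) ^+ 2)) => //.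
    by move=> t t0 _; exact: dG.
  by rewrite G0.
have Gv : G x b <= v x.
  exact: ((fine_Vtilde_leP FL psi_solution psi_S Gcost Vtilde_small _ Dx).1 (lexx _) b (ltW b0)).
apply: lt_le_trans Gv; rewrite G0 !subr0 in Ec; rewrite Ec mulr_gt0//.
exact: Hb (ltW cb).
Qed.

Lemma Vtilde_visc_sol : visc_sol D (Vtilde_eq F) v.
Proof.
suff [H1 H2] : visc_subsol D (transport F (fun x => enorm x ^+ 2)) v /\
    visc_supersol D (transport F (fun x => enorm x ^+ 2)) v.
  split => //; apply: continuous_in_subspaceT => x /set_mem; exact: v_continuous.
apply: visc_of_characteristics => // x Dx; have Sx := D_S Dx.
exists (psi ^~ x), (fun t => F (psi t x)), (fun t => enorm (psi t x) ^+ 2); split.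
- by case: (psi_solution Sx).
- by split; [exact: psi0D|exact: F_psi].
- exact: dpsi.
- by near=> t; apply: dv => //; near: t; exact: nbhs_right_gt.
- split; last exact: sqr_enorm_psi.
  exact: (cvg_comp _ _ (psi0D Sx) (v_continuous Dx)).
Unshelve. all: by end_near. Qed.

Let D_psi_cvg x : D x -> psi t x @[t --> +oo] --> (0 : E).
Proof. by case. Qed.

Let within_pointwise (A : set E) (u : E -> R) : open A -> {within A, continuous u} ->
  forall x, A x -> {for x, continuous u}.
Proof.
move=> oA; rewrite continuous_open_subspace// => uc x Ax.
by apply: uc; exact/mem_set.
Qed.

Lemma Vtilde_unique u : visc_sol D (Vtilde_eq F) u -> u 0 = 0 ->
  forall x, D x -> u x = v x.
Proof.
move=> [uc sub sup] u0 x Dx; have Sx := D_S Dx.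
have [vc vsub vsup] := Vtilde_visc_sol.
have p0 : psi 0 x = x by case: (psi_solution Sx).
rewrite -p0; apply: (@visc_comparison _ _ D D F L u v (fun x => enorm x ^+ 2)
   (fun x => enorm x ^+ 2) (psi ^~ x) 0) => //.
- by move=> y z /D_Omega Oy /D_Omega Oz; exact: FL.
- by move=> y Dy; split; [exact: within_pointwise uc _ Dy|exact: v_continuous].
- by move=> y _; split; exact: continuous_sqr_enorm.
- by move=> y _; rewrite subrr mulr0.
- by move=> t t0; exact: D_psi.
- by case: (psi_solution Sx).
- by rewrite p0; exact: psi0D.
- exact: D_psi_cvg.
- by rewrite u0 /= Vtilde_origin.
Qed.

Context (vphi beta : R -> R).
Hypothesis beta_ok : transformation vphi beta.
Hypothesis Omega_compact : compact Omega.
Hypothesis outside : forall x, Omega x -> ~ S x ->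
  F x = 0 \/ \forall y \near x, ~ S y.

Local Notation Wt := (beta_ext D beta (Vtilde psi)).

Let WtD x : D x -> Wt x = beta (v x).
Proof. by move=> Dx; rewrite /beta_ext mem_set. Qed.

Let WtND x : ~ D x -> Wt x = 1.
Proof. by move=> Dx; rewrite /beta_ext memNset. Qed.

Let beta_ge0 s : 0 <= s -> 0 <= beta s.
Proof. by have [H _ _] := transformation_bounds beta_ok; exact: H. Qed.

Let beta_lt1 s : 0 <= s -> beta s < 1.
Proof. by have [_ H _] := transformation_bounds beta_ok; exact: H. Qed.

Let Wt_ge0 x : 0 <= Wt x.
Proof.
by have [Dx|nDx] := pselect (D x); [rewrite WtD// beta_ge0|rewrite WtND].
Qed.

Let Wt_le1 x : Wt x <= 1.
Proof.
by have [Dx|nDx] := pselect (D x); [rewrite WtD// ltW// beta_lt1|rewrite WtND].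
Qed.

Let Wt_continuous x : Omega x -> {for x, continuous Wt}.
Proof.
move=> Ox; have [Dx|nDx] := pselect (D x).
  have [_ _ _ [_ bc _ _]] := beta_ok.
  have c1 : {for x, continuous (fun y => beta (Num.max (v y) 0))}.
    apply: (@continuous_comp _ _ _ v (fun r => beta (Num.max r 0))).
      exact: v_continuous.
    exact: continuous_extend_right.
  apply: near_eq_continuous_at c1.
  apply: filterS (open_nbhs_nbhs (conj D_open Dx)) => y Dy.
  by rewrite WtD// (max_idPl (v_ge0 y)).
apply: near_dist_continuous => e e0; rewrite WtND//.
have [_ _ blim] := transformation_bounds beta_ok.
have e1 : 1 - e < 1 by rewrite ltrBlDr ltrDl.
have [M HM] := blim _ e1.
have [G Gcost] := cost_exists psi_solution.
have : \forall y \near x, D y -> M <= v y.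
  have [Sx|nSx] := pselect (S x).
    have [d d0 Hd] := away_from_basin FL psi_solution psi_S basin_near0.
    exact: (fine_Vtilde_blowup FL psi_solution psi_S Gcost Vtilde_small d0
      (psi_solution Sx) (Hd x Sx nDx)).
  (* At a zero of [F] the constant solution is the reference for the blow-up; it stays away from 0
     because a ball around 0 lies in the basin. *)
  have [F0|nearS] := outside Ox nSx; last first.
    by apply: filterS nearS => y nSy /D_S.
  have [d d0 Hd] := (near_distP _ _).1 basin_near0.
  apply: (fine_Vtilde_blowup FL psi_solution psi_S Gcost Vtilde_small (gam := fun=> x) d0).
    split => //.
    - by apply: continuous_subspaceT; exact: cst_continuous.
    - by move=> *; rewrite F0; exact: is_derive_cst.
  by move=> t _; rewrite leNgt; apply/negP => xd; apply/nDx/Hd; rewrite subr0.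
apply: filterS => y Hy; have [Dy|nDy] := pselect (D y); last first.
  by rewrite WtND// subrr normr0 ltW.
have := HM (v y) (Hy Dy) (v_ge0 y); have := Wt_le1 y; rewrite -WtD//.
by rewrite ler_norml => H1 H2; apply/andP; split; lra.
Qed.

(** The source obtained by putting [Wt] itself for the unknown. *)
Let lW x := (1 - Wt x) * vphi (Wt x) * enorm x ^+ 2.

Let lW_continuous x : Omega x -> {for x, continuous lW}.
Proof.
move=> Ox; have Wc := Wt_continuous Ox.
have [vc _ _ _] := beta_ok.
have c2 : {for x, continuous (fun y => vphi (Wt y))}.
  have -> : (fun y => vphi (Wt y)) = (fun y => vphi (Num.max (Wt y) 0)).
    by apply/funext => y; rewrite (max_idPl (Wt_ge0 y)).
  apply: (@continuous_comp _ _ _ Wt (fun r => vphi (Num.max r 0))) => //.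
  exact: continuous_extend_right.
have c1 : {for x, continuous (fun y => 1 - Wt y)}.
  by apply: continuousB => //; exact: cst_continuous.
exact: (continuousM (continuousM c1 c2) (@continuous_sqr_enorm R n x)).
Qed.

(** Trajectories serve at the safe points other than 0: along them [Wt] is a function of v inside
    the basin, and is constantly 1 off it. Elsewhere [line] applies: [Wt] is constant along a short
    segment of velocity [F x], because F x = 0 or because no point near x is safe. *)
Let Wt_characteristic x : Omega x -> has_characteristic F lW Wt x.
Proof.
move=> Ox.
have line : (\forall t \near 0^'+, Wt (x + t *: F x) = Wt x) -> lW x = 0 ->
    has_characteristic F lW Wt x.
  move=> W1 l0.
  have gc : {for 0, continuous (fun t : R => x + t *: F x)}.
    exact: is_derive_continuous (is_derive_line x (F x) 0).
  exists (fun t => x + t *: F x), (fun=> F x), (fun=> 0); split.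
  - by rewrite scale0r addr0.
  - split; last exact: cvg_cst.
    by have := cvg_at_right_filter gc; rewrite scale0r addr0.
  - by near=> t; exact: is_derive_line.
  - have [b b0 Hb] := nbhs_right_itv W1.
    near=> t; rewrite oppr0.
    have H : is_derive t 1 (fun _ : R => Wt x) (0 : R) by exact: is_derive_cst.
    apply: near_eq_is_derive H; near=> s; rewrite Hb//.
      by near: s; apply: lt_nbhsr; near: t; exact: nbhs_right_gt.
    apply: ltW; near: s; apply: lt_nbhsl; near: t; exact: nbhs_right_lt.
  - split; last by rewrite l0; exact: cvg_cst.
    by apply: cvg_near_cst.
(* The origin is set apart: v vanishes there, where no derivative of [beta] is given. *)
have [x0|x0] := eqVneq x 0; last first.
have [Dx|nDx] := pselect (D x).
  have Sx := D_S Dx; have [_ _ _ [_ _ _ db]] := beta_ok.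
  exists (psi ^~ x), (fun t => F (psi t x)), (fun t => lW (psi t x)); split.
  - by case: (psi_solution Sx).
  - by split; [exact: psi0D|exact: F_psi].
  - exact: dpsi.
  - have nz : \forall t \near 0^'+, psi t x != 0.
      have ex : 0 < enorm x ^+ 2.
        rewrite lt_neqAle sqr_ge0 andbT eq_sym sqrf_eq0.
        by apply: contra x0 => /eqP/enorm_eq0 ->.
      have gtp : \forall t \near 0^'+, 0 < enorm (psi t x) ^+ 2.
        exact: (cvgr_gt _ (sqr_enorm_psi Sx)).
      apply: filterS gtp => t.
      by apply: contraTneq => ->; rewrite enorm0 expr0n ltxx.
    near=> t.
    have t0 : 0 < t by near: t; exact: nbhs_right_gt.
    have pz : psi t x != 0 by near: t.
    have Dt := D_psi Dx (ltW t0).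
    have vp := v_pos Dt pz.
    have H := is_derive1_comp (db _ vp) (dv Dx t0).
    have {}H : is_derive t 1 (fun s => beta (v (psi s x))) (- lW (psi t x)).
      apply: (@is_derive_eq _ _ _ _ _ _ _ _ H).
      by rewrite /lW WtD// mulrN.
    apply: near_eq_is_derive H; near=> s; rewrite WtD//; apply: D_psi => //.
    by apply: ltW; near: s; exact: lt_nbhsr.
  - split.
      exact: (cvg_comp _ _ (psi0D Sx) (Wt_continuous Ox)).
    exact: (cvg_comp _ _ (psi0D Sx) (lW_continuous Ox)).
have l0 : lW x = 0 by rewrite /lW WtND// subrr !mul0r.
have [Sx|nSx] := pselect (S x).
  have W1 t : 0 <= t -> Wt (psi t x) = 1.
    by move=> t0; rewrite WtND// => /(basin_psi FL psi_solution psi_S Sx t0).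
  exists (psi ^~ x), (fun t => F (psi t x)), (fun=> 0); split.
  - by case: (psi_solution Sx).
  - by split; [exact: psi0D|exact: F_psi].
  - exact: dpsi.
  - near=> t; rewrite oppr0.
    have H : is_derive t 1 (fun _ : R => 1 : R) (0 : R) by exact: is_derive_cst.
    apply: near_eq_is_derive H; near=> s; rewrite W1//.
    by apply: ltW; near: s; apply: lt_nbhsr; near: t; exact: nbhs_right_gt.
  - split; last by rewrite l0; exact: cvg_cst.
    exact: (cvg_comp _ _ (psi0D Sx) (Wt_continuous Ox)).
apply: line => //; have [F0|nearS] := outside Ox nSx.
  by near=> t; rewrite F0 scaler0 addr0.
have gc : {for 0, continuous (fun t : R => x + t *: F x)}.
  exact: is_derive_continuous (is_derive_line x (F x) 0).
have gx : (x + t *: F x) @[t --> 0^'+] --> x.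
  by have := cvg_at_right_filter gc; rewrite scale0r addr0.
have gS : \forall t \near 0^'+, ~ S (x + t *: F x) by exact: (gx _ nearS).
apply: filterS gS => t nSt.
by rewrite !WtND// => /D_S.
apply: line; first by near=> t; rewrite x0 F_origin scaler0 addr0.
by rewrite /lW x0 enorm0 expr0n mulr0.
Unshelve. all: by end_near. Qed.

Let D_interior x : D x -> interior Omega x.
Proof. by move=> Dx; apply: filterS (open_nbhs_nbhs (conj D_open Dx)); exact: D_Omega. Qed.

Let Wt_origin : Wt 0 = 0.
Proof.
by have [_ _ _ [b0 _ _ _]] := beta_ok; rewrite WtD//= Vtilde_origin.
Qed.

Let Wt_visc : visc_subsol (interior Omega) (transport F lW) Wt /\
  visc_supersol (interior Omega) (transport F lW) Wt.
Proof.
apply: visc_of_characteristics; first exact: open_interior.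
by move=> x /interior_subset; exact: Wt_characteristic.
Qed.

Lemma Wtilde_visc_sol : dirichlet_visc_sol Omega (Wtilde_eq F vphi Wt) Wt.
Proof.
have [sub sup] := Wt_visc.
split=> //.
- by apply: continuous_in_subspaceT => x /set_mem; exact: Wt_continuous.
- split=> //; apply: continuous_in_subspaceT => x /set_mem /interior_subset.
  exact: Wt_continuous.
- by move=> x [_ nOx]; apply: WtND => /D_interior.
Qed.

Let vphi_gt0 s : 0 <= s -> 0 < vphi s.
Proof. by have [_ H _ _] := beta_ok; exact: H. Qed.

Let Wtilde_unique_basin u :
  dirichlet_visc_sol Omega (Wtilde_eq F vphi Wt) u -> forall x, D x -> u x = Wt x.
Proof.
move=> [_ [uc sub sup] u0 _] x Dx; have Sx := D_S Dx.
have [wsub wsup] := Wt_visc.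
have p0 : psi 0 x = x by case: (psi_solution Sx).
(* The source of u with its value frozen; [lW] minus this is (u - Wt) * vphi (Wt) * |y|^2, of the
   sign that the comparison asks for. *)
pose l y := (1 - u y) * vphi (Wt y) * enorm y ^+ 2.
have ucD y : D y -> {for y, continuous u}.
  by move=> /D_interior; apply: within_pointwise uc _; exact: open_interior.
rewrite -p0; apply: (@visc_comparison _ _ D (interior Omega) F L u Wt l lW (psi ^~ x) 0) => //.
- exact: open_interior.
- by move=> y z /D_Omega Oy /D_Omega Oz; exact: FL.
- by move=> y Dy; split; [exact: ucD|exact/Wt_continuous/D_Omega].
- move=> y Dy; split; last exact/lW_continuous/D_Omega.
  have [vc _ _ _] := beta_ok.
  have c2 : {for y, continuous (fun y => vphi (Wt y))}.
    have -> : (fun y => vphi (Wt y)) = (fun y => vphi (Num.max (Wt y) 0)).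
      by apply/funext => z; rewrite (max_idPl (Wt_ge0 z)).
    apply: (@continuous_comp _ _ _ Wt (fun r => vphi (Num.max r 0))) => //.
      exact/Wt_continuous/D_Omega.
    exact: continuous_extend_right.
  have c1 : {for y, continuous (fun y => 1 - u y)}.
    by apply: continuousB; [exact: cst_continuous|exact: ucD].
  exact: (continuousM (continuousM c1 c2) (@continuous_sqr_enorm R n y)).
- move=> y Dy; rewrite /l /lW.
  have -> : (u y - Wt y) * ((1 - Wt y) * vphi (Wt y) * enorm y ^+ 2 -
      (1 - u y) * vphi (Wt y) * enorm y ^+ 2) =
      (u y - Wt y) ^+ 2 * vphi (Wt y) * enorm y ^+ 2 by ring.
  have vW := ltW (vphi_gt0 (Wt_ge0 y)).
  by apply: mulr_ge0; [apply: mulr_ge0|]; rewrite ?sqr_ge0.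
- by move=> t t0; exact: D_psi.
- by case: (psi_solution Sx).
- by rewrite p0; exact: psi0D.
- exact: D_psi_cvg.
- by rewrite u0 Wt_origin.
Qed.

(* Off the basin the equation has the sign of a strict maximum principle: at an
   interior extremum of [u - Wt] a constant test function is admissible. *)
Lemma Wtilde_unique u : dirichlet_visc_sol Omega (Wtilde_eq F vphi Wt) u ->
  forall x, Omega x -> u x = Wt x.
Proof.
move=> usol x Ox; have uD := Wtilde_unique_basin usol.
have [uc [_ sub sup] u0 uF] := usol.
have dc : {within Omega, continuous (fun y => u y - Wt y)}.
  move=> y; apply: (@continuousB _ _ (subspace Omega) u Wt); first exact: uc.
  by apply: continuous_in_subspaceT => z /set_mem; exact: Wt_continuous.
have On0 : Omega !=set0 by exists x.
have interior_of z : Omega z -> u z != Wt z -> interior Omega z /\ ~ D z.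
  move=> Oz uz; split; last by move=> /uD E; rewrite E eqxx in uz.
  apply: contrapT => nz; move: uz; rewrite uF ?WtND ?eqxx//.
    by move=> /D_interior.
  by split => //; exact: subset_closure.
have strict z : ~ D z -> 0 < vphi (Wt z) * enorm z ^+ 2.
  move=> nDz; rewrite mulr_gt0 ?vphi_gt0// lt_neqAle sqr_ge0 andbT eq_sym sqrf_eq0.
  by apply/negP => /eqP/enorm_eq0 z0; apply: nDz; rewrite z0.
have upper : u x - Wt x <= 0.
  have [z /set_mem Oz zmax] := EVT_max_rV On0 Omega_compact dc.
  apply: le_trans (zmax x (mem_set Ox)) _; rewrite leNgt; apply/negP => uz.
  have [iz nDz] : interior Omega z /\ ~ D z.
    by apply: interior_of => //; move: uz; rewrite subr_gt0 => /gt_eqF ->.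
  have near_z : \forall y \near z, u y - 0 <= u z - 0.
    (* Off the basin [Wt] has its largest value 1, so a maximum of [u - Wt] at z is also a local
       maximum of u. *)
    apply: filterS iz => y Oy; have := zmax y (mem_set Oy).
    by have := Wt_le1 y; rewrite (WtND nDz); lra.
  have := sub (fun=> 0) z iz (@C1_cst R n _ 0) near_z.
  rewrite /Wtilde_eq grad_cst dotv0l oppr0 sub0r -mulrA oppr_le0 pmulr_lge0 ?strict//.
  by move: uz; rewrite (WtND nDz); lra.
have lower : 0 <= u x - Wt x.
  have [z /set_mem Oz zmin] := EVT_min_rV On0 Omega_compact dc.
  apply: le_trans (zmin x (mem_set Ox)); rewrite leNgt; apply/negP => uz.
  have [iz nDz] : interior Omega z /\ ~ D z.
    by apply: interior_of => //; move: uz; rewrite subr_lt0 => /lt_eqF ->.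
  (* Here Wt <= 1 goes the wrong way. But the difference stays negative near z while it vanishes on
     the basin, so no point near z is in the basin, and [Wt] is locally the constant 1. *)
  have near_z : \forall y \near z, u z - 0 <= u y - 0.
    have uWc : {for z, continuous (fun y => u y - Wt y)}.
      apply: continuousB; last exact: Wt_continuous.
      have uc' : {within interior Omega, continuous u}.
        by apply: continuous_subspaceW uc; exact: interior_subset.
      exact: within_pointwise (@open_interior _ Omega) uc' _ iz.
    have uz2 : 0 < - (u z - Wt z) by rewrite oppr_gt0.
    have nn := continuous_near_dist uWc uz2.
    near=> y.
    have Oy : Omega y by near: y.
    have : `|(u y - Wt y) - (u z - Wt z)| < - (u z - Wt z) by near: y.
    rewrite ltr_norml => /andP[_ uy].
    have nDy : ~ D y by move=> /uD Ey; move: uy; rewrite Ey; lra.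
    have := zmin y (mem_set Oy); rewrite (WtND nDz) (WtND nDy); lra.
  have := sup (fun=> 0) z iz (@C1_cst R n _ 0) near_z.
  rewrite /Wtilde_eq grad_cst dotv0l oppr0 sub0r -mulrA oppr_ge0 pmulr_lle0 ?strict//.
  by move: uz; rewrite (WtND nDz); lra.
apply/eqP; rewrite -subr_eq0 eq_le upper lower//.
Unshelve. all: by end_near. Qed.

End DirichletProblem.

(** Where h x = 1 the factor (1 - h)^k vanishes, and where h x > 1 a whole neighbourhood is
    unsafe. *)
Lemma ftilde_off_safe {R : realType} {n : nat}
    (f : 'rV[R]_n -> 'rV[R]_n) (h theta : 'rV[R]_n -> R) k x :
  continuous h -> 1 <= k -> ~ h x < 1 ->
  ftilde f h theta k x = 0 \/ \forall y \near x, ~ h y < 1.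
Proof.
move=> hc k1 /negP; rewrite -leNgt le_eqVlt => /predU1P[hx|hx]; [left|right].
  rewrite /ftilde -hx subrr /rpow lexx powR0 ?mul0r ?scale0r//.
  by rewrite gt_eqF// (lt_le_trans ltr01).
have hx0 : 0 < h x - 1 by rewrite subr_gt0.
have := continuous_near_dist (hc x) hx0; apply: filterS => y.
by rewrite ltr_norml => /andP[H _]; apply/negP; rewrite -leNgt; lra.
Qed.

Theorem theorem3 (R : realType) (n : nat)
    (f : 'rV[R]_n -> 'rV[R]_n) (phi psi : R -> 'rV[R]_n -> 'rV[R]_n)
    (U Omega : set 'rV[R]_n) (h theta q0 : 'rV[R]_n -> R) (k : R)
    (vphi beta : R -> R)
    (D := safe_attraction_domain phi U)
    (w := omega h theta k)
    (V := value phi U w q0)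
    (ft := ftilde f h theta k)
    (Vt := Vtilde psi)
    (W := beta_ext D beta V)
    (Wt := beta_ext D beta Vt)
    (f_lip : loc_lipschitz f)
    (phi_flow : is_flow f phi)
    (stable0 : loc_asymp_stable f phi)
    (safe : safe_set_conditions U h)
    (D0_nontrivial : attraction_domain phi `\ 0 !=set0)
    (q0_ok : exit_cost_ok U q0)
    (Omega_compact : compact Omega)
    (safe_Omega : ~` U `<=` Omega)
    (k_ge1 : 1 <= k)
    (pow_defined : forall x, Omega x -> rpow_defined (1 - h x) k)
    (theta_ok : C1b_pos Omega theta)
    (w_ok : running_cost_conditions phi U w q0)
    (beta_ok : transformation vphi beta)
    (* psi ^~ x is the solution from x, whenever there is one on [0, +oo[ in
       Omega, the set where ft is defined *)
    (psi_sol : forall x, (exists y, is_solution ft Omega x y) ->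
                 is_solution ft Omega x (psi ^~ x)) :
  [/\ forall x, D x -> Vt x \is a fin_num,
      visc_sol D (Vtilde_eq ft) (fine \o Vt) /\ fine (Vt 0) = 0,
      forall u, visc_sol D (Vtilde_eq ft) u -> u 0 = 0 ->
        forall x, D x -> u x = fine (Vt x) &
      forall x, D x -> Vt x = V x] /\
  [/\ dirichlet_visc_sol Omega (Wtilde_eq ft vphi Wt) Wt,
      forall u, dirichlet_visc_sol Omega (Wtilde_eq ft vphi Wt) u ->
        forall x, Omega x -> u x = Wt x &
      forall x, (~` U) x -> Wt x = W x].
Proof.
have [SE hC1 _ [_ _] S0U] := safe.
have S0 : h 0 < 1 by have : (~` U) 0 by []; rewrite SE.
have SO : [set x | h x < 1] `<=` Omega by rewrite -SE.
have hc : continuous h by move=> x; exact: differentiable_continuous (hC1 x I).1.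
have [L FL] := ftilde_lipschitz f_lip hC1 Omega_compact k_ge1 theta_ok.
have psol := psi_solution_safe f_lip phi_flow hC1 Omega_compact SO k_ge1 theta_ok psi_sol.
have psafe := psi_safe f_lip phi_flow hC1 Omega_compact SO k_ge1 theta_ok psi_sol.
have DP := safe_attraction_domainP f_lip phi_flow hC1 Omega_compact SO k_ge1 theta_ok
  psi_sol SE S0.
have DE : D = basin [set x | h x < 1] psi.
  by apply/seteqP; split => x /DP.
have VE x : D x -> V x = Vt x.
  exact: (value_eq_Vtilde f_lip phi_flow hC1 Omega_compact SO k_ge1 theta_ok psi_sol SE S0).
have near0 := basin_near_origin f_lip phi_flow hC1 Omega_compact SO k_ge1 theta_ok
  psi_sol SE S0 stable0.
have [M bOmega] : exists M : R, forall x, Omega x -> `|x| <= M.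
  have [M [_ HM]] := compact_bounded Omega_compact.
  by exists (M + 1) => x Ox; apply: (HM (M + 1)) => //; rewrite ltrDl.
(* The smallness of [V] near 0 passes to [Vt], because a neighbourhood of 0 lies in D, where the two
   agree. *)
have small (e : R) : 0 < e ->
    exists2 d : R, 0 < d & forall x, `|x| < d -> (Vt x < e%:E)%E.
  have [_ _ _ _ Vsmall] := w_ok; move=> e0; have [d d0 Hd] := Vsmall e e0.
  have : \forall x \near (0 : 'rV[R]_n), D x /\ enorm x < d.
    near=> x; split; first by rewrite DE; near: x.
    near: x; apply: filterS (continuous_near_dist (@continuous_enorm R n 0) d0) => x.
    by rewrite enorm0 subr0 ger0_norm// sqrtr_ge0.
  move=> /near_distP[r r0 Hr]; exists r => // x xr.
  have [|Dx xd] := Hr x; first by rewrite subr0.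
  by rewrite -(VE _ Dx); exact: Hd.
have ft0 : ft 0 = 0 by have [f0 _ _] := stable0; rewrite /ft /ftilde f0 scaler0.
have So := S_open hC1.
have [G Gcost] := cost_exists psol.
have off x : Omega x -> ~ [set x | h x < 1] x ->
    ft x = 0 \/ \forall y \near x, ~ [set x | h x < 1] y.
  by move=> _; exact: ftilde_off_safe.
rewrite /Wt /W DE; split; split.
- exact: (Vtilde_fin_num FL psol psafe Gcost small).
- split; last by rewrite /Vt (Vtilde_origin FL SO psol near0 ft0).
  exact: (Vtilde_visc_sol FL bOmega So SO psol psafe near0 small).
- exact: (Vtilde_unique FL bOmega So SO psol psafe near0 small ft0).
- by move=> x; rewrite -DE => /VE.
- exact: (Wtilde_visc_sol FL bOmega So SO psol psafe near0 small ft0 beta_ok off).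
- exact: (Wtilde_unique FL bOmega So SO psol psafe near0 small ft0 beta_ok Omega_compact off).
- move=> x _; rewrite /beta_ext; case: ifPn => // /set_mem; rewrite -DE => Dx.
  by rewrite VE.
Unshelve. all: by end_near. Qed.
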